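(* Let $\mathcal I=\langle I,\in^{\mathcal I}\rangle$ be a countable recursively saturated $\mathcal L$-structure with $\mathcal I\models\text{Infinity}$. The following are equivalent: (I) $\mathcal I\models\mathrm{MOST}+\Delta_0^{\mathcal P}\text{-collection}$; (II) there is an $\mathcal L$-structure $\mathcal M\models\mathrm{MOST}$ and a non-trivial automorphism $j:\mathcal M\to\mathcal M$ such that $\mathcal I_{\mathrm{fix}}(j)=\mathcal I$.
   Context: $\mathcal{L}$ is the language with one binary relation $\in$. $\mathrm{Mac}$: extensionality, pairing, emptyset, union, infinity, powerset, transitive containment, $\Delta_0$-separation, set foundation, and ''every set can be well-ordered''. $\mathrm{MOST}=\mathrm{Mac}+\Sigma_1$-separation$+\Delta_0$-collection. $\Delta_0^{\mathcal P}$-collection is the collection scheme restricted to formulae built from atomic formulae using connectives and bounded quantifiers $\exists x\in y,\forall x\in y,\exists x\subseteq y,\forall x\subseteq y$. For an automorphism $j$ of $\mathcal M$, $\mathcal I_{\mathrm{fix}}(j)$ is the substructure of $\mathcal M$ with domain $\{x\in M: j(y)=y\text{ for all }y\in M\text{ with }\mathcal M\models y\in\mathrm{TC}(\{x\})\}$, transitive closure computed in $\mathcal M$. Non-trivial means not the identity. Recursively saturated: every recursive finitely realised type (with finitely many parameters) is realised. *)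

(* Defs.v *)
From mathcomp Require Import all_boot.
From Stdlib Require List.

Set Implicit Arguments.
Unset Strict Implicit.
Unset Printing Implicit Defensive.

Record Lstructure := LStructure {
  dom :> Type;
  Lmem : dom -> dom -> Prop }.

(* De Bruijn indices: index 0 is the variable bound by the nearest enclosing
   quantifier, and indices that escape all quantifiers are free variables. *)
Inductive formula : Type :=
| fMem of nat & nat
| fEq of nat & nat
| fNot of formula
| fAnd of formula & formula
| fOr of formula & formula
| fImp of formula & formula
| fAll of formula
| fEx of formula.

Definition scons (T : Type) (a : T) (e : nat -> T) : nat -> T :=
  fun n => if n is k.+1 then e k else a.

Fixpoint sat (M : Lstructure) (e : nat -> M) (phi : formula) : Prop :=
  match phi with
  | fMem i j => Lmem (e i) (e j)
  | fEq i j => e i = e j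
  | fNot f => ~ sat e f
  | fAnd f g => sat e f /\ sat e g
  | fOr f g => sat e f \/ sat e g
  | fImp f g => sat e f -> sat e g
  | fAll f => forall a : M, sat (scons a e) f
  | fEx f => exists a : M, sat (scons a e) f
  end.

(* All free variables of phi have index < k. *)
Fixpoint free_below (k : nat) (phi : formula) : Prop :=
  match phi with
  | fMem i j | fEq i j => i < k /\ j < k
  | fNot f => free_below k f
  | fAnd f g | fOr f g | fImp f g => free_below k f /\ free_below k g
  | fAll f | fEx f => free_below k.+1 f
  end.

(* In the bounded quantifiers below, the bound i is an index outside the
   quantifier; it is shifted by one under it, so it cannot be captured. *)
Definition fSub (i j : nat) : formula :=
  fAll (fImp (fMem 0 i.+1) (fMem 0 j.+1)).
Definition fAll_in (i : nat) (f : formula) := fAll (fImp (fMem 0 i.+1) f).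
Definition fEx_in (i : nat) (f : formula) := fEx (fAnd (fMem 0 i.+1) f).
Definition fAll_sub (i : nat) (f : formula) := fAll (fImp (fSub 0 i.+1) f).
Definition fEx_sub (i : nat) (f : formula) := fEx (fAnd (fSub 0 i.+1) f).

Inductive Delta0 : formula -> Prop :=
| Delta0_mem i j : Delta0 (fMem i j)
| Delta0_eq i j : Delta0 (fEq i j)
| Delta0_not f : Delta0 f -> Delta0 (fNot f)
| Delta0_and f g : Delta0 f -> Delta0 g -> Delta0 (fAnd f g)
| Delta0_or f g : Delta0 f -> Delta0 g -> Delta0 (fOr f g)
| Delta0_imp f g : Delta0 f -> Delta0 g -> Delta0 (fImp f g)
| Delta0_all_in i f : Delta0 f -> Delta0 (fAll_in i f)
| Delta0_ex_in i f : Delta0 f -> Delta0 (fEx_in i f).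

Inductive Delta0P : formula -> Prop :=
| Delta0P_mem i j : Delta0P (fMem i j)
| Delta0P_eq i j : Delta0P (fEq i j)
| Delta0P_not f : Delta0P f -> Delta0P (fNot f)
| Delta0P_and f g : Delta0P f -> Delta0P g -> Delta0P (fAnd f g)
| Delta0P_or f g : Delta0P f -> Delta0P g -> Delta0P (fOr f g)
| Delta0P_imp f g : Delta0P f -> Delta0P g -> Delta0P (fImp f g)
| Delta0P_all_in i f : Delta0P f -> Delta0P (fAll_in i f)
| Delta0P_ex_in i f : Delta0P f -> Delta0P (fEx_in i f)
| Delta0P_all_sub i f : Delta0P f -> Delta0P (fAll_sub i f)
| Delta0P_ex_sub i f : Delta0P f -> Delta0P (fEx_sub i f).

Inductive Sigma1 : formula -> Prop :=
| Sigma1_Delta0 f : Delta0 f -> Sigma1 f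
| Sigma1_ex f : Sigma1 f -> Sigma1 (fEx f).

(* The finitely many single axioms are written directly as their satisfaction
   conditions in M; every quantifier ranges over elements of M. *)
Section SetTheory.
Variable M : Lstructure.
Implicit Types x y z u v w p r s t : M.

Definition subset_in x y := forall z, Lmem z x -> Lmem z y.
Definition transitive_in x := forall y, Lmem y x -> subset_in y x.
Definition is_empty x := forall y, ~ Lmem y x.
Definition is_upair w x y := forall z, Lmem z w <-> z = x \/ z = y.
Definition is_succ w x := forall z, Lmem z w <-> Lmem z x \/ z = x.

(* Kuratowski: p = {{x}, {x, y}}. *)
Definition is_opair p x y :=
  forall w, Lmem w p <-> is_upair w x x \/ is_upair w x y.

Definition related r x y := exists p, Lmem p r /\ is_opair p x y.

Definition well_orders r x :=
  [/\ forall p, Lmem p r ->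
        exists u v, [/\ Lmem u x, Lmem v x & is_opair p u v],
      forall u, Lmem u x -> ~ related r u u,
      forall u v w, Lmem u x -> Lmem v x -> Lmem w x ->
        related r u v -> related r v w -> related r u w,
      forall u v, Lmem u x -> Lmem v x ->
        [\/ related r u v, u = v | related r v u]
    & forall s, subset_in s x -> (exists u, Lmem u s) ->
        exists u, Lmem u s /\ forall v, Lmem v s -> u = v \/ related r u v].

Definition Extensionality :=
  forall x y, (forall z, Lmem z x <-> Lmem z y) -> x = y.
Definition Emptyset := exists x, is_empty x.
Definition Pairing := forall x y, exists w, is_upair w x y.
Definition Union :=
  forall x, exists y, forall z, Lmem z y <-> exists w, Lmem w x /\ Lmem z w.
Definition Infinity :=
  exists x, (exists y, Lmem y x /\ is_empty y) /\
    forall y, Lmem y x -> exists w, Lmem w x /\ is_succ w y.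
Definition Powerset :=
  forall x, exists y, forall z, Lmem z y <-> subset_in z x.
Definition TransitiveContainment :=
  forall x, exists y, transitive_in y /\ subset_in x y.
Definition SetFoundation :=
  forall x, (exists y, Lmem y x) ->
    exists y, Lmem y x /\ forall z, ~ (Lmem z y /\ Lmem z x).
Definition WellOrdering := forall x, exists r, well_orders r x.

Definition Separation (Gamma : formula -> Prop) :=
  forall phi, Gamma phi -> forall (e : nat -> M) x,
    exists y, forall z, Lmem z y <-> Lmem z x /\ sat (scons z e) phi.

(* In phi, index 0 is the witness y, index 1 is x, the rest are parameters. *)
Definition Collection (Gamma : formula -> Prop) :=
  forall phi, Gamma phi -> forall (e : nat -> M) w,
    (forall x, Lmem x w -> exists y, sat (scons y (scons x e)) phi) ->
    exists c, forall x, Lmem x w ->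
      exists y, Lmem y c /\ sat (scons y (scons x e)) phi.

Definition Mac :=
  Extensionality /\ Pairing /\ Emptyset /\ Union /\ Infinity /\ Powerset /\
  TransitiveContainment /\ Separation Delta0 /\ SetFoundation /\
  WellOrdering.

Definition MOST := [/\ Mac, Separation Sigma1 & Collection Delta0].

(* t = TC({x}): the least transitive set that has x as an element. *)
Definition is_TC_singleton t x :=
  [/\ transitive_in t, Lmem x t
    & forall s, transitive_in s -> Lmem x s -> subset_in t s].

Definition in_TC_singleton y x := exists t, is_TC_singleton t x /\ Lmem y t.

End SetTheory.

Definition automorphism (M : Lstructure) (j : M -> M) : Prop :=
  bijective j /\ forall x y : M, Lmem (j x) (j y) <-> Lmem x y.

Definition nontrivial (M : Lstructure) (j : M -> M) : Prop :=
  exists x : M, j x <> x.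

Definition substructure (M : Lstructure) (D : M -> Prop) : Lstructure :=
  @LStructure {x : M | D x} (fun x y => Lmem (sval x) (sval y)).

Definition Ifix (M : Lstructure) (j : M -> M) : Lstructure :=
  substructure (fun x : M => forall y : M, in_TC_singleton y x -> j y = y).

Definition isomorphic (M N : Lstructure) : Prop :=
  exists f : M -> N,
    bijective f /\ forall x y : M, Lmem (f x) (f y) <-> Lmem x y.

Definition countable_structure (M : Lstructure) : Prop :=
  exists f : M -> nat, injective f.

(* The total general recursive functions: minimization is applied only to
   functions that have a zero for every value of the other arguments. *)
Inductive recursive : forall n : nat, (n.-tuple nat -> nat) -> Prop :=
| rec_zero : @recursive 0 (fun _ => 0)
| rec_succ : @recursive 1 (fun v => (thead v).+1)
| rec_proj n (i : 'I_n) : @recursive n (fun v => tnth v i)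
| rec_comp m n (f : m.-tuple nat -> nat) (g : 'I_m -> n.-tuple nat -> nat) :
    recursive f -> (forall i, recursive (g i)) ->
    @recursive n (fun v => f [tuple g i v | i < m])
| rec_prim n (f : n.-tuple nat -> nat) (g : n.+2.-tuple nat -> nat)
    (h : n.+1.-tuple nat -> nat) :
    recursive f -> recursive g ->
    (forall v, h (cons_tuple 0 v) = f v) ->
    (forall k v, h (cons_tuple k.+1 v) =
                 g (cons_tuple k (cons_tuple (h (cons_tuple k v)) v))) ->
    recursive h
| rec_mu n (f : n.+1.-tuple nat -> nat) (h : n.-tuple nat -> nat) :
    recursive f ->
    (forall v, f (cons_tuple (h v) v) = 0) ->
    (forall v k, k < h v -> f (cons_tuple k v) <> 0) ->
    recursive h.

Definition recursive_set (A : nat -> Prop) : Prop :=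
  exists h : 1.-tuple nat -> nat,
    recursive h /\ forall k, A k <-> h [tuple k] = 0.

Fixpoint godel (phi : formula) : nat :=
  match phi with
  | fMem i j => CodeSeq.code [:: 0; i; j]
  | fEq i j => CodeSeq.code [:: 1; i; j]
  | fNot f => CodeSeq.code [:: 2; godel f]
  | fAnd f g => CodeSeq.code [:: 3; godel f; godel g]
  | fOr f g => CodeSeq.code [:: 4; godel f; godel g]
  | fImp f g => CodeSeq.code [:: 5; godel f; godel g]
  | fAll f => CodeSeq.code [:: 6; godel f]
  | fEx f => CodeSeq.code [:: 7; godel f]
  end.

Definition recursive_formulas (p : formula -> Prop) : Prop :=
  recursive_set (fun k => exists phi, p phi /\ godel phi = k).

(* In a type p, indices 0 .. m-1 are the variables of the type and indices
   m .. m+n-1 stand for the parameters e 0, .., e (n-1). *)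
Definition recursively_saturated (M : Lstructure) : Prop :=
  forall (m n : nat) (p : formula -> Prop) (e : nat -> M),
    recursive_formulas p ->
    (forall phi, p phi -> free_below (m + n) phi) ->
    (forall s : seq formula, List.Forall p s ->
       exists a : m.-tuple M, List.Forall (sat (foldr (@scons M) e a)) s) ->
    exists a : m.-tuple M, forall phi, p phi -> sat (foldr (@scons M) e a) phi.

(* Main.v *)
Require Import Defs.
From mathcomp Require Import all_boot zify.
From Stdlib Require Import Classical ClassicalEpsilon FunctionalExtensionality.

(** From (II) to (I): the fixed segment of j is transitive, closed under subsets,
    power sets and surjective images, and Löwenheim–Skolem followed by the Mostowski
    collapse, both inside M, make it Sigma_1-elementary in M. An
    ordinal with all its predecessors in the segment is fixed, hence in the segment,
    so no ordinal is the least one outside; but a failure of Delta_0^P-collection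
    would define such an ordinal as the least one that maps onto the transitive
    closures of suitable witnesses.

    From (I) to (II): recursive saturation gives in I a coded chain
    G = (N_0, N_1, ...) of nonstandard length, each term closed under the relevant
    operations on the previous one; M is the union of the N_n with n standard. A
    back-and-forth of length omega builds at once an embedding of I onto J inside M
    and an automorphism j of M. A stage consists of tuples a, a', c, d and a set K
    such that every Delta_0^P formula satisfiable over a is satisfiable over a'
    in K, and c and d have the same Delta_0^P type over K. The sets K shrink,
    and J is included in all of them, so j fixes J pointwise. Given b with
    transitive closure t, either t injects into an iterated power set of a small set,
    in which case b can be captured by J through a Mostowski collapse, or two elements
    of t have the same type over the next K by the pigeonhole principle and j is made
    to send one to the other. *)

Set Implicit Arguments.
Unset Strict Implicit.
Unset Printing Implicit Defensive.

Notation "x ∈ y" := (Lmem x y) (at level 70, no associativity).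

(** * Definability *)

(** In both directions the obstacle is that neither [j] nor the standard cut of the chain is given
    by a formula, so separation and collection cannot mention them. Foundation is therefore applied
    to properties written with set parameters: for a surjection [F] the set [j F] replaces the
    action of [j], and overspill along the coded chain [G] replaces reference to standard [n]. The
    fixed segment and the standard part of the chain satisfy the same closure conditions, collected
    in [good], and one argument gives [MOST] for both. Elementarity serves Sigma_1-separation there.
    The Skolem hull is indexed by a double power set over an infinite set, because such a set
    belongs to the segment and has room for codes of terms, so that the collapsed hull is a
    surjective image of a member of the segment. In the back-and-forth, a finite part of a type over
    [K] must itself be a set: it is an element of [P3 K], and this is why each shrinking of [K]
    leaves three power sets of room. Recursive saturation passes from finite parts to full types,
    and countability schedules the requirements. *)

Definition up (r : nat -> nat) (n : nat) := if n is k.+1 then (r k).+1 else 0.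

Fixpoint rename (r : nat -> nat) (f : formula) : formula :=
  match f with
  | fMem i j => fMem (r i) (r j)
  | fEq i j => fEq (r i) (r j)
  | fNot f => fNot (rename r f)
  | fAnd f g => fAnd (rename r f) (rename r g)
  | fOr f g => fOr (rename r f) (rename r g)
  | fImp f g => fImp (rename r f) (rename r g)
  | fAll f => fAll (rename (up r) f)
  | fEx f => fEx (rename (up r) f)
  end.

Lemma scons_up (T : Type) (a : T) (e : nat -> T) r :
  (fun i => scons a e (up r i)) = scons a (fun i => e (r i)).
Proof. by apply: functional_extensionality => -[]. Qed.

Lemma sat_rename (M : Lstructure) f (e : nat -> M) r :
  sat e (rename r f) <-> sat (fun i => e (r i)) f.
Proof.
elim: f e r => //= [f IH|f IHf g IHg|f IHf g IHg|f IHf g IHg|f IH|f IH] e r;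
  rewrite ?IH ?IHf ?IHg //.
- by split=> H a; move: (H a); rewrite IH scons_up.
- by split=> -[a H]; exists a; move: H; rewrite IH scons_up.
Qed.

Class formula_class (Gam : formula -> Prop) := FormulaClass {
  fc_mem i j : Gam (fMem i j);
  fc_eq i j : Gam (fEq i j);
  fc_not f : Gam f -> Gam (fNot f);
  fc_and f g : Gam f -> Gam g -> Gam (fAnd f g);
  fc_or f g : Gam f -> Gam g -> Gam (fOr f g);
  fc_imp f g : Gam f -> Gam g -> Gam (fImp f g);
  fc_all_in i f : Gam f -> Gam (fAll_in i f);
  fc_ex_in i f : Gam f -> Gam (fEx_in i f);
  fc_rename r f : Gam f -> Gam (rename r f) }.

#[global] Instance Delta0_class : formula_class Delta0.
Proof.
split; try by constructor.
move=> r f Hf; by elim: Hf r => /=; constructor.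
Qed.

#[global] Instance Delta0P_class : formula_class Delta0P.
Proof.
split; try by constructor.
move=> r f Hf; by elim: Hf r => /=; constructor.
Qed.

Section Def.
Variables (Gam : formula -> Prop) (M : Lstructure).
Context {GamC : formula_class Gam}.
Implicit Types (b : bool) (e : nat -> M) (P : (nat -> M) -> Prop).

Definition tmv (tau : nat + M) e := match tau with inl i => e i | inr c => c end.
Definition isinl (tau : nat + M) := if tau is inl _ then true else false.

(* [Def b P]: P is the satisfaction predicate of a formula of [Gam]; when [b]
   is true the formula may have elements of M as parameters. *)
Definition Def b P := exists (f : formula) (ts : nat -> nat + M),
  [/\ Gam f, forall n, b || isinl (ts n)
    & forall e, sat (fun n => tmv (ts n) e) f <-> P e].

Definition isterm b (t : (nat -> M) -> M) :=
  exists tau, b || isinl tau /\ forall e, t e = tmv tau e.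

Lemma isterm_var b i : isterm b (fun e => e i).
Proof. by exists (inl i); rewrite orbT. Qed.

Lemma isterm_cst c : isterm true (fun _ => c).
Proof. by exists (inr c). Qed.

Lemma isterm_shift b t (r : nat -> nat) :
  isterm b t -> isterm b (fun e => t (fun n => e (r n))).
Proof.
move=> [[i|c] [Hb H]].
- by exists (inl (r i)); split=> // e; rewrite H.
- by exists (inr c); split=> // e; rewrite H.
Qed.

Lemma Def_iff b P Q : (forall e, P e <-> Q e) -> Def b P -> Def b Q.
Proof.
move=> H [f [ts [Gf Hb Hs]]]; exists f, ts; split=> // e.
by rewrite Hs H.
Qed.

Lemma Def_sat b f (T : (nat -> M) -> nat -> M) :
  Gam f -> (forall i, isterm b (fun e => T e i)) -> Def b (fun e => sat (T e) f).
Proof.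
move=> Gf HT.
exists f, (fun i => proj1_sig (constructive_indefinite_description _ (HT i))).
split=> // [n|e].
  by case: constructive_indefinite_description => /= tau [].
suff -> : (fun n => tmv (sval (constructive_indefinite_description _ (HT n))) e)
  = T e by [].
apply: functional_extensionality => n.
by case: constructive_indefinite_description => /= tau [] _ ->.
Qed.

Lemma Def_comp b P (T : (nat -> M) -> nat -> M) :
  Def b P -> (forall i, isterm b (fun e => T e i)) -> Def b (fun e => P (T e)).
Proof.
move=> [f [ts [Gf Hb Hs]]] HT.
apply: (@Def_iff b (fun e => sat (fun n => tmv (ts n) (T e)) f)).
  by move=> e; rewrite Hs.
apply: Def_sat => // i; case E : (ts i) => [k|c] /=; first exact: HT.
by exists (inr c); split=> //; move: (Hb i); rewrite E.
Qed.

Lemma Def_mem b t u : isterm b t -> isterm b u -> Def b (fun e => t e ∈ u e).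
Proof.
move=> Ht Hu.
apply: (@Def_sat b (fMem 0 1) (fun e i => if i is 0 then t e else u e)).
  exact: fc_mem.
by case.
Qed.

Lemma Def_eq b t u : isterm b t -> isterm b u -> Def b (fun e => t e = u e).
Proof.
move=> Ht Hu.
apply: (@Def_sat b (fEq 0 1) (fun e i => if i is 0 then t e else u e)).
  exact: fc_eq.
by case.
Qed.

Lemma Def_not b P : Def b P -> Def b (fun e => ~ P e).
Proof.
move=> [f [ts [Gf Hb Hs]]]; exists (fNot f), ts; split=> //.
  exact: fc_not.
by move=> e /=; rewrite Hs.
Qed.

(** The two lists of arguments are interleaved on even and odd indices, so that both formulas are
    read in a single environment and can be joined by a connective. *)
Lemma Def_merge b P Q : Def b P -> Def b Q ->
  exists f g ts, [/\ Gam f, Gam g, forall n, b || isinl (ts n) &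
    forall e, (sat (fun n => tmv (ts n) e) f <-> P e) /\
              (sat (fun n => tmv (ts n) e) g <-> Q e)].
Proof.
move=> [f [ts [Gf Hb Hs]]] [g [us [Gg Hb' Hs']]].
exists (rename double f), (rename (fun n => n.*2.+1) g).
exists (fun n => if odd n then us n./2 else ts n./2); split.
- exact: fc_rename.
- exact: fc_rename.
- by move=> n; case: ifP.
- move=> e; rewrite !sat_rename -Hs -Hs'; split.
  + suff -> : (fun i : nat =>
      tmv (if odd i.*2 then us i.*2./2 else ts i.*2./2) e) =
      (fun n => tmv (ts n) e) by [].
    by apply: functional_extensionality => n; rewrite odd_double doubleK.
  + suff -> : (fun i : nat =>
      tmv (if odd i.*2.+1 then us i.*2.+1./2 else ts i.*2.+1./2) e) =
      (fun n => tmv (us n) e) by [].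
    apply: functional_extensionality => n /=.
    by rewrite odd_double /= uphalf_double.
Qed.

Lemma Def_and b P Q : Def b P -> Def b Q -> Def b (fun e => P e /\ Q e).
Proof.
move=> HP HQ; have [f [g [ts [Gf Gg Hb H]]]] := Def_merge HP HQ.
exists (fAnd f g), ts; split=> //; first exact: fc_and.
by move=> e /=; case: (H e) => -> ->.
Qed.

Lemma Def_or b P Q : Def b P -> Def b Q -> Def b (fun e => P e \/ Q e).
Proof.
move=> HP HQ; have [f [g [ts [Gf Gg Hb H]]]] := Def_merge HP HQ.
exists (fOr f g), ts; split=> //; first exact: fc_or.
by move=> e /=; case: (H e) => -> ->.
Qed.

Lemma Def_imp b P Q : Def b P -> Def b Q -> Def b (fun e => P e -> Q e).
Proof.
move=> HP HQ; have [f [g [ts [Gf Gg Hb H]]]] := Def_merge HP HQ.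
exists (fImp f g), ts; split=> //; first exact: fc_imp.
by move=> e /=; case: (H e) => -> ->.
Qed.

Lemma Def_equiv b P Q : Def b P -> Def b Q -> Def b (fun e => P e <-> Q e).
Proof. by move=> HP HQ; apply: Def_and; apply: Def_imp. Qed.

(** By excluded middle the proposition becomes a trivially true or false equation. This lets
    external facts, such as the satisfiability of a given formula, occur as clauses of a definable
    predicate. *)
Lemma Def_const b (A : Prop) : Def b (fun _ => A).
Proof.
case: (classic A) => HA.
- apply: (@Def_iff b (fun e => e 0 = e 0)) => //.
  by apply: Def_eq; apply: isterm_var.
- apply: (@Def_iff b (fun e => ~ (e 0 = e 0))) => //.
  by apply: Def_not; apply: Def_eq; apply: isterm_var.
Qed.

(** Common core of the bounded quantifiers: the bound is moved to outer index 0, so that the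
    quantifier prefixed to [f] always refers to that index. The bound variable stays at 0 and every
    other argument moves past both slots. *)
Lemma Def_bound b t (Q : M -> (nat -> M) -> Prop) :
  isterm b t -> Def b (fun e => Q (e 0) (fun n => e n.+1)) ->
  exists f ts, [/\ Gam f, forall n, b || isinl (ts n) & forall e,
    tmv (ts 0) e = t e /\
    forall x, sat (scons x (fun n => tmv (ts n) e)) f <-> Q x e].
Proof.
move=> [tau [Hb Ht]] [f [ts [Gf Hb' Hs]]].
pose r n := if ts n is inl 0 then 0 else n.+2.
pose us n := if n is k.+1 then
    (match ts k with inl i => inl i.-1 | inr c => inr c end) else tau.
exists (rename r f), us; split.
- exact: fc_rename.
- by case=> // n; move: (Hb' n); rewrite /us; case: (ts n).
- move=> e; split; first by rewrite Ht.
  move=> x; rewrite sat_rename -(Hs (scons x e)).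
  suff -> : (fun i => scons x (fun n => tmv (us n) e) (r i)) =
            (fun n => tmv (ts n) (scons x e)) by [].
  apply: functional_extensionality => n.
  rewrite /r /us; case E : (ts n) => [[|i]|c] //=; by rewrite E.
Qed.

Lemma Def_allin b t (Q : M -> (nat -> M) -> Prop) :
  isterm b t -> Def b (fun e => Q (e 0) (fun n => e n.+1)) ->
  Def b (fun e => forall x, x ∈ t e -> Q x e).
Proof.
move=> Ht HQ; have [f [ts [Gf Hb H]]] := Def_bound Ht HQ.
exists (fAll_in 0 f), ts; split=> //; first exact: fc_all_in.
by move=> e /=; case: (H e) => -> Hx; split=> Hy x Hxt; apply/Hx; apply: Hy.
Qed.

Lemma Def_exin b t (Q : M -> (nat -> M) -> Prop) :
  isterm b t -> Def b (fun e => Q (e 0) (fun n => e n.+1)) ->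
  Def b (fun e => exists x, x ∈ t e /\ Q x e).
Proof.
move=> Ht HQ; have [f [ts [Gf Hb H]]] := Def_bound Ht HQ.
exists (fEx_in 0 f), ts; split=> //; first exact: fc_ex_in.
move=> e /=; case: (H e) => -> Hx.
by split=> -[x [Hxt HQx]]; exists x; split=> //; apply/Hx.
Qed.

Lemma Def_bigand b (N : nat) (P : nat -> (nat -> M) -> Prop) :
  (forall n, n < N -> Def b (P n)) -> Def b (fun e => forall n, n < N -> P n e).
Proof.
elim: N => [|N IH] H.
  by apply: Def_iff (Def_const b True) => e; split.
have H1 := IH (fun n Hn => H n (ltnW Hn)).
apply: Def_iff (Def_and H1 (H N (ltnSn N))) => e; split.
- move=> [Hlt HN] n; rewrite ltnS leq_eqVlt => /orP[/eqP -> //|]; exact: Hlt.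
- by move=> Hall; split=> [n Hn|]; apply: Hall => //; apply: ltnW.
Qed.

Lemma Def_bigor b (N : nat) (P : nat -> (nat -> M) -> Prop) :
  (forall n, n < N -> Def b (P n)) ->
  Def b (fun e => exists n, n < N /\ P n e).
Proof.
move=> H.
have H1 : Def b (fun e => ~ forall n, n < N -> ~ P n e).
  by apply: Def_not; apply: Def_bigand => n Hn; apply: Def_not; apply: H.
apply: Def_iff H1 => e; split.
- move=> Hn; apply: NNPP => Hc; apply: Hn => n Hn HP; apply: Hc; by exists n.
- by move=> [n [Hn HP]] Hall; apply: (Hall n).
Qed.

Lemma Def_sub b t u : isterm b t -> isterm b u ->
  Def b (fun e => subset_in (t e) (u e)).
Proof.
move=> Ht Hu; apply: (@Def_allin b t (fun x e => x ∈ u e)) => //.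
apply: Def_mem; first exact: isterm_var.
exact: (isterm_shift succn Hu).
Qed.

Lemma Def_formula P : Def false P -> exists2 f, Gam f & forall e, sat e f <-> P e.
Proof.
move=> [f [ts [Gf Hb Hs]]].
exists (rename (fun n => if ts n is inl i then i else 0) f).
  exact: fc_rename.
move=> e; rewrite sat_rename -Hs.
suff -> : (fun i => e match ts i with inl i0 => i0 | inr _ => 0 end) =
          (fun n => tmv (ts n) e) by [].
apply: functional_extensionality => n; move: (Hb n) => /=.
by case: (ts n).
Qed.

Lemma Def_params b P (d : M) : Def b P -> exists f e0, Gam f /\
  forall e, sat (fun n => if odd n then e0 n./2 else e n./2) f <-> P e.
Proof.
move=> [f [ts [Gf Hb Hs]]].
exists (rename (fun n => if ts n is inl i then i.*2 else n.*2.+1) f).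
exists (fun n => if ts n is inr c then c else d); split; first exact: fc_rename.
move=> e; rewrite sat_rename -Hs.
set u := (X in sat X f); suff -> : u = (fun n => tmv (ts n) e) by [].
apply: functional_extensionality => n; rewrite /u.
case E : (ts n) => [i|c] /=; first by rewrite odd_double doubleK.
by rewrite odd_double /= uphalf_double E.
Qed.

End Def.

Lemma Def_allsub (M : Lstructure) b t (Q : M -> (nat -> M) -> Prop) :
  isterm b t -> Def Delta0P b (fun e => Q (e 0) (fun n => e n.+1)) ->
  Def Delta0P b (fun e => forall x, subset_in x (t e) -> Q x e).
Proof.
move=> Ht HQ; have [f [ts [Gf Hb H]]] := Def_bound Ht HQ.
exists (fAll_sub 0 f), ts; split=> //; first by constructor.
by move=> e /=; case: (H e) => -> Hx; split=> Hy x Hxt; apply/Hx; apply: Hy.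
Qed.

Lemma Def_exsub (M : Lstructure) b t (Q : M -> (nat -> M) -> Prop) :
  isterm b t -> Def Delta0P b (fun e => Q (e 0) (fun n => e n.+1)) ->
  Def Delta0P b (fun e => exists x, subset_in x (t e) /\ Q x e).
Proof.
move=> Ht HQ; have [f [ts [Gf Hb H]]] := Def_bound Ht HQ.
exists (fEx_sub 0 f), ts; split=> //; first by constructor.
move=> e /=; case: (H e) => -> Hx.
by split=> -[x [Hxt HQx]]; exists x; split=> //; apply/Hx.
Qed.

(** * Set theory in a model of MOST *)

Class isMOST (M : Lstructure) := most_ax : MOST M.

Section Functions.
Variable M : Lstructure.
Implicit Types x y : M.

(** [epsilon] makes these operations total on any structure. Their specifications follow later from
    the axioms, for [sep] only when the predicate is definable. *)
Definition upr x y : M := epsilon (inhabits x) (fun w => is_upair w x y).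
Definition sg x : M := upr x x.
Definition opr x y : M := upr (sg x) (upr x y).
Definition Un x : M :=
  epsilon (inhabits x) (fun y => forall z, z ∈ y <-> exists w, w ∈ x /\ z ∈ w).
Definition Cup x y : M := Un (upr x y).
Definition Pw x : M :=
  epsilon (inhabits x) (fun y => forall z, z ∈ y <-> subset_in z x).
Definition sep x (P : M -> Prop) : M :=
  epsilon (inhabits x) (fun y => forall z, z ∈ y <-> z ∈ x /\ P z).

End Functions.

Ltac dterm := first [ assumption | exact: isterm_var | exact: isterm_cst
                    | apply: isterm_shift; dterm ].

Ltac ddef_atom := fail.
Ltac ddef_step := first
  [ exact: Def_const | assumption
  | apply: Def_mem; dterm | apply: Def_eq; dterm | apply: Def_sub; dterm
  | ddef_atom
  | apply: Def_equiv | apply: Def_and | apply: Def_or | apply: Def_not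
  | apply: Def_imp
  | apply: Def_allin; [dterm|] | apply: Def_exin; [dterm|]
  | apply: Def_allsub; [dterm|] | apply: Def_exsub; [dterm|]
  ].
Ltac ddef := repeat (cbv beta; ddef_step).

Section Basics.
Variable M : Lstructure.
Context {HM : isMOST M}.
Implicit Types x y z u v w p q r s t a : M.

Lemma ext x y : (forall z, z ∈ x <-> z ∈ y) -> x = y.
Proof. by case: most_ax => -[] H *; apply: H. Qed.

Lemma found a : (exists y, y ∈ a) -> exists y, y ∈ a /\ forall z, z ∈ y -> ~ z ∈ a.
Proof.
have [[_ [_ [_ [_ [_ [_ [_ [_ [H _]]]]]]]]] _ _] := (most_ax : MOST M).
move=> /H [y [Hy Hz]]; exists y; split=> // z Hzy Hza; exact: (Hz z).
Qed.

Lemma uprE z x y : z ∈ upr x y <-> z = x \/ z = y.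
Proof.
have [[_ [H _]] _ _] := (most_ax : MOST M).
have := epsilon_spec (inhabits x) (fun w => is_upair w x y) (H x y).
exact.
Qed.

Lemma is_upairE w x y : is_upair w x y <-> w = upr x y.
Proof.
split=> [H|-> z]; last exact: uprE.
by apply: ext => z; rewrite H uprE.
Qed.

Lemma sgE z x : z ∈ sg x <-> z = x.
Proof. by rewrite uprE; split=> [[]|]; auto. Qed.

Lemma is_opairE p x y : is_opair p x y <-> p = opr x y.
Proof.
split=> [H|-> w].
- by apply: ext => z; rewrite H !is_upairE uprE.
- by rewrite uprE !is_upairE.
Qed.

Lemma upr_eq x y u v : upr x y = upr u v -> (x = u /\ y = v) \/ (x = v /\ y = u).
Proof.
move=> E.
have /uprE H1 : x ∈ upr u v by rewrite -E uprE; left.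
have /uprE H2 : y ∈ upr u v by rewrite -E uprE; right.
have /uprE H3 : u ∈ upr x y by rewrite E uprE; left.
have /uprE H4 : v ∈ upr x y by rewrite E uprE; right.
by case: H1 H2 H3 H4 => -> [] -> [] ? [] ?; subst; auto.
Qed.

Lemma sg_inj x y : sg x = sg y -> x = y.
Proof. by case/upr_eq => -[]. Qed.

Lemma opr_inj x y u v : opr x y = opr u v -> x = u /\ y = v.
Proof.
case/upr_eq => -[E1 E2].
- move/sg_inj: E1 => E1; subst.
  by case/upr_eq: E2 => -[? ?]; subst.
- case/upr_eq: E1 => -[? ?]; case/upr_eq: E2 => -[? ?]; subst; auto.
Qed.

Lemma UnE z x : z ∈ Un x <-> exists w, w ∈ x /\ z ∈ w.
Proof.
have [[_ [_ [_ [H _]]]] _ _] := (most_ax : MOST M).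
exact: (epsilon_spec (inhabits x) _ (H x)).
Qed.

Lemma CupE z x y : z ∈ Cup x y <-> z ∈ x \/ z ∈ y.
Proof.
rewrite UnE; split.
- by move=> [w [/uprE [] -> H]]; auto.
- by case=> H; [exists x|exists y]; rewrite uprE; auto.
Qed.

Lemma PwE z x : z ∈ Pw x <-> subset_in z x.
Proof.
have [[_ [_ [_ [_ [_ [H _]]]]]] _ _] := (most_ax : MOST M).
exact: (epsilon_spec (inhabits x) _ (H x)).
Qed.

Lemma sepE a (P : M -> Prop) z : Def Delta0 true (fun e => P (e 0)) ->
  (z ∈ sep a P <-> z ∈ a /\ P z).
Proof.
move=> HP.
have [[_ [_ [_ [_ [_ [_ [_ [H _]]]]]]]] _ _] := (most_ax : MOST M).
suff Hex : exists y, forall z, z ∈ y <-> z ∈ a /\ P z.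
  exact: (epsilon_spec (inhabits a) _ Hex).
have [f [e0 [Hf Hs]]] := Def_params a HP.
(* [P] depends on slot 0 alone, so every even slot may receive the element being tested. *)
pose r n := if odd n then n./2.+1 else 0.
have [y Hy] := H (rename r f) (fc_rename r Hf) e0 a.
exists y => u; rewrite Hy sat_rename -(Hs (fun _ => u)).
suff -> : (fun i => scons u e0 (r i)) = (fun n => if odd n then e0 n./2 else u)
  by [].
by apply: functional_extensionality => n; rewrite /r; case: ifP.
Qed.

Lemma sep_sigma a (P : M -> M -> Prop) :
  Def Delta0 true (fun e => P (e 1) (e 0)) ->
  exists s, forall z, z ∈ s <-> z ∈ a /\ exists y, P z y.
Proof.
move=> HP; have [_ H _] := (most_ax : MOST M).
have [f [e0 [Hf Hs]]] := Def_params a HP.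
(* Slot 0 is the witness and slot 1 the element tested; the further even slots are irrelevant to [P]
   and reuse slot 1. *)
pose r n := if odd n then n./2.+2 else if n is 0 then 0 else 1.
have Hr : Sigma1 (fEx (rename r f)).
  by apply: Sigma1_ex; apply: Sigma1_Delta0; apply: fc_rename.
have [y Hy] := H _ Hr e0 a.
exists y => u; rewrite Hy /=.
suff E v : sat (scons v (scons u e0)) (rename r f) <-> P u v.
  by split=> -[? [v ?]]; split=> //; exists v; apply/E.
rewrite sat_rename -(Hs (scons v (fun _ => u))).
set e1 := (X in sat X f); set e2 := (X in _ <-> sat X f).
suff -> : e1 = e2 by [].
apply: functional_extensionality => n; rewrite /e1 /e2 /r.
by case: n => [|[|n]] //=; case: ifP.
Qed.

Lemma collect w (P : M -> M -> Prop) : Def Delta0 true (fun e => P (e 1) (e 0)) ->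
  (forall x, x ∈ w -> exists y, P x y) ->
  exists c, forall x, x ∈ w -> exists y, y ∈ c /\ P x y.
Proof.
move=> HP Hex; have [_ _ H] := (most_ax : MOST M).
have [f [e0 [Hf Hs]]] := Def_params w HP.
pose r n := if odd n then n./2.+2 else if n is 0 then 0 else 1.
have E u v : sat (scons v (scons u e0)) (rename r f) <-> P u v.
  rewrite sat_rename -(Hs (scons v (fun _ => u))).
  set e1 := (X in sat X f); set e2 := (X in _ <-> sat X f).
  suff -> : e1 = e2 by [].
  apply: functional_extensionality => n; rewrite /e1 /e2 /r.
  by case: n => [|[|n]] //=; case: ifP.
have [|c Hc] := H (rename r f) (fc_rename r Hf) e0 w.
  by move=> x /Hex [y Hy]; exists y; apply/E.
exists c => x /Hc [y [Hy Hyc]]; exists y; split=> //; exact/E.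
Qed.

Lemma Def_eq_upr Gam (GC : formula_class Gam) b (z x y : (nat -> M) -> M) :
  isterm b z -> isterm b x -> isterm b y ->
  Def Gam b (fun e => z e = upr (x e) (y e)).
Proof.
move=> Hz Hx Hy.
apply: (@Def_iff _ _ _ (fun e => (x e ∈ z e /\ y e ∈ z e) /\
   forall w, w ∈ z e -> w = x e \/ w = y e)); last by ddef.
move=> e; split=> [[[H1 H2] H3]|->].
- apply: ext => w; rewrite uprE; split=> [/H3 //|[] -> //].
- by rewrite !uprE; split; [split; auto|move=> w /uprE].
Qed.

Ltac ddef_atom ::= first [apply: Def_eq_upr; dterm].

Lemma Def_eq_opr Gam (GC : formula_class Gam) b (z x y : (nat -> M) -> M) :
  isterm b z -> isterm b x -> isterm b y ->
  Def Gam b (fun e => z e = opr (x e) (y e)).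
Proof.
move=> Hz Hx Hy.
apply: (@Def_iff _ _ _ (fun e =>
  ((exists u, u ∈ z e /\ u = upr (x e) (x e)) /\
   (exists u, u ∈ z e /\ u = upr (x e) (y e))) /\
   forall w, w ∈ z e -> w = upr (x e) (x e) \/ w = upr (x e) (y e)));
   last by ddef.
move=> e; split=> [[[[u1 [H1 E1]] [u2 [H2 E2]]] H3]|->]; first subst.
- by apply: ext => w; rewrite uprE; split=> [/H3 //|[] ->].
- split; first by split; eexists; split; rewrite ?uprE //; auto.
  by move=> w /uprE.
Qed.

Ltac ddef_atom ::= first [apply: Def_eq_upr; dterm|apply: Def_eq_opr; dterm].

Lemma Def_opr_mem Gam (GC : formula_class Gam) b (z x y : (nat -> M) -> M) :
  isterm b z -> isterm b x -> isterm b y ->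
  Def Gam b (fun e => opr (x e) (y e) ∈ z e).
Proof.
move=> Hz Hx Hy.
apply: (@Def_iff _ _ _ (fun e => exists u, u ∈ z e /\ u = opr (x e) (y e)));
  last by ddef.
by move=> e; split=> [[u [H <-]] //|H]; exists (opr (x e) (y e)).
Qed.

Lemma opr_parts x y : exists u, u ∈ opr x y /\ (x ∈ u /\ y ∈ u).
Proof. by exists (upr x y); rewrite !uprE; auto. Qed.

(** The components of a pair [p] lie in elements of [p], so a quantifier over the pairs in a set
    splits into bounded quantifiers. *)
Lemma Def_ex_opr2 Gam (GC : formula_class Gam) b (z : (nat -> M) -> M)
    (Q : M -> M -> (nat -> M) -> Prop) : isterm b z ->
  Def Gam b (fun e => Q (e 1) (e 0) (fun n => e n.+2)) ->
  Def Gam b (fun e => exists x y, opr x y ∈ z e /\ Q x y e).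
Proof.
move=> Hz HQ.
apply: (@Def_iff _ _ _ (fun e => exists p, p ∈ z e /\ exists u, u ∈ p /\
   exists x, x ∈ u /\ exists u', u' ∈ p /\ exists y, y ∈ u' /\
   (p = opr x y /\ Q x y e))).
  move=> e; split.
  - by move=> [p [Hp [u [_ [x [_ [u' [_ [y [_ [E H]]]]]]]]]]]; exists x, y; subst.
  - move=> [x [y [H HH]]]; exists (opr x y); split=> //.
    have [u [Hu [Hx Hy]]] := opr_parts x y.
    by exists u; split=> //; exists x; split=> //; exists u; split=> //;
       exists y.
ddef.
move: HQ => [f [ts [Gf Hb Hs]]].
(* Below the five quantifiers [p, u, x, u', y] the variable [y] is at index 0 and [x] at 2, and
   outer variables are shifted by 5 instead of 2. *)
pose us n := match ts n with inl 0 => inl 0 | inl 1 => inl 2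
             | inl (k.+2) => inl k.+4.+1 | inr c => inr c end.
exists f, us; split=> //.
  by move=> n; move: (Hb n); rewrite /us; case: (ts n) => [[|[|]]|].
move=> e; rewrite -(Hs (scons (e 0) (scons (e 2) (fun n => e n.+4.+1)))).
set e1 := (X in sat X f); set e2 := (X in _ <-> sat X f).
suff -> : e1 = e2 by [].
apply: functional_extensionality => n; rewrite /e1 /e2 /us.
by case: (ts n) => [[|[|]]|].
Qed.

Lemma Def_all_opr2 Gam (GC : formula_class Gam) b (z : (nat -> M) -> M)
    (Q : M -> M -> (nat -> M) -> Prop) : isterm b z ->
  Def Gam b (fun e => Q (e 1) (e 0) (fun n => e n.+2)) ->
  Def Gam b (fun e => forall x y, opr x y ∈ z e -> Q x y e).
Proof.
move=> Hz HQ.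
have H : Def Gam b (fun e => ~ exists x y, opr x y ∈ z e /\ ~ Q x y e).
  by apply: Def_not; apply: Def_ex_opr2 => //; apply: Def_not.
apply: Def_iff H => e; split.
- move=> H x y Hxy; apply: NNPP => HN; apply: H; by exists x, y.
- by move=> H [x [y [Hxy HN]]]; apply: HN; apply: H.
Qed.

Lemma Def_ex_opr Gam (GC : formula_class Gam) b (z x : (nat -> M) -> M)
    (Q : M -> (nat -> M) -> Prop) : isterm b z -> isterm b x ->
  Def Gam b (fun e => Q (e 0) (fun n => e n.+1)) ->
  Def Gam b (fun e => exists y, opr (x e) y ∈ z e /\ Q y e).
Proof.
move=> Hz Hx HQ.
apply: (@Def_iff _ _ _ (fun e => exists x' y, opr x' y ∈ z e /\
                                 (x' = x e /\ Q y e))).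
  move=> e; split; first by move=> [x' [y [H [E HH]]]]; subst; exists y.
  by move=> [y [H HH]]; exists (x e), y.
apply: Def_ex_opr2 => //; cbv beta; apply: Def_and.
  by apply: Def_eq; [dterm|apply: (isterm_shift (fun n => n.+2) Hx)].
move: HQ => [f [ts [Gf Hb Hs]]].
pose us n := match ts n with inl 0 => inl 0
             | inl (k.+1) => inl k.+2 | inr c => inr c end.
exists f, us; split=> //.
  by move=> n; move: (Hb n); rewrite /us; case: (ts n) => [[|]|].
move=> e; rewrite -(Hs (scons (e 0) (fun n => e n.+2))).
set e1 := (X in sat X f); set e2 := (X in _ <-> sat X f).
suff -> : e1 = e2 by [].
apply: functional_extensionality => n; rewrite /e1 /e2 /us.
by case: (ts n) => [[|]|].
Qed.

Lemma Def_all_opr Gam (GC : formula_class Gam) b (z x : (nat -> M) -> M)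
    (Q : M -> (nat -> M) -> Prop) : isterm b z -> isterm b x ->
  Def Gam b (fun e => Q (e 0) (fun n => e n.+1)) ->
  Def Gam b (fun e => forall y, opr (x e) y ∈ z e -> Q y e).
Proof.
move=> Hz Hx HQ.
have H : Def Gam b (fun e => ~ exists y, opr (x e) y ∈ z e /\ ~ Q y e).
  by apply: Def_not; apply: Def_ex_opr => //; apply: Def_not.
apply: Def_iff H => e; split.
- move=> H y Hxy; apply: NNPP => HN; apply: H; by exists y.
- by move=> H [y [Hxy HN]]; apply: HN; apply: H.
Qed.

Lemma Def_trans Gam (GC : formula_class Gam) b (z : (nat -> M) -> M) :
  isterm b z -> Def Gam b (fun e => transitive_in (z e)).
Proof.
move=> Hz; apply: (@Def_iff _ _ _ (fun e => forall y, y ∈ z e -> subset_in y (z e)));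
  [by []|ddef].
Qed.

Lemma eps_ind t (P : M -> Prop) : transitive_in t ->
  Def Delta0 true (fun e => P (e 0)) ->
  (forall x, x ∈ t -> (forall y, y ∈ x -> P y) -> P x) ->
  forall x, x ∈ t -> P x.
Proof.
move=> Ht HP IH x Hx; apply: NNPP => HN.
have HN' : Def Delta0 true (fun e : nat -> M => ~ P (e 0)) by ddef.
have [|y [/(sepE _ _ HN') [Hy HNy] Hmin]] := @found (sep t (fun x => ~ P x)).
  by exists x; apply/sepE.
apply: HNy; apply: IH => // z Hz; apply: NNPP => HNz.
apply: (Hmin z Hz); apply/sepE => //; split=> //; exact: (Ht y).
Qed.

Lemma mem_irrefl x : ~ x ∈ x.
Proof.
move=> H; have [|y [/sgE -> Hz]] := @found (sg x); first by exists x; apply/sgE.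
by apply: (Hz x H); apply/sgE.
Qed.

Lemma mem_asym x y : x ∈ y -> ~ y ∈ x.
Proof.
move=> Hxy Hyx.
have [|z [/uprE [] -> Hz]] := @found (upr x y); first by exists x; apply/uprE; auto.
- by apply: (Hz y) => //; apply/uprE; auto.
- by apply: (Hz x) => //; apply/uprE; auto.
Qed.

Definition prod a b : M :=
  sep (Pw (Pw (Cup a b)))
    (fun z => exists x, x ∈ a /\ exists y, y ∈ b /\ z = opr x y).

Lemma prodE z a b : z ∈ prod a b <-> exists x, x ∈ a /\ exists y, y ∈ b /\ z = opr x y.
Proof.
rewrite /prod sepE; last first.
  apply: Def_exin; first dterm; cbv beta; apply: Def_exin; first dterm.
  by cbv beta; apply: Def_eq_opr; dterm.
split; [by case|split=> //].
case: H => x [Hx [y [Hy ->]]]; apply/PwE => u /uprE Hu; apply/PwE => v Hv.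
apply/CupE; case: Hu Hv => -> /uprE [] ->; auto.
Qed.

Lemma opr_prod x y a b : opr x y ∈ prod a b <-> x ∈ a /\ y ∈ b.
Proof.
rewrite prodE; split; last by move=> [Hx Hy]; exists x; split=> //; exists y.
by move=> [u [Hu [v [Hv /opr_inj [-> ->]]]]].
Qed.

Definition rng g : M :=
  sep (Un (Un g)) (fun v => exists x y, opr x y ∈ g /\ y = v).

Lemma rngE v g : v ∈ rng g <-> exists q, opr q v ∈ g.
Proof.
rewrite /rng sepE; last first.
  by apply: Def_ex_opr2; [dterm|cbv beta; apply: Def_eq; dterm].
split; first by move=> [_ [x [y [H <-]]]]; exists x.
move=> [q Hq]; split; last by exists q, v.
have [u [Hu [Hx Hy]]] := opr_parts q v.
by apply/UnE; exists u; split=> //; apply/UnE; exists (opr q v).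
Qed.

Lemma tc_exists x : exists t, transitive_in t /\ x ∈ t.
Proof.
have [[_ [_ [_ [_ [_ [_ [H _]]]]]]] _ _] := (most_ax : MOST M).
have [t [Ht Hs]] := H (sg x); exists t; split=> //.
by apply: Hs; apply/sgE.
Qed.

End Basics.

Ltac ddef_atom ::= first
  [ apply: Def_eq_upr; dterm | apply: Def_eq_opr; dterm
  | apply: Def_opr_mem; dterm | apply: Def_trans; dterm
  | apply: Def_ex_opr; [dterm|dterm|] | apply: Def_all_opr; [dterm|dterm|]
  | apply: Def_ex_opr2; [dterm|] | apply: Def_all_opr2; [dterm|] ].

Lemma free_below_le f j k : j <= k -> free_below j f -> free_below k f.
Proof.
elim: f j k => /= [a b|a b|f IH|f IHf g IHg|f IHf g IHg|f IHf g IHg|f IH|f IH] j k Hjk.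
- lia.
- lia.
- exact: IH.
- by move=> [/(IHf _ _ Hjk) ? /(IHg _ _ Hjk)].
- by move=> [/(IHf _ _ Hjk) ? /(IHg _ _ Hjk)].
- by move=> [/(IHf _ _ Hjk) ? /(IHg _ _ Hjk)].
- exact: IH.
- exact: IH.
Qed.

Lemma free_below_exists f : exists k, free_below k f.
Proof.
elim: f => /= [a b|a b|//|f [k Hk] g [l Hl]|f [k Hk] g [l Hl]|f [k Hk] g [l Hl]|f [k Hk]|f [k Hk]].
- by exists (a + b).+1; lia.
- by exists (a + b).+1; lia.
- exists (k + l); split.
    exact: (free_below_le (leq_addr l k) Hk). exact: (free_below_le (leq_addl k l) Hl).
- exists (k + l); split.
    exact: (free_below_le (leq_addr l k) Hk). exact: (free_below_le (leq_addl k l) Hl).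
- exists (k + l); split.
    exact: (free_below_le (leq_addr l k) Hk). exact: (free_below_le (leq_addl k l) Hl).
- by exists k; apply: free_below_le Hk.
- by exists k; apply: free_below_le Hk.
Qed.

Lemma sat_free_below (M : Lstructure) f k (e e' : nat -> M) :
  free_below k f -> (forall i, i < k -> e i = e' i) -> (sat e f <-> sat e' f).
Proof.
elim: f k e e' => /= [a b|a b|f IH|f IHf g IHg|f IHf g IHg|f IHf g IHg|f IH|f IH] k e e'.
- by move=> [Ha Hb] H; rewrite !H.
- by move=> [Ha Hb] H; rewrite !H.
- by move=> Hf H; rewrite (IH _ _ _ Hf H).
- by move=> [Hf Hg] H; rewrite (IHf _ _ _ Hf H) (IHg _ _ _ Hg H).
- by move=> [Hf Hg] H; rewrite (IHf _ _ _ Hf H) (IHg _ _ _ Hg H).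
- by move=> [Hf Hg] H; rewrite (IHf _ _ _ Hf H) (IHg _ _ _ Hg H).
- move=> Hf H; have E a : sat (scons a e) f <-> sat (scons a e') f.
    by apply: (IH _ _ _ Hf) => -[|i] //=; apply: H.
  by split=> Ha a; apply/E.
- move=> Hf H; have E a : sat (scons a e) f <-> sat (scons a e') f.
    by apply: (IH _ _ _ Hf) => -[|i] //=; apply: H.
  by split=> -[a Ha]; exists a; apply/E.
Qed.

Lemma Def_ex_opr0 (M : Lstructure) (HM : isMOST M) Gam (GC : formula_class Gam) b
  (z x : (nat -> M) -> M) : isterm b z -> isterm b x ->
  Def Gam b (fun e => exists y, opr (x e) y ∈ z e).
Proof.
move=> Hz Hx.
apply: (@Def_iff _ _ _ (fun e => exists y, opr (x e) y ∈ z e /\ True)); last by ddef.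
by move=> e; split=> [[y []]|[y]]; exists y.
Qed.

Ltac ddef_atom ::= first
  [ apply: Def_eq_upr; dterm | apply: Def_eq_opr; dterm
  | apply: Def_opr_mem; dterm | apply: Def_trans; dterm
  | apply: Def_ex_opr0; dterm
  | apply: Def_ex_opr; [dterm|dterm|] | apply: Def_all_opr; [dterm|dterm|]
  | apply: Def_ex_opr2; [dterm|] | apply: Def_all_opr2; [dterm|] ].

(** * The Mostowski collapse of a well-founded relation *)

Section Collapse.
Variable M : Lstructure.
Context {HM : isMOST M}.
Implicit Types x y z u v w p q r s t a : M.

Definition wfr (E D : M) := forall s, subset_in s D -> (exists q, q ∈ s) ->
  exists q, q ∈ s /\ forall p, p ∈ s -> ~ opr p q ∈ E.

(** A partial collapse, with domain closed under [E]-predecessors. Only bounded quantifiers are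
    needed to define it, so that the existence of a partial collapse defined at a given point is a
    Sigma_1 property. *)
Definition pcoll (E D h : M) := forall q v, opr q v ∈ h ->
  [/\ q ∈ D, forall v', opr q v' ∈ h -> v' = v,
      forall p, p ∈ D -> opr p q ∈ E -> exists u, opr p u ∈ h /\ u ∈ v
    & forall u, u ∈ v -> exists p, p ∈ D /\ (opr p q ∈ E /\ opr p u ∈ h)].

Definition is_coll (E D g : M) :=
  pcoll E D g /\ forall q, q ∈ D -> exists v, opr q v ∈ g.

Lemma Def_pcoll Gam (GC : formula_class Gam) b (E D h : (nat -> M) -> M) :
  isterm b E -> isterm b D -> isterm b h ->
  Def Gam b (fun e => pcoll (E e) (D e) (h e)).
Proof.
move=> HE HD Hh.
apply: (@Def_iff _ _ _ (fun e => forall q v, opr q v ∈ h e ->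
  (q ∈ D e /\ (forall v', opr q v' ∈ h e -> v' = v)) /\
  ((forall p, p ∈ D e -> opr p q ∈ E e -> exists u, opr p u ∈ h e /\ u ∈ v) /\
   (forall u, u ∈ v -> exists p, p ∈ D e /\ (opr p q ∈ E e /\ opr p u ∈ h e))))).
  move=> e; split=> H q v Hqv; first by case: (H q v Hqv) => -[? ?] [].
  by case: (H q v Hqv).
ddef.
Qed.

Variables (E D : M).
Hypothesis wfED : wfr E D.

(** At an [E]-minimal point of disagreement the predecessors have equal values, and then so has the
    point itself. *)
Lemma pcoll_agree h h' : pcoll E D h -> pcoll E D h' ->
  forall q v v', opr q v ∈ h -> opr q v' ∈ h' -> v = v'.
Proof.
move=> Hh Hh' q v v' Hq Hq'; apply: NNPP => HN.
pose P q := exists v, opr q v ∈ h /\ exists v', opr q v' ∈ h' /\ ~ v = v'.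
have HP : Def Delta0 true (fun e => P (e 0)) by rewrite /P; ddef.
have [||q0 [/(sepE _ _ HP) [Hq0 [w [Hw [w' [Hw' Hne]]]]] Hmin]] :=
  @wfED (sep D P).
- by move=> z /(sepE _ _ HP) [].
- exists q; apply/sepE => //; split; first by case: (Hh _ _ Hq).
  by exists v; split=> //; exists v'.
- have Heq p u u' : p ∈ D -> opr p q0 ∈ E -> opr p u ∈ h -> opr p u' ∈ h' -> u = u'.
    move=> Hp HpE Hu Hu'; apply: NNPP => Hneu; apply: (Hmin p) => //.
    apply/sepE => //; split=> //; by exists u; split=> //; exists u'.
  have [_ _ H3 H4] := Hh _ _ Hw; have [_ _ H3' H4'] := Hh' _ _ Hw'.
  apply: Hne; apply: ext => u; split.
  + move=> /H4 [p [Hp [HpE Hpu]]]; have [u' [Hpu' Hu']] := H3' p Hp HpE.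
    by rewrite (Heq p u u').
  + move=> /H4' [p [Hp [HpE Hpu]]]; have [u' [Hpu' Hu']] := H3 p Hp HpE.
    by rewrite -(Heq p u' u).
Qed.

Lemma pcoll_Un C : (forall h, h ∈ C -> pcoll E D h) -> pcoll E D (Un C).
Proof.
move=> HC q v /UnE [h [Hh Hq]]; have [H1 H2 H3 H4] := HC _ Hh _ _ Hq; split=> //.
- move=> v' /UnE [h' [Hh' Hq']].
  exact: (pcoll_agree (HC _ Hh') (HC _ Hh) Hq' Hq).
- move=> p Hp HpE; have [u [Hu Huv]] := H3 p Hp HpE.
  by exists u; split=> //; apply/UnE; exists h.
- move=> u Hu; have [p [Hp [HpE Hpu]]] := H4 u Hu.
  by exists p; split=> //; split=> //; apply/UnE; exists h.
Qed.

Lemma pcoll_ext h q : pcoll E D h -> q ∈ D ->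
  (forall p, p ∈ D -> opr p q ∈ E -> exists u, opr p u ∈ h) ->
  exists h', pcoll E D h' /\ exists v, opr q v ∈ h'.
Proof.
move=> Hh Hq Hpred.
case: (classic (exists v, opr q v ∈ h)) => Hqh; first by exists h.
pose P u := exists p, p ∈ D /\ (opr p q ∈ E /\ opr p u ∈ h).
have HP : Def Delta0 true (fun e => P (e 0)) by rewrite /P; ddef.
pose V := sep (rng h) P.
have VE u : u ∈ V <-> P u.
  rewrite sepE //; split=> [[]//|Hu]; split=> //.
  by case: Hu => p [_ [_ Hpu]]; apply/rngE; exists p.
pose h' := Cup h (sg (opr q V)).
have h'E p u : opr p u ∈ h' <-> opr p u ∈ h \/ (p = q /\ u = V).
  rewrite CupE sgE; split=> [[|/opr_inj]|[|[-> ->]]]; auto.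
exists h'; split; last by exists V; apply/h'E; auto.
move=> q1 v /h'E [Hq1|[-> ->]]; last first.
- split=> //.
  + by move=> v' /h'E [Hv'|[]//]; case: Hqh; exists v'.
  + move=> p Hp HpE; have [u Hu] := Hpred p Hp HpE.
    by exists u; split; [apply/h'E; left|apply/VE; exists p].
  + move=> u /VE [p [Hp [HpE Hpu]]]; exists p; do 2 split=> //.
    by apply/h'E; left.
- have [H1 H2 H3 H4] := Hh _ _ Hq1; split=> //.
  + move=> v' /h'E [/H2 //|[Eq _]]; case: Hqh; exists v; by rewrite -Eq.
  + move=> p Hp HpE; have [u [Hu Huv]] := H3 p Hp HpE.
    by exists u; split=> //; apply/h'E; left.
  + move=> u Hu; have [p [Hp [HpE Hpu]]] := H4 u Hu.
    by exists p; do 2 split=> //; apply/h'E; left.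
Qed.

Lemma Def_pcoll_dom : Def Delta0 true (fun e : nat -> M =>
  pcoll E D (e 0) /\ exists v, opr (e 1) v ∈ e 0).
Proof. by apply: Def_and; [apply: Def_pcoll; dterm|ddef]. Qed.

Lemma pcoll_cover a : (forall q, q ∈ a -> exists h, pcoll E D h /\ exists v, opr q v ∈ h) ->
  exists h, pcoll E D h /\ forall q, q ∈ a -> exists v, opr q v ∈ h.
Proof.
move=> Ha; have [C HC] := collect Def_pcoll_dom Ha.
have Hd : Def Delta0 true (fun e : nat -> M => pcoll E D (e 0)).
  by apply: Def_pcoll; dterm.
exists (Un (sep C (pcoll E D))); split.
- by apply: pcoll_Un => h /(sepE _ _ Hd) [].
- move=> q /HC [h [HhC [Hh [v Hv]]]]; exists v; apply/UnE; exists h; split=> //.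
  exact/sepE.
Qed.

(** The points reached by some partial collapse form a set [S] by Sigma_1-separation. At a minimal
    point outside [S] all predecessors are reached, Delta_0-collection unites their partial
    collapses, and the union extends by one point. *)
Theorem mostowski : exists g, is_coll E D g.
Proof.
suff Hall q : q ∈ D -> exists h, pcoll E D h /\ exists v, opr q v ∈ h.
  by have [g [Hg Hd]] := pcoll_cover Hall; exists g.
move=> Hq; apply: NNPP => HN.
have [S HS] := @sep_sigma _ _ D
  (fun q h => pcoll E D h /\ exists v, opr q v ∈ h) Def_pcoll_dom.
have HP : Def Delta0 true (fun e : nat -> M => ~ e 0 ∈ S) by ddef.
have [||q0 [/(sepE _ _ HP) [Hq0 HqS] Hmin]] := @wfED (sep D (fun q => ~ q ∈ S)).
- by move=> z /(sepE _ _ HP) [].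
- by exists q; apply/sepE => //; split=> // /HS [_].
have HQ : Def Delta0 true (fun e : nat -> M => opr (e 0) q0 ∈ E) by ddef.
have [p|h [Hh Hdom]] := @pcoll_cover (sep D (fun p => opr p q0 ∈ E)).
  move=> /(sepE _ _ HQ) [Hp HpE]; apply: NNPP => HNp.
  by apply: (Hmin p) => //; apply/sepE => //; split=> // /HS [_].
apply: HqS; apply/HS; split=> //; apply: (pcoll_ext Hh) => // p Hp HpE.
by apply: Hdom; apply/sepE.
Qed.

End Collapse.

Ltac ddef_atom ::= first
  [ apply: Def_pcoll; dterm
  | apply: Def_eq_upr; dterm | apply: Def_eq_opr; dterm
  | apply: Def_opr_mem; dterm | apply: Def_trans; dterm
  | apply: Def_ex_opr0; dterm
  | apply: Def_ex_opr; [dterm|dterm|] | apply: Def_all_opr; [dterm|dterm|]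
  | apply: Def_ex_opr2; [dterm|] | apply: Def_all_opr2; [dterm|] ].

(** * Transitive images as collapses; supertransitive sets *)

Section CollapseMore.
Variable M : Lstructure.
Context {HM : isMOST M}.
Implicit Types x y z u v w p q r s t a : M.

(** The membership relation on the range of [F], carried back to its domain. *)
Definition pullback (D F : M) : M := sep (prod D D)
  (fun z => exists p u, opr p u ∈ F /\ exists q v, opr q v ∈ F /\
            (u ∈ v /\ z = opr p q)).

Definition partial_map (D F t : M) :=
  (forall p u, opr p u ∈ F -> p ∈ D /\ u ∈ t) /\
  (forall p u u', opr p u ∈ F -> opr p u' ∈ F -> u = u').

Definition onto_trans (D F t : M) :=
  [/\ transitive_in t, partial_map D F t & forall u, u ∈ t -> exists p, opr p u ∈ F].

Lemma pullbackE (D F p q t : M) : partial_map D F t ->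
  opr p q ∈ pullback D F <->
  exists u v, [/\ opr p u ∈ F, opr q v ∈ F & u ∈ v].
Proof.
move=> [HF _]; rewrite /pullback sepE; last by ddef.
rewrite opr_prod; split.
- by move=> [_ [p' [u [Hu [q' [v [Hv [Huv /opr_inj [-> ->]]]]]]]]]; exists u, v.
- move=> [u [v [Hu Hv Huv]]]; split.
    by case: (HF _ _ Hu); case: (HF _ _ Hv).
  by exists p, u; split=> //; exists q, v.
Qed.

(** A point outside the domain of [F] has no predecessors and is minimal; if there is none in [s],
    foundation applies to the image of [s]. *)
Lemma pullback_wf (D F t : M) : partial_map D F t -> wfr (pullback D F) D.
Proof.
move=> HF s Hs [q0 Hq0]; have [H1 H2] := HF.
case: (classic (forall q, q ∈ s -> exists u, opr q u ∈ F)) => Hdom; last first.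
  have [q [Hq Hn]] : exists q, q ∈ s /\ ~ exists u, opr q u ∈ F.
    apply: NNPP => HN; apply: Hdom => q Hq; apply: NNPP => Hn; apply: HN.
    by exists q.
  exists q; split=> // p Hp /(pullbackE _ _ HF) [u [v [_ Hv _]]]; apply: Hn.
  by exists v.
pose P u := exists q, q ∈ s /\ opr q u ∈ F.
have HP : Def Delta0 true (fun e => P (e 0)) by rewrite /P; ddef.
have [|u [/(sepE _ _ HP) [Hu [q [Hq Hqu]]] Hmin]] := @found _ _ (sep t P).
  have [u Hu] := Hdom _ Hq0; exists u; apply/sepE => //; split.
    by case: (H1 _ _ Hu).
  by exists q0.
exists q; split=> // p Hp /(pullbackE _ _ HF) [w [v [Hw Hv Hwv]]].
rewrite (H2 _ _ _ Hv Hqu) in Hwv.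
apply: (Hmin w Hwv); apply/sepE => //; split; first by case: (H1 _ _ Hw).
by exists p.
Qed.

(** Induction on [u] in the transitive set [t]. A transitive image of [D] is thus recovered from a
    relation on [D], so a set with the collapses of all well-founded relations on [D] bounds all
    transitive images of [D]. *)
Lemma pullback_coll (D F t g : M) : onto_trans D F t ->
  is_coll (pullback D F) D g -> forall p u, opr p u ∈ F -> opr p u ∈ g.
Proof.
move=> [Ht HF H3] [Hg Hdom] p u Hpu; have [H1 H2] := HF.
have Hut : u ∈ t by case: (H1 _ _ Hpu).
have HP : Def Delta0 true (fun e : nat -> M =>
   forall p, p ∈ D -> opr p (e 0) ∈ F -> opr p (e 0) ∈ g) by ddef.
suff : forall p, p ∈ D -> opr p u ∈ F -> opr p u ∈ g.
  by apply=> //; case: (H1 _ _ Hpu).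
move: {p Hpu} u Hut.
apply: (eps_ind (P := fun u => forall p, p ∈ D -> opr p u ∈ F -> opr p u ∈ g) Ht HP).
move=> u Hut IH p Hp Hpu.
have [v Hv] := Hdom p Hp; have [_ G2 G3 G4] := Hg _ _ Hv.
suff -> : u = v by [].
apply: ext => w; split=> Hw.
- have [p' Hp'] := H3 w (Ht u Hut w Hw).
  have Hp'D : p' ∈ D by case: (H1 _ _ Hp').
  have [|w' [Hw' Hw'v]] := G3 p' Hp'D.
    by apply/(pullbackE _ _ HF); exists w, u.
  have Hpw := IH w Hw p' Hp'D Hp'.
  by have [_ Hfun _ _] := Hg _ _ Hpw; rewrite -(Hfun _ Hw').
- have [p' [Hp'D [/(pullbackE _ _ HF) [w' [u' [Hw' Hu' Hwu]]] Hp'w]]] := G4 w Hw.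
  rewrite (H2 _ _ _ Hu' Hpu) in Hwu.
  have Hpw := IH w' Hwu p' Hp'D Hw'.
  by have [_ Hfun _ _] := Hg _ _ Hpw; rewrite (Hfun _ Hp'w).
Qed.

(* The relations E range over subsets of [Pw (Pw k)], which contains all
   subsets of k x k; pairs outside k x k are ignored by [is_coll]. *)
Definition coll_closed k p2 z := forall E, subset_in E p2 -> wfr E k ->
  exists g, g ∈ z /\ is_coll E k g.

(** With [Pw k] as a parameter the quantifier over subsets is bounded and the condition is Delta_0.
    The idle conjunct [q = q] gives the shape that [Def_exin] expects. *)
Lemma wfr_Pw E k : wfr E k <-> forall s, s ∈ Pw k -> (exists q, q ∈ s /\ q = q) ->
  exists q, q ∈ s /\ forall p, p ∈ s -> ~ opr p q ∈ E.
Proof.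
split=> H s Hs Hex; apply: H; rewrite -?PwE // ?PwE //; case: Hex => q; first case.
  by exists q.
by exists q.
Qed.

Lemma coll_closed_exists k p2 : exists z, coll_closed k p2 z.
Proof.
pose P E g := (forall s, s ∈ Pw k -> (exists q, q ∈ s /\ q = q) ->
  exists q, q ∈ s /\ forall p, p ∈ s -> ~ opr p q ∈ E) -> is_coll E k g.
have HP : Def Delta0 true (fun e => P (e 1) (e 0)).
  by rewrite /P /is_coll; ddef.
have [E HE|z Hz] := @collect _ _ (Pw p2) P HP.
  case: (classic (wfr E k)) => Hwf.
    by have [g Hg] := mostowski Hwf; exists g => _.
  by exists E => /wfr_Pw.
exists z => E /PwE /Hz [g [Hg HPg]] /wfr_Pw Hwf; exists g; split=> //.
exact: HPg.
Qed.

Definition strans K := transitive_in K /\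
  forall y, y ∈ K -> forall x, subset_in x y -> x ∈ K.

Lemma strans_exists x : exists K, strans K /\ x ∈ K.
Proof.
have [t [Ht Hx]] := tc_exists x.
exists (Pw t); split; last by apply/PwE; apply: Ht.
split.
- by move=> y /PwE Hy z Hz; apply/PwE; apply: Ht; apply: Hy.
- by move=> y /PwE Hy z Hz; apply/PwE => w /Hz /Hy.
Qed.

Lemma fin_set (e : nat -> M) N : exists s, forall i, i < N -> e i ∈ s.
Proof.
elim: N => [|N [s Hs]]; first by exists (e 0).
exists (Cup s (sg (e N))) => i; rewrite ltnS leq_eqVlt => /orP[/eqP ->|/Hs].
- by apply/CupE; right; apply/sgE.
- by move=> ?; apply/CupE; left.
Qed.

Lemma Def_scons Gam b (P : (nat -> M) -> Prop) : Def Gam b P ->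
  Def Gam b (fun e => P (scons (e 0) (fun n => e n.+1))).
Proof.
suff E e : scons (e 0) (fun n => e n.+1) = e :> (nat -> M).
  by apply: Def_iff => e; rewrite E.
by apply: functional_extensionality => -[].
Qed.

(** Over a set closed under elements and subsets, a quantifier over the subsets of [e i] may be
    bounded by [C]. Hence the Delta_0 schemes apply to powerset formulas whose parameters are
    confined to one set. *)
Lemma Delta0P_restrict f C : Delta0P f -> strans C -> exists P,
  Def Delta0 true P /\
  forall e : nat -> M, (forall i, e i ∈ C) -> (sat e f <-> P e).
Proof.
move=> Hf [Ct Cs].
have HC e x i : (forall i, e i ∈ C) -> x ∈ e i -> forall i, scons x e i ∈ C.
  by move=> He Hx [|k] //=; apply: (Ct (e i)).
have HC' e x i : (forall i, e i ∈ C) -> subset_in x (e i) ->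
    forall i, scons x e i ∈ C.
  by move=> He Hx [|k] //=; apply: (Cs (e i)).
elim: Hf => {f}.
- by move=> i j; exists (fun e => e i ∈ e j); split=> //; ddef.
- by move=> i j; exists (fun e => e i = e j); split=> //; ddef.
- move=> f _ [P [HP H]]; exists (fun e => ~ P e); split; first by ddef.
  by move=> e /H /= ->.
- move=> f g _ [P [HP H]] _ [Q [HQ H']]; exists (fun e => P e /\ Q e).
  by split; [ddef|move=> e He /=; rewrite H // H'].
- move=> f g _ [P [HP H]] _ [Q [HQ H']]; exists (fun e => P e \/ Q e).
  by split; [ddef|move=> e He /=; rewrite H // H'].
- move=> f g _ [P [HP H]] _ [Q [HQ H']]; exists (fun e => P e -> Q e).
  by split; [ddef|move=> e He /=; rewrite H // H'].
- move=> i f _ [P [HP H]].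
  exists (fun e => forall x, x ∈ e i -> P (scons x e)); split.
    by apply: Def_allin; [dterm|cbv beta; apply: Def_scons].
  by move=> e He /=; split=> Hx x Hxe; apply/H; auto; apply: HC => //; exact: Hxe.
- move=> i f _ [P [HP H]].
  exists (fun e => exists x, x ∈ e i /\ P (scons x e)); split.
    by apply: Def_exin; [dterm|cbv beta; apply: Def_scons].
  move=> e He /=; split=> -[x [Hxe Hx]]; exists x; split=> //; apply/H; auto;
    by apply: HC => //; exact: Hxe.
- move=> i f _ [P [HP H]].
  exists (fun e => forall x, x ∈ C -> subset_in x (e i) -> P (scons x e)); split.
    apply: Def_allin; [dterm|cbv beta; apply: Def_imp; first by ddef].
    exact: Def_scons.
  move=> e He /=; split=> [Hx x HxC Hxe|Hx x Hxe]; apply/H; auto.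
  + by apply: HC' => //; exact: Hxe.
  + by apply: HC' => //; exact: Hxe.
  + by apply: Hx => //; apply: (Cs (e i)).
- move=> i f _ [P [HP H]].
  exists (fun e => exists x, x ∈ C /\ (subset_in x (e i) /\ P (scons x e))); split.
    apply: Def_exin; [dterm|cbv beta; apply: Def_and; first by ddef].
    exact: Def_scons.
  move=> e He /=; split=> [[x [Hxe Hx]]|[x [HxC [Hxe Hx]]]]; exists x; split=> //.
  + exact: (Cs (e i)).
  + by split=> //; apply/H; auto; apply: HC' => //; exact: Hxe.
  + by apply/H; auto; apply: HC' => //; exact: Hxe.
Qed.

Lemma sepPE a (P : M -> Prop) z : Def Delta0P true (fun e => P (e 0)) ->
  (z ∈ sep a P <-> z ∈ a /\ P z).
Proof.
move=> HP.
suff Hex : exists y, forall z, z ∈ y <-> z ∈ a /\ P z.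
  exact: (epsilon_spec (inhabits a) _ Hex).
have [f [e0 [Hf Hs]]] := Def_params a HP.
have [k Hk] := free_below_exists f.
have [s Hs0] := fin_set (scons a e0) k.+1.
have [C [HC HsC]] := strans_exists s.
have [Q [HQ HQE]] := Delta0P_restrict Hf HC.
(* Only indices below [k] matter; resetting the others to [a] puts the whole environment into
   [C]. *)
pose e1 i := if i < k then e0 i else a.
have HaC : a ∈ C by apply: (HC.1 s) => //; apply: (Hs0 0).
have He1 i : e1 i ∈ C.
  rewrite /e1; case: ifP => Hi //; apply: (HC.1 s) => //; exact: (Hs0 i.+1).
pose ee u := fun n => if odd n then e1 n./2 else u.
have HQ' : Def Delta0 true (fun e => Q (ee (e 0))).
  move: HQ => [g [ts [Hg _ Hgs]]].
  pose us n := match ts n with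
    | inl i => if odd i then inr (e1 i./2) else inl 0 | inr c => inr c end.
  exists g, us; split=> // e; rewrite -Hgs.
  set x1 := (X in sat X g); set x2 := (X in _ <-> sat X g).
  suff -> : x1 = x2 by [].
  apply: functional_extensionality => n; rewrite /x1 /x2 /us /ee.
  by case: (ts n) => //= i; case: ifP => Hi /=; rewrite ?Hi.
exists (sep a (fun u => Q (ee u))) => u.
have E : sat (ee u) f <-> P u.
  rewrite -(Hs (fun _ => u)); apply: (sat_free_below Hk) => i Hi.
  by rewrite /ee; case: ifP => // _; rewrite /e1; have -> : i./2 < k by lia.
have HeC : u ∈ a -> forall i, ee u i ∈ C.
  by move=> Hu i; rewrite /ee; case: ifP => // _; exact: (HC.1 a).
by rewrite sepE // -E; split=> -[Hu Hp]; split=> //; apply/HQE; auto.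
Qed.

End CollapseMore.

(** * Löwenheim–Skolem inside a model of MOST *)

Section Codes.
Variable M : Lstructure.
Context {HM : isMOST M}.
Implicit Types x y z u v w p q r s t a h : M.

Variables (X t o : M).
Hypotheses (o_empty : is_empty o) (oX : o ∈ X)
  (X_succ : forall y, y ∈ X -> exists w, w ∈ X /\ is_succ w y).

Lemma Def_succ Gam (GC : formula_class Gam) b (w x : (nat -> M) -> M) :
  isterm b w -> isterm b x -> Def Gam b (fun e => is_succ (w e) (x e)).
Proof.
move=> Hw Hx.
apply: (@Def_iff _ _ _ (fun e => (x e ∈ w e /\ subset_in (x e) (w e)) /\
  forall z, z ∈ w e -> z ∈ x e \/ z = x e)); last by ddef.
move=> e; split=> [[[H1 H2] H3] z|H].
- by split=> [/H3|[/H2|->]].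
- split; last by move=> z /H.
  by split; [apply/H; right|move=> z Hz; apply/H; left].
Qed.

Let Y := Cup X t.
Let H := Pw Y.
Let Q := Pw H.

(* The injection [shift] of Y into itself misses the empty set o, so the maps
   A |-> shift[A] and A |-> shift[A] u {o} of Pw Y have disjoint ranges. *)
Definition shift y y' := (y ∈ X /\ is_succ y' y) \/ (~ y ∈ X /\ y' = y).

Lemma shift_total y : y ∈ Y -> exists y', y' ∈ Y /\ shift y y'.
Proof.
move=> Hy; case: (classic (y ∈ X)) => HX.
- have [w [Hw Hs]] := X_succ HX; exists w; split; last by left.
  by apply/CupE; left.
- by exists y; split=> //; right.
Qed.

Lemma is_succ_inj w x y : is_succ w x -> is_succ w y -> x = y.
Proof.
move=> Hx Hy.
have /Hy [Hxy|//] : x ∈ w by apply/Hx; right.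
have /Hx [Hyx|//] : y ∈ w by apply/Hy; right.
by case: (mem_asym Hxy).
Qed.

Lemma shift_inj y z y' : shift y y' -> shift z y' -> y = z.
Proof.
have HXs u : u ∈ X -> is_succ y' u -> y' ∈ X.
  move=> Hu Hs; have [w [Hw Hsw]] := X_succ Hu.
  suff -> : y' = w by []. by apply: ext => v; rewrite Hs Hsw.
move=> [[Hy Hs]|[Hy E]] [[Hz Hs']|[Hz E']].
- exact: is_succ_inj Hs Hs'.
- by case: Hz; rewrite -E'; apply: HXs Hs.
- by case: Hy; rewrite -E; apply: HXs Hs'.
- by rewrite -E.
Qed.

Lemma shift_o y : ~ shift y o.
Proof.
move=> [[_ Hs]|[Hn E]]; last by apply: Hn; rewrite -E.
by apply: (o_empty (y := y)); apply/Hs; right.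
Qed.

Definition tag (d : bool) h h' := subset_in h' Y /\ forall y, y ∈ Y ->
  (y ∈ h' <-> (d /\ y = o) \/ exists y', y' ∈ h /\ shift y' y).

Lemma tag_total d h : exists h', h' ∈ H /\ tag d h h'.
Proof.
pose P y := (d /\ y = o) \/ exists y', y' ∈ h /\ shift y' y.
have HP : Def Delta0 true (fun e => P (e 0)).
  by rewrite /P /shift; ddef; apply: Def_succ; dterm.
exists (sep Y P).
have Hs : subset_in (sep Y P) Y by move=> y /(sepE _ _ HP) [].
split; first exact/PwE.
by split=> // y Hy; rewrite sepE //; split=> [[]|].
Qed.

Lemma tag_inj d h1 h2 h' : h1 ∈ H -> h2 ∈ H -> tag d h1 h' -> tag d h2 h' -> h1 = h2.
Proof.
have Hsub a b : a ∈ H -> tag d a h' -> tag d b h' -> subset_in a b.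
  move=> /PwE Ha [_ H1] [_ H2] y Hy.
  have [y' [Hy' Hs]] := shift_total (Ha y Hy).
  have /(H2 _ Hy') [[_ E]|[z [Hz Hzs]]] : y' ∈ h' by apply/H1 => //; right; exists y.
    by case: (@shift_o y); rewrite -E.
  by rewrite (shift_inj Hs Hzs).
by move=> Ha Hb Ht1 Ht2; apply: ext => z; split; apply: Hsub.
Qed.

Lemma tag_disjoint h1 h2 h' : tag false h1 h' -> ~ tag true h2 h'.
Proof.
move=> [_ H1] [_ H2]; have Ho : o ∈ Y by apply/CupE; left.
have /(H1 _ Ho) [[]//|[y [_ /shift_o]]] // : o ∈ h'.
by apply/H2 => //; left.
Qed.

(** Two families of subsets of [Y] are coded by the disjoint union of their tagged copies, which is
    again such a family, whereas Kuratowski pairs would leave [Q]. *)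
Definition cpair w a b := subset_in w H /\ forall h, h ∈ H ->
  (h ∈ w <-> (exists h', h' ∈ a /\ tag false h' h) \/
             (exists h', h' ∈ b /\ tag true h' h)).

Lemma Def_cpair (w a b : (nat -> M) -> M) :
  isterm true w -> isterm true a -> isterm true b ->
  Def Delta0 true (fun e => cpair (w e) (a e) (b e)).
Proof.
by move=> Hw Ha Hb; rewrite /cpair /tag /shift; ddef; apply: Def_succ; dterm.
Qed.

Lemma cpair_total a b : exists w, w ∈ Q /\ cpair w a b.
Proof.
pose P h := (exists h', h' ∈ a /\ tag false h' h) \/
             (exists h', h' ∈ b /\ tag true h' h).
have HP : Def Delta0 true (fun e => P (e 0)).
  by rewrite /P /tag /shift; ddef; apply: Def_succ; dterm.
exists (sep H P).
have Hs : subset_in (sep H P) H by move=> y /(sepE _ _ HP) [].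
split; first exact/PwE.
by split=> // y Hy; rewrite sepE //; split=> [[]|].
Qed.

Lemma cpair_inj w a b a' b' : a ∈ Q -> b ∈ Q -> a' ∈ Q -> b' ∈ Q ->
  cpair w a b -> cpair w a' b' -> a = a' /\ b = b'.
Proof.
have Hsub a1 b1 a2 b2 : a1 ∈ Q -> b1 ∈ Q -> a2 ∈ Q -> b2 ∈ Q ->
    cpair w a1 b1 -> cpair w a2 b2 -> subset_in a1 a2 /\ subset_in b1 b2.
  move=> /PwE Ha1 /PwE Hb1 /PwE Ha2 /PwE Hb2 [_ H1] [_ H2]; split=> h Hh.
  - have [h' [Hh' Ht]] := tag_total false h.
    have /(H2 _ Hh') [[k [Hk Hkt]]|[k [Hk Hkt]]] : h' ∈ w.
      by apply/H1 => //; left; exists h.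
    + by rewrite (tag_inj (Ha1 _ Hh) (Ha2 _ Hk) Ht Hkt).
    + by case: (tag_disjoint Ht Hkt).
  - have [h' [Hh' Ht]] := tag_total true h.
    have /(H2 _ Hh') [[k [Hk Hkt]]|[k [Hk Hkt]]] : h' ∈ w.
      by apply/H1 => //; right; exists h.
    + by case: (tag_disjoint Hkt Ht).
    + by rewrite (tag_inj (Hb1 _ Hh) (Hb2 _ Hk) Ht Hkt).
move=> Ha Hb Ha' Hb' Hc Hc'.
have [S1 S2] := Hsub _ _ _ _ Ha Hb Ha' Hb' Hc Hc'.
have [S3 S4] := Hsub _ _ _ _ Ha' Hb' Ha Hb Hc' Hc.
by split; apply: ext => z; split; auto.
Qed.

(** All that the term codes of the Skolem hull require: three labels, names for the elements of [t],
    and a pairing that stays inside [Q]. The double singleton lifts [x] to the level of [Q], and the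
    empty set, not being of that form, is free to name one further element. *)
Lemma codes_exist : exists (a0 a1 a2 : M) (pr : M -> M -> M -> Prop),
  [/\ [/\ a0 ∈ Q, a1 ∈ Q & a2 ∈ Q], [/\ ~ a0 = a1, ~ a0 = a2 & ~ a1 = a2],
      forall x, x ∈ t -> sg (sg x) ∈ Q /\ ~ sg (sg x) = a0,
      forall a b, exists w, w ∈ Q /\ pr w a b &
      (forall w a b a' b', a ∈ Q -> b ∈ Q -> a' ∈ Q -> b' ∈ Q ->
        pr w a b -> pr w a' b' -> a = a' /\ b = b') /\
      (forall w a b : (nat -> M) -> M, isterm true w -> isterm true a -> isterm true b ->
        Def Delta0 true (fun e => pr (w e) (a e) (b e)))].
Proof.
have Hsg x : ~ sg x = o.
  by move=> E; apply: (o_empty (y := x)); rewrite -E; apply/sgE.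
exists o, (sg o), (sg (sg o)), cpair; split.
- split; apply/PwE => z.
  + by move/o_empty.
  + by move/sgE ->; apply/PwE => y /o_empty.
  + by move/sgE ->; apply/PwE => y /sgE ->; apply/CupE; left.
- by split=> [/esym/Hsg|/esym/Hsg|/sg_inj /esym /Hsg].
- move=> x Hx; split; last exact: Hsg.
  by apply/PwE => z /sgE ->; apply/PwE => y /sgE ->; apply/CupE; right.
- exact: cpair_total.
- by split; [exact: cpair_inj|exact: Def_cpair].
Qed.

End Codes.

(** * The Skolem hull, indexed by codes of terms *)

Section Hull.
Variable M : Lstructure.
Context {HM : isMOST M}.
Implicit Types x z u v w p q r s a : M.

Variables (Q t y T W a0 a1 a2 : M) (pr : M -> M -> M -> Prop).
Variables (l : seq (nat * formula)) (n : nat).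
Let it k := nth (0, fEq 0 0) l k.

Hypotheses (T_trans : transitive_in T) (tT : subset_in t T) (yT : y ∈ T).
Hypothesis WO : well_orders W T.
Hypotheses (a0Q : a0 ∈ Q) (a1Q : a1 ∈ Q) (a2Q : a2 ∈ Q).
Hypotheses (a01 : ~ a0 = a1) (a02 : ~ a0 = a2) (a12 : ~ a1 = a2).
Hypothesis leafQ : forall x, x ∈ t -> sg (sg x) ∈ Q /\ ~ sg (sg x) = a0.
Hypothesis pr_total : forall a b, exists w, w ∈ Q /\ pr w a b.
Hypothesis pr_inj : forall w a b a' b', a ∈ Q -> b ∈ Q -> a' ∈ Q -> b' ∈ Q ->
  pr w a b -> pr w a' b' -> a = a' /\ b = b'.
Hypothesis Def_pr : forall w a b : (nat -> M) -> M,
  isterm true w -> isterm true a -> isterm true b ->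
  Def Delta0 true (fun e => pr (w e) (a e) (b e)).
Hypothesis it_ok : forall k, k < size l ->
  [/\ (it k).1 < n, Delta0 (it k).2 & free_below n.+1 (it k).2].

Let tl := Cup t (sg y).

(** The code of the constant term for [x], marked by [a2]; the name [a0] is reserved for the added
    element [y]. The bound variable [z] stands for [sg x], which keeps the definition Delta_0. *)
Definition leaf x w := exists w1, w1 ∈ Q /\
  (((x ∈ t /\ exists z, z ∈ w1 /\ (z = upr x x /\ w1 = upr z z)) \/
    (x = y /\ w1 = a0)) /\ pr w a2 w1).

Fixpoint cn m (qs : nat -> M) w : Prop :=
  if m is m'.+1 then
    exists w', w' ∈ Q /\ (cn m' (fun i => qs i.+1) w' /\ pr w (qs 0) w')
  else w = a0.

(** The index of a Skolem function is written in unary with [a0] and closed by [a1]. A compound code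
    therefore begins with [a0] or [a1] and a leaf with [a2], which gives unique readability. *)
Fixpoint ck k w w' : Prop :=
  if k is k'.+1 then exists w1, w1 ∈ Q /\ (ck k' w1 w' /\ pr w a0 w1)
  else pr w a1 w'.

Definition code k qs w := exists w', w' ∈ Q /\ (cn n qs w' /\ ck k w w').

(** Choosing the [W]-least witness makes the Skolem function definable by a Delta_0 formula with
    parameter [W]. *)
Definition sk k u ss := u ∈ ss (it k).1 /\ (sat (scons u ss) (it k).2 /\
  forall u', u' ∈ ss (it k).1 -> sat (scons u' ss) (it k).2 ->
  u' = u \/ opr u u' ∈ W).

Definition closed R :=
  (forall x, x ∈ tl -> forall w, w ∈ Q -> leaf x w -> opr w x ∈ R) /\
  forall k, k < size l -> forall qs ss, (forall i, i < n -> opr (qs i) (ss i) ∈ R) ->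
  forall u, u ∈ T -> sk k u ss -> forall w, w ∈ Q -> code k qs w -> opr w u ∈ R.

Fixpoint app2 m (qs ss e : nat -> M) : nat -> M :=
  if m is m'.+1 then app2 m' qs ss (scons (ss m') (scons (qs m') e)) else e.

Lemma app2_tail m qs ss e j : app2 m qs ss e (m.*2 + j) = e j.
Proof.
elim: m e j => //= m IH e j.
have -> : m.+1.*2 + j = m.*2 + j.+2 by lia.
by rewrite IH.
Qed.

Lemma app2_s m qs ss e i : i < m -> app2 m qs ss e i.*2 = ss i.
Proof.
elim: m e => //= m IH e; rewrite ltnS leq_eqVlt => /orP[/eqP ->|]; last exact: IH.
by have := app2_tail m qs ss (scons (ss m) (scons (qs m) e)) 0; rewrite addn0.
Qed.

Lemma app2_q m qs ss e i : i < m -> app2 m qs ss e i.*2.+1 = qs i.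
Proof.
elim: m e => //= m IH e; rewrite ltnS leq_eqVlt => /orP[/eqP ->|]; last exact: IH.
by have := app2_tail m qs ss (scons (ss m) (scons (qs m) e)) 1; rewrite addn1.
Qed.

Lemma app2_ext m qs qs' ss ss' e : (forall i, i < m -> qs i = qs' i) ->
  (forall i, i < m -> ss i = ss' i) -> app2 m qs ss e = app2 m qs' ss' e.
Proof.
elim: m e => //= m IH e Hq Hs; rewrite Hq // Hs //.
by apply: IH => i Hi; [apply: Hq|apply: Hs]; apply: ltnW.
Qed.

(** The number [m] of quantified pairs is external, so the result is still a single Delta_0 formula.
    In the environment [app2] the values stand at even and the codes at odd indices, and the old
    environment begins at [m.*2]. *)
Lemma Def_app2 m (R : (nat -> M) -> M) P : isterm true R -> Def Delta0 true P ->
  Def Delta0 true (fun e => forall qs ss,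
    (forall i, i < m -> opr (qs i) (ss i) ∈ R e) -> P (app2 m qs ss e)).
Proof.
elim: m R => [|m IH] R HR HP.
  by apply: Def_iff HP => e; split=> [H _ _ _|H] //=; apply: (H e e).
have HR2 := isterm_shift (fun n => n.+2) HR.
have H1 : Def Delta0 true (fun e => forall q s, opr q s ∈ R e ->
   (fun e' : nat -> M => forall qs ss,
     (forall i, i < m -> opr (qs i) (ss i) ∈ R (fun n => e' n.+2)) ->
     P (app2 m qs ss e')) (scons s (scons q e))).
  apply: Def_all_opr2 => //.
  have := IH _ HR2 HP; apply: Def_iff => e.
  suff -> : scons (e 0) (scons (e 1) (fun n0 => e n0.+2)) = e by [].
  by apply: functional_extensionality => -[|[]].
apply: Def_iff H1 => e; split.
- move=> H qs ss Hqs; apply: (H (qs m) (ss m)); first exact: Hqs.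
  by move=> i Hi; apply: Hqs; apply: ltnW.
- move=> H q s Hq qs ss Hqs.
  have := H (fun i => if i == m then q else qs i) (fun i => if i == m then s else ss i).
  rewrite /= eqxx.
  rewrite (@app2_ext m _ qs _ ss); [|by move=> i Hi; case: eqP => // E; lia..].
  apply=> i; rewrite ltnS.
  by case: eqP => [//|Hne] Hi; apply: Hqs; lia.
Qed.

Lemma Def_cn m (qs : (nat -> M) -> nat -> M) (w : (nat -> M) -> M) :
  (forall i, isterm true (fun e => qs e i)) -> isterm true w ->
  Def Delta0 true (fun e => cn m (qs e) (w e)).
Proof.
elim: m qs w => [|m IH] qs w Hq Hw /=; first by ddef.
apply: Def_exin; first dterm; cbv beta; apply: Def_and.
- apply: IH; last by dterm.
  by move=> i; apply: (isterm_shift succn (Hq i.+1)).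
- by apply: Def_pr; [dterm|apply: (isterm_shift succn (Hq 0))|dterm].
Qed.

Lemma Def_ck k (w w' : (nat -> M) -> M) : isterm true w -> isterm true w' ->
  Def Delta0 true (fun e => ck k (w e) (w' e)).
Proof.
elim: k w w' => [|k IH] w w' Hw Hw' /=; first by apply: Def_pr; dterm.
by ddef; [apply: IH|apply: Def_pr]; dterm.
Qed.

Lemma cn_ext m qs qs' w : (forall i, i < m -> qs i = qs' i) -> cn m qs w -> cn m qs' w.
Proof.
elim: m qs qs' w => //= m IH qs qs' w E [w' [Hw' [H1 H2]]].
exists w'; split=> //; split; last by rewrite -E.
by apply: IH H1 => i Hi; apply: E.
Qed.

Lemma sk_ext k u ss ss' : k < size l -> (forall i, i < n -> ss i = ss' i) ->
  sk k u ss -> sk k u ss'.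
Proof.
move=> Hk E [H1 [H2 H3]]; have [Hi _ Hf] := it_ok Hk.
have Hsat v : sat (scons v ss) (it k).2 <-> sat (scons v ss') (it k).2.
  by apply: (sat_free_below Hf) => -[|i] //= Hin; apply: E.
rewrite /sk -E // -Hsat; split=> //; split=> // u' Hu' /Hsat; exact: H3.
Qed.

Lemma Def_closed : Def Delta0 true (fun e : nat -> M => closed (e 0)).
Proof.
apply: Def_and.
  by rewrite /leaf; ddef; apply: Def_pr; dterm.
apply: Def_bigand => k Hk; have [_ HD _] := it_ok Hk.
pose P (e : nat -> M) := forall u, u ∈ T -> sk k u (fun i => e i.*2) ->
  forall w, w ∈ Q -> code k (fun i => e i.*2.+1) w -> opr w u ∈ e n.*2.
have HP : Def Delta0 true P.
  apply: Def_allin; first dterm; cbv beta; apply: Def_imp.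
    apply: Def_and; first by ddef.
    apply: Def_and; first by apply: Def_sat => // -[|i] /=; dterm.
    apply: Def_allin; first dterm; cbv beta; apply: Def_imp; last by ddef.
    by apply: Def_sat => // -[|i] /=; dterm.
  apply: Def_allin; first dterm; cbv beta; apply: Def_imp; last by ddef.
  apply: Def_exin; first dterm; cbv beta; apply: Def_and.
    by apply: Def_cn => [i|]; dterm.
  by apply: Def_ck; dterm.
have := @Def_app2 n (fun e => e 0) P (isterm_var _ _ _) HP.
have E qs ss e : (forall i, i < n -> app2 n qs ss e i.*2 = ss i) /\
   (forall i, i < n -> app2 n qs ss e i.*2.+1 = qs i) /\ app2 n qs ss e n.*2 = e 0.
  split; [by move=> i; apply: app2_s|split; first by move=> i; apply: app2_q].
  by have := app2_tail n qs ss e 0; rewrite addn0.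
apply: Def_iff => e; split=> H qs ss Hqs; have [E1 [E2 E3]] := E qs ss e.
- move=> u Hu Hsk w Hw [w' [Hw' [Hc Hck]]].
  have := H qs ss Hqs u Hu; rewrite E3; apply=> //.
    by apply: sk_ext Hsk => // i Hi; rewrite E1.
  by exists w'; split=> //; split=> //; apply: cn_ext Hc => i Hi; rewrite E2.
- move=> u Hu Hsk w Hw [w' [Hw' [Hc Hck]]]; rewrite E3.
  apply: (H qs ss Hqs u) => //; first by apply: sk_ext Hsk.
  by exists w'; split=> //; split=> //; apply: cn_ext Hc => i Hi; rewrite E2.
Qed.

Let QT := prod Q T.

(** The least closed relation, obtained as an intersection inside the power set of [Q] times [T].
    Only Delta_0-separation is used, and no recursion along the natural numbers of the model. *)
Definition hullgraph : M := sep QT (fun z => forall R, R ∈ Pw QT -> closed R -> z ∈ R).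
Let G := hullgraph.

Lemma GE z : z ∈ G <-> z ∈ QT /\ forall R, R ∈ Pw QT -> closed R -> z ∈ R.
Proof.
apply: sepE; apply: Def_allin; first dterm; cbv beta.
by apply: Def_imp; [apply: Def_closed|ddef].
Qed.

Lemma G_closed : closed G.
Proof.
split.
- move=> x Hx w Hw Hl; apply/GE; split.
    apply/opr_prod; split=> //; move: Hx => /CupE [/tT //|/sgE -> //].
  by move=> R HR [HR1 _]; apply: HR1.
- move=> k Hk qs ss Hqs u Hu Hsk w Hw Hc; apply/GE; split; first exact/opr_prod.
  move=> R HR HRc; apply: (HRc.2 k Hk qs ss) => // i Hi.
  by have /GE [_ H] := Hqs i Hi; apply: H.
Qed.

(** Leastness in the form that replaces induction on terms. *)
Lemma G_del z : closed (sep G (fun z' => ~ z' = z)) -> ~ z ∈ G.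
Proof.
have HD : Def Delta0 true (fun e : nat -> M => ~ e 0 = z) by ddef.
move=> Hc /[dup] Hz /GE [_ H].
have HR : sep G (fun z' => ~ z' = z) ∈ Pw QT.
  by apply/PwE => z' /(sepE _ _ HD) [/GE []].
by have /(sepE _ _ HD) [_] := H _ HR Hc.
Qed.

Lemma GQT q s : opr q s ∈ G -> q ∈ Q /\ s ∈ T.
Proof. by move/GE => -[/opr_prod]. Qed.

Lemma ck_inj k k' w x x' : x ∈ Q -> x' ∈ Q -> ck k w x -> ck k' w x' ->
  k = k' /\ x = x'.
Proof.
elim: k k' w => [|k IH] [|k'] w Hx Hx' /=.
- by move=> H1 H2; case: (pr_inj _ _ _ _ H1 H2).
- by move=> H1 [w1 [Hw1 [_ H2]]]; case: (pr_inj a1Q Hx a0Q Hw1 H1 H2) => /esym.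
- by move=> [w1 [Hw1 [_ H2]]] H1; case: (pr_inj a1Q Hx' a0Q Hw1 H1 H2) => /esym.
- move=> [w1 [Hw1 [H1 H2]]] [w2 [Hw2 [H3 H4]]].
  have [_ E] := pr_inj a0Q Hw1 a0Q Hw2 H2 H4; subst.
  by case: (IH _ _ Hx Hx' H1 H3) => -> ->.
Qed.

Lemma cn_inj m qs qs' w : (forall i, i < m -> qs i ∈ Q) ->
  (forall i, i < m -> qs' i ∈ Q) -> cn m qs w -> cn m qs' w ->
  forall i, i < m -> qs i = qs' i.
Proof.
elim: m qs qs' w => // m IH qs qs' w Hq Hq' [w1 [Hw1 [H1 H2]]] [w2 [Hw2 [H3 H4]]].
have [E0 E] := pr_inj (Hq 0 isT) Hw1 (Hq' 0 isT) Hw2 H2 H4; subst.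
case=> [_|i Hi]; first exact: E0.
apply: (IH (fun i => qs i.+1) (fun i => qs' i.+1) w2) => // j Hj;
  [exact: Hq|exact: Hq'].
Qed.

Lemma leaf_ck k w x x' : x ∈ Q -> ck k w x -> leaf x' w -> False.
Proof.
move=> Hx; case: k => [|k] /= => [H1|[w1 [Hw1 [_ H1]]]] [w2 [Hw2 [_ H2]]].
- by case: (pr_inj a1Q Hx a2Q Hw2 H1 H2).
- by case: (pr_inj a0Q Hw1 a2Q Hw2 H1 H2).
Qed.

Lemma leaf_inj x x' w : leaf x w -> leaf x' w -> x = x'.
Proof.
move=> [w1 [Hw1 [H1 P1]]] [w2 [Hw2 [H2 P2]]].
have [_ E] := pr_inj a2Q Hw1 a2Q Hw2 P1 P2; subst w2.
case: H1 H2 => [[Hx [z [_ [-> E]]]]|[-> E]] [[Hx' [z' [_ [-> E']]]]|[-> E']] //.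
- by move: E'; rewrite E => /sg_inj /sg_inj.
- by have [_ []] := leafQ Hx; rewrite -E'.
- by have [_ []] := leafQ Hx'; rewrite -E.
Qed.

Lemma WE u v : related W u v <-> opr u v ∈ W.
Proof.
split; first by move=> [p [Hp /is_opairE <-]].
by move=> H; exists (opr u v); split=> //; apply/is_opairE.
Qed.

Lemma sk_uniq k u u' ss : (forall i, i < n -> ss i ∈ T) -> k < size l ->
  sk k u ss -> sk k u' ss -> u = u'.
Proof.
move=> Hss Hk [H1 [H2 H3]] [H1' [H2' H3']]; have [Hi _ _] := it_ok Hk.
have Hu : u ∈ T by apply: T_trans (Hss _ Hi) _ H1.
have Hu' : u' ∈ T by apply: T_trans (Hss _ Hi) _ H1'.
have [_ Hirr Htr _ _] := WO.
case: (H3 _ H1' H2') => [-> //|/WE Huu'].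
case: (H3' _ H1 H2) => [-> //|/WE Hu'u].
by case: (Hirr u Hu); apply: (Htr u u' u).
Qed.

(** The pairs of [G] whose code has only one value form a closed relation, hence all of [G]. A
    second value for a leaf or a compound code could be deleted without loss of closure, because by
    unique readability no rule produces it. *)
Lemma G_fun q s s' : opr q s ∈ G -> opr q s' ∈ G -> s = s'.
Proof.
pose P z := exists q s, opr q s ∈ G /\ (z = opr q s /\
   forall s', opr q s' ∈ G -> s' = s).
have HP : Def Delta0 true (fun e => P (e 0)) by rewrite /P; ddef.
have PE q1 s1 : P (opr q1 s1) <-> opr q1 s1 ∈ G /\ forall s', opr q1 s' ∈ G -> s' = s1.
  split; last by move=> [H1 H2]; exists q1, s1.
  by move=> [q2 [s2 [H1 [/opr_inj [-> ->] H2]]]].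
suff Hc : closed (sep G P).
  move=> /GE [_ H] Hs'.
  have HR : sep G P ∈ Pw QT by apply/PwE => z' /(sepE _ _ HP) [/GE []].
  by have /(sepE _ _ HP) [_ /PE [_ HH]] := H _ HR Hc; rewrite (HH _ Hs').
have [Gl Gc] := G_closed.
split.
- move=> x Hx w Hw Hl; apply/sepE => //; split; first exact: Gl.
  apply/PE; split; first exact: Gl.
  move=> s1 Hs1; apply: NNPP => Hne; apply: G_del Hs1.
  have HD : Def Delta0 true (fun e : nat -> M => ~ e 0 = opr w s1) by ddef.
  split.
  + move=> x' Hx' w' Hw' Hl'; apply/sepE => //; split; first exact: Gl.
    move=> /opr_inj [Ew Es]; subst w'; apply: Hne; rewrite -Es.
    exact: leaf_inj Hl' Hl.
  + move=> k Hk qs ss Hqs u Hu Hsk w' Hw' Hcd; apply/sepE => //; split.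
      by apply: (Gc k Hk qs ss) => // i Hi; have /(sepE _ _ HD) [] := Hqs i Hi.
    move=> /opr_inj [Ew _]; subst w'; case: Hcd => v [Hv [_ Hck]].
    exact: leaf_ck Hck Hl.
- move=> k Hk qs ss Hqs u Hu Hsk w Hw Hcd.
  have Hqs1 i (Hi : i < n) : opr (qs i) (ss i) ∈ G.
    by have /(sepE _ _ HP) [] := Hqs i Hi.
  have Hqs2 i (Hi : i < n) s1 : opr (qs i) s1 ∈ G -> s1 = ss i.
    by have /(sepE _ _ HP) [_ /PE [_ H]] := Hqs i Hi; apply: H.
  have HG : opr w u ∈ G by apply: (Gc k Hk qs ss).
  apply/sepE => //; split=> //; apply/PE; split=> //.
  move=> s1 Hs1; apply: NNPP => Hne; apply: G_del Hs1.
  have HD : Def Delta0 true (fun e : nat -> M => ~ e 0 = opr w s1) by ddef.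
  case: Hcd => v [Hv [Hcn Hck]].
  split.
  + move=> x' Hx' w' Hw' Hl'; apply/sepE => //; split; first exact: Gl.
    move=> /opr_inj [Ew Es]; subst w'; exact: leaf_ck Hck Hl'.
  + move=> k' Hk' qs' ss' Hqs' u' Hu' Hsk' w' Hw' Hcd'.
    have Hqs1' i (Hi : i < n) : opr (qs' i) (ss' i) ∈ G.
      by have /(sepE _ _ HD) [] := Hqs' i Hi.
    apply/sepE => //; split; first by apply: (Gc k' Hk' qs' ss').
    move=> /opr_inj [Ew Eu]; subst w' u'; case: Hcd' => v' [Hv' [Hcn' Hck']].
    have [Ek Ev] := ck_inj Hv Hv' Hck Hck'; subst k' v'.
    have Eq : forall i, i < n -> qs i = qs' i.
      by apply: cn_inj Hcn Hcn' => i Hi;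
        [case: (GQT (Hqs1 i Hi))|case: (GQT (Hqs1' i Hi))].
    apply: Hne; apply: (@sk_uniq k _ _ ss) => //.
      by move=> i Hi; case: (GQT (Hqs1 i Hi)).
    apply: sk_ext Hsk' => // i Hi; apply: Hqs2 => //.
    by rewrite Eq //; apply: Hqs1'.
Qed.

Definition hull s := exists q, opr q s ∈ G.

Lemma hull_leaf x : x ∈ t \/ x = y -> hull x.
Proof.
move=> Hx; have [Gl _] := G_closed.
have [w1 [Hw1 Hl]] : exists w1, w1 ∈ Q /\
   ((x ∈ t /\ exists z, z ∈ w1 /\ (z = upr x x /\ w1 = upr z z)) \/
    (x = y /\ w1 = a0)).
  case: Hx => Hx; last by exists a0; split=> //; right.
  exists (sg (sg x)); split; first by case: (leafQ Hx).
  by left; split=> //; exists (sg x); split=> //; apply/sgE.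
have [w [Hw Hp]] := pr_total a2 w1.
exists w; apply: Gl => //.
  by apply/CupE; case: Hx => Hx; [left|right; apply/sgE].
by exists w1.
Qed.

Lemma cn_total m qs : exists w, w ∈ Q /\ cn m qs w.
Proof.
elim: m qs => [|m IH] qs /=; first by exists a0.
have [w' [Hw' H]] := IH (fun i => qs i.+1).
have [w [Hw Hp]] := pr_total (qs 0) w'.
by exists w; split=> //; exists w'.
Qed.

Lemma ck_total k w' : exists w, w ∈ Q /\ ck k w w'.
Proof.
elim: k => [|k [w1 [Hw1 H1]]] /=; first exact: pr_total.
by have [w [Hw Hp]] := pr_total a0 w1; exists w; split=> //; exists w1.
Qed.

Lemma hull_sk k ss : k < size l -> (forall i, i < n -> hull (ss i)) ->
  (exists u, u ∈ ss (it k).1 /\ sat (scons u ss) (it k).2) ->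
  exists u, hull u /\ (u ∈ ss (it k).1 /\ sat (scons u ss) (it k).2).
Proof.
move=> Hk Hss Hex; have [Hi HD Hf] := it_ok Hk.
have [qs Hqs] : exists qs, forall i, i < n -> opr (qs i) (ss i) ∈ G.
  have H i : exists q, i < n -> opr q (ss i) ∈ G.
    case: (boolP (i < n)) => Hin; last by exists a0.
    by have [q Hq] := Hss i Hin; exists q.
  exists (fun i => proj1_sig (constructive_indefinite_description _ (H i))) => i.
  by case: constructive_indefinite_description.
have HssT i : i < n -> ss i ∈ T by move=> /Hqs /GQT [].
pose P u := sat (scons u ss) (it k).2.
have HP : Def Delta0 true (fun e => P (e 0)).
  by rewrite /P; apply: Def_sat => // -[|i] /=; dterm.
have [_ _ _ _ Hmin] := WO.
have [||u [/(sepE _ _ HP) [Hu Pu] Hul]] := Hmin (sep (ss (it k).1) P).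
- by move=> z /(sepE _ _ HP) [Hz _]; apply: T_trans (HssT _ Hi) _ Hz.
- by have [u [Hu Pu]] := Hex; exists u; apply/sepE.
exists u; split=> //.
have Hsk : sk k u ss.
  split=> //; split=> // u' Hu' Pu'.
  case: (Hul u'); first by apply/sepE.
    by left.
  by move/WE; right.
have [w' [Hw' Hcn]] := cn_total n qs; have [w [Hw Hck]] := ck_total k w'.
exists w; apply: (G_closed.2 k Hk qs ss) => //.
  exact: T_trans (HssT _ Hi) _ Hu.
by exists w'.
Qed.

Lemma hull_map : partial_map Q G T.
Proof. by split; [exact: GQT|exact: G_fun]. Qed.

End Hull.

(** A Tarski-Vaught test with finitely many instances: one formula per quantifier of [f], negated
    for a universal one. [S] stands for the hull and [B] for its collapsing map. The list depends on
    [f] alone, so it is available before the hull is built. *)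
Lemma skolem_list f : Delta0 f -> exists l : seq (nat * formula),
  (forall p, List.In p l -> Delta0 p.2) /\
  forall (M : Lstructure) (S : M -> Prop) (B : M -> M -> Prop),
  (forall s v r u, B s v -> B r u -> (r ∈ s <-> u ∈ v)) ->
  (forall s v r u, B s v -> B r u -> (r = s <-> u = v)) ->
  (forall s v u, S s -> B s v -> u ∈ v -> exists r, [/\ S r, r ∈ s & B r u]) ->
  (forall s, S s -> exists v, B s v) ->
  (forall p, List.In p l -> forall ss, (forall i, S (ss i)) ->
     (exists u, u ∈ ss p.1 /\ sat (scons u ss) p.2) ->
     exists u, S u /\ (u ∈ ss p.1 /\ sat (scons u ss) p.2)) ->
  forall ss vs, (forall i, S (ss i)) -> (forall i, B (ss i) (vs i)) ->
  (sat ss f <-> sat vs f).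
Proof.
elim=> {f}.
- move=> i j; exists [::]; split=> // M S B b1 b2 b3 b4 cl ss vs HS HB /=; exact: b1.
- move=> i j; exists [::]; split=> // M S B b1 b2 b3 b4 cl ss vs HS HB /=; exact: b2.
- move=> f _ [l [Hl H]]; exists l; split=> // M S B b1 b2 b3 b4 cl ss vs HS HB /=.
  by rewrite (H M S B b1 b2 b3 b4 cl ss vs HS HB).
- move=> f g _ [l [Hl H]] _ [l' [Hl' H']]; exists (l ++ l'); split.
    by move=> p /List.in_app_iff [/Hl|/Hl'].
  move=> M S B b1 b2 b3 b4 cl ss vs HS HB /=.
  rewrite (H M S B b1 b2 b3 b4 _ ss vs HS HB); last first.
    by move=> p Hp; apply: cl; apply/List.in_app_iff; left.
  rewrite (H' M S B b1 b2 b3 b4 _ ss vs HS HB) //.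
  by move=> p Hp; apply: cl; apply/List.in_app_iff; right.
- move=> f g _ [l [Hl H]] _ [l' [Hl' H']]; exists (l ++ l'); split.
    by move=> p /List.in_app_iff [/Hl|/Hl'].
  move=> M S B b1 b2 b3 b4 cl ss vs HS HB /=.
  rewrite (H M S B b1 b2 b3 b4 _ ss vs HS HB); last first.
    by move=> p Hp; apply: cl; apply/List.in_app_iff; left.
  rewrite (H' M S B b1 b2 b3 b4 _ ss vs HS HB) //.
  by move=> p Hp; apply: cl; apply/List.in_app_iff; right.
- move=> f g _ [l [Hl H]] _ [l' [Hl' H']]; exists (l ++ l'); split.
    by move=> p /List.in_app_iff [/Hl|/Hl'].
  move=> M S B b1 b2 b3 b4 cl ss vs HS HB /=.
  rewrite (H M S B b1 b2 b3 b4 _ ss vs HS HB); last first.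
    by move=> p Hp; apply: cl; apply/List.in_app_iff; left.
  rewrite (H' M S B b1 b2 b3 b4 _ ss vs HS HB) //.
  by move=> p Hp; apply: cl; apply/List.in_app_iff; right.
- move=> i f Hf [l [Hl H]]; exists ((i, fNot f) :: l); split.
    by move=> p [<-|/Hl //]; constructor.
  move=> M S B b1 b2 b3 b4 cl ss vs HS HB /=.
  have Hf' u v : S u -> B u v -> sat (scons u ss) f <-> sat (scons v vs) f.
    move=> Hu Huv; apply: (H M S B b1 b2 b3 b4) => [p Hp|[]|[]] //.
    by apply: cl; right.
  split=> Ha u Hu.
  + have [r [Sr Hr HB']] := b3 _ _ _ (HS i) (HB i) Hu.
    by apply/(Hf' r u Sr HB'); apply: Ha.
  + apply: NNPP => HN.
    have [||v [Sv [Hv]]] := cl (i, fNot f) _ ss HS; first by left.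
      by exists u.
    have [w Hw] := b4 v Sv.
    rewrite /= (Hf' v w Sv Hw); apply; apply: Ha.
    by apply/(b1 _ _ _ _ (HB i) Hw).
- move=> i f Hf [l [Hl H]]; exists ((i, f) :: l); split.
    by move=> p [<-|/Hl //].
  move=> M S B b1 b2 b3 b4 cl ss vs HS HB /=.
  have Hf' u v : S u -> B u v -> sat (scons u ss) f <-> sat (scons v vs) f.
    move=> Hu Huv; apply: (H M S B b1 b2 b3 b4) => [p Hp|[]|[]] //.
    by apply: cl; right.
  split=> -[u [Hu Hs]].
  + have [||v [Sv [Hv Hsv]]] := cl (i, f) _ ss HS; first by left.
      by exists u.
    have [w Hw] := b4 v Sv; exists w.
    by rewrite -(b1 _ _ _ _ (HB i) Hw) -(Hf' v w Sv Hw).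
  + have [r [Sr Hr HB']] := b3 _ _ _ (HS i) (HB i) Hu.
    by exists r; split=> //; apply/(Hf' r u Sr HB').
Qed.

Lemma bound_list (l : seq (nat * formula)) : exists n, 1 < n /\
  forall p, List.In p l -> p.1 < n /\ free_below n.+1 p.2.
Proof.
elim: l => [|[i f] l [n [H1 H]]]; first by exists 2.
have [k Hk] := free_below_exists f.
exists (n + k + i.+1); split; first lia.
move=> p [<- /=|/H [Hp1 Hp2]].
- by split; [lia|apply: free_below_le Hk; lia].
- by split; [lia|apply: free_below_le Hp2; lia].
Qed.

Lemma In_nth (T : Type) (d p : T) (l : seq T) : List.In p l ->
  exists k, k < size l /\ nth d l k = p.
Proof.
elim: l => //= a l IH [->|/IH [k [Hk E]]]; first by exists 0.
by exists k.+1.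
Qed.

Lemma nth_In (T : Type) (d : T) (l : seq T) k : k < size l -> List.In (nth d l k) l.
Proof. by elim: l k => //= a l IH [|k] Hk; [left|right; apply: IH]. Qed.

Section LS.
Variable M : Lstructure.
Context {HM : isMOST M}.
Implicit Types x z u v w p q r s a : M.

(** The hull of [t] and [y] is indexed by term codes, and so is its collapse. The collapse fixes the
    transitive set [t], hence the parameters, and sends [y] to the required [y']. *)
Lemma Delta0_reflect X o t (e : nat -> M) y f :
  is_empty o -> o ∈ X -> (forall y, y ∈ X -> exists w, w ∈ X /\ is_succ w y) ->
  transitive_in t -> (forall i, e i ∈ t) -> Delta0 f -> sat (scons y e) f ->
  exists F t' y', [/\ onto_trans (Pw (Pw (Cup X t))) F t', y' ∈ t'
                    & sat (scons y' e) f].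
Proof.
move=> o_empty oX X_succ t_trans et Hf Hsat.
set Q := Pw (Pw (Cup X t)).
have [a0 [a1 [a2 [pr [[a0Q a1Q a2Q] [a01 a02 a12] leafQ pr_tot [pr_inj Def_pr]]]]]] :=
  codes_exist t o_empty oX X_succ.
have [l0 [Hl0 Hel]] := skolem_list Hf.
(* With [a] and [b] in slots 0 and 1, the extra entry asks for an element of [a] outside [b]. It
   makes the hull extensional and its collapse injective. *)
pose l := (0, fNot (fMem 0 2)) :: l0.
have [n [n2 Hn]] := bound_list l.
have [T [T_trans HT]] := tc_exists (upr t y).
have HtT : t ∈ T by apply: T_trans HT _ _; apply/uprE; left.
have yT : y ∈ T by apply: T_trans HT _ _; apply/uprE; right.
have tT : subset_in t T by apply: T_trans.
have [W WO] : exists W, well_orders W T.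
  have [[_ [_ [_ [_ [_ [_ [_ [_ [_ H]]]]]]]]] _ _] := (most_ax : MOST M).
  exact: H.
have it_ok k : k < size l -> [/\ (nth (0, fEq 0 0) l k).1 < n,
    Delta0 (nth (0, fEq 0 0) l k).2 & free_below n.+1 (nth (0, fEq 0 0) l k).2].
  move=> /(nth_In (0, fEq 0 0)) Hk; have [H1 H2] := Hn _ Hk; split=> //.
  by case: Hk => [<-|/Hl0 //]; repeat constructor.
set G := hullgraph Q t y T W a0 a1 a2 pr l n.
pose S := hull Q t y T W a0 a1 a2 pr l n.
have [HGQ G_fun] := hull_map T_trans tT yT WO a0Q a1Q a2Q a01 a02 a12 leafQ
  pr_inj Def_pr it_ok.
rewrite -/G in HGQ G_fun.
have hleaf x : x ∈ t \/ x = y -> S x.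
  by move=> Hx; exact: (@hull_leaf M HM Q t y T W a0 a1 a2 pr l n tT yT a0Q leafQ pr_tot Def_pr it_ok x Hx).
have hsk (p : nat * formula) (Hp : List.In p l) ss : (forall i, S (ss i)) ->
     (exists u, u ∈ ss p.1 /\ sat (scons u ss) p.2) ->
     exists u, S u /\ (u ∈ ss p.1 /\ sat (scons u ss) p.2).
  have [k [Hk Ek]] := In_nth (0, fEq 0 0) Hp; rewrite -Ek => Hss Hex.
  exact: (hull_sk T_trans tT yT WO a0Q pr_tot Def_pr it_ok Hk (fun i _ => Hss i) Hex).
have HG : partial_map Q G T by split.
have [g [Hg Hgd]] := mostowski (pullback_wf HG).
have PB p q : opr p q ∈ pullback Q G <-> exists u v, [/\ opr p u ∈ G, opr q v ∈ G & u ∈ v].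
  exact: (pullbackE _ _ HG).
pose B s v := exists q, opr q s ∈ G /\ opr q v ∈ g.
have g_fun q v v' : opr q v ∈ g -> opr q v' ∈ g -> v = v'.
  by move=> H H'; have [_ Hu _ _] := Hg _ _ H'; apply: Hu.
have B_mem s v r u : B s v -> B r u -> r ∈ s -> u ∈ v.
  move=> [q [Hqs Hqv]] [p [Hpr Hpu]] Hrs.
  have [_ _ H3 _] := Hg _ _ Hqv.
  have [|u' [Hu' Hu'v]] := H3 p (proj1 (HGQ _ _ Hpr)).
    by apply/PB; exists r, s.
  by rewrite (g_fun _ _ _ Hpu Hu').
have B_surj s v u : B s v -> u ∈ v -> exists r, r ∈ s /\ B r u.
  move=> [q [Hqs Hqv]] Huv; have [_ _ _ H4] := Hg _ _ Hqv.
  have [p [HpQ [/PB [r [s' [Hpr Hqs' Hrs]]] Hpu]]] := H4 u Huv.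
  exists r; rewrite (G_fun _ _ _ Hqs Hqs'); split=> //; by exists p.
have B_fun s v v' : B s v -> B s v' -> v = v'.
  move=> H1 H2; apply: ext => u; split=> Hu.
  + have [r [Hr HBr]] := B_surj _ _ _ H1 Hu; exact: B_mem H2 HBr Hr.
  + have [r [Hr HBr]] := B_surj _ _ _ H2 Hu; exact: B_mem H1 HBr Hr.
have B_tot s : S s -> exists v, B s v.
  move=> [q Hq]; have [v Hv] := Hgd q (proj1 (HGQ _ _ Hq)); by exists v, q.
(* Take [q0] minimal for the pulled-back relation among the codes of elements that share their
   collapse with another one. A member of the hull that separates the two elements then gives a code
   below [q0] of the same kind. *)
have B_inj s s' v : B s v -> B s' v -> s = s'.
  pose P q := exists s, opr q s ∈ G /\ exists v, opr q v ∈ g /\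
    exists q' s', opr q' s' ∈ G /\ (opr q' v ∈ g /\ ~ s = s').
  have HP : Def Delta0 true (fun e => P (e 0)) by rewrite /P; ddef.
  move=> [q [Hqs Hqv]] [q' [Hqs' Hqv']]; apply: NNPP => Hne.
  have [||q0 [/(sepE _ _ HP) [Hq0 [r [Hr [w [Hw [q1 [r1 [Hr1 [Hw1 Hner]]]]]]]]] Hmin]] :=
    pullback_wf HG (s := sep Q P).
  - by move=> z /(sepE _ _ HP) [].
  - exists q; apply/sepE => //; split; first by case: (HGQ _ _ Hqs).
    by exists s; split=> //; exists v; split=> //; exists q', s'.
  have Heq p x p' x' u : opr p x ∈ G -> opr p u ∈ g -> opr p' x' ∈ G ->
      opr p' u ∈ g -> x ∈ r -> x = x'.
    move=> Hx Hu Hx' Hu' Hxr; apply: NNPP => Hnx; apply: (Hmin p); last first.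
      by apply/PB; exists x, r.
    apply/sepE => //; split; first by case: (HGQ _ _ Hx).
    by exists x; split=> //; exists u; split=> //; exists p', x'.
  have Br : B r w by exists q0.
  have Br1 : B r1 w by exists q1.
  apply: Hner; apply: NNPP => Hner.
  have ext_sk a b : S a -> S b -> (exists u, u ∈ a /\ ~ u ∈ b) ->
      exists u, S u /\ (u ∈ a /\ ~ u ∈ b).
    move=> Sa Sb [u [Hua Hub]].
    have := hsk (0, fNot (fMem 0 2)) (or_introl erefl)
      (fun i => if i is 0 then a else b).
    by move/(_ ltac:(by case)) => /=; apply; exists u.
  have Sr : S r by exists q0.
  have Sr1 : S r1 by exists q1.
  case: (classic (subset_in r r1)) => H1; first case: (classic (subset_in r1 r)) => H2.
  + by apply: Hner; apply: ext => z; split; [apply: H1|apply: H2].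
  + have [|u [Su [Hu Hnu]]] := ext_sk r1 r Sr1 Sr.
      apply: NNPP => HN; apply: H2 => z Hz; apply: NNPP => Hnz; apply: HN; by exists z.
    have [u1 Bu] := B_tot u Su.
    have Hu1 := B_mem _ _ _ _ Br1 Bu Hu.
    have [u2 [Hu2 Bu2]] := B_surj _ _ _ Br Hu1.
    case: Bu => p [Hp1 Hp2]; case: Bu2 => p' [Hp1' Hp2'].
    by apply: Hnu; rewrite -(Heq _ _ _ _ _ Hp1' Hp2' Hp1 Hp2 Hu2).
  + have [|u [Su [Hu Hnu]]] := ext_sk r r1 Sr Sr1.
      apply: NNPP => HN; apply: H1 => z Hz; apply: NNPP => Hnz; apply: HN; by exists z.
    have [u1 Bu] := B_tot u Su.
    have Hu1 := B_mem _ _ _ _ Br Bu Hu.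
    have [u2 [Hu2 Bu2]] := B_surj _ _ _ Br1 Hu1.
    case: Bu => p [Hp1 Hp2]; case: Bu2 => p' [Hp1' Hp2'].
    by apply: Hnu; rewrite (Heq _ _ _ _ _ Hp1 Hp2 Hp1' Hp2' Hu).
have B_t x : x ∈ t -> B x x.
  have HP : Def Delta0 true (fun e : nat -> M =>
     exists q, q ∈ Q /\ (opr q (e 0) ∈ G /\ opr q (e 0) ∈ g)) by ddef.
  suff H : forall x, x ∈ t -> exists q, q ∈ Q /\ (opr q x ∈ G /\ opr q x ∈ g).
    by move=> /H [q [_ [H1 H2]]]; exists q.
  apply: (eps_ind (P := fun x => exists q, q ∈ Q /\ (opr q x ∈ G /\ opr q x ∈ g))
    t_trans HP) => {}x Hx IH.
  have IH' z : z ∈ x -> B z z by move=> /IH [q [_ [H1 H2]]]; exists q.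
  have [v [q [Hq Hv]]] := B_tot x (hleaf x (or_introl Hx)).
  suff E : x = v by exists q; split; [case: (HGQ _ _ Hq)|split=> //; rewrite E].
  have Bxv : B x v by exists q.
  apply: ext => z; split=> Hz; first exact: B_mem Bxv (IH' z Hz) Hz.
  have [r [Hr Br]] := B_surj _ _ _ Bxv Hz.
  by rewrite (B_fun _ _ _ Br (IH' r Hr)).
have [y' By] := B_tot y (hleaf y (or_intror erefl)).
exists g, (rng g), y'; split.
- split.
  + move=> v /rngE [q Hq] u Hu; have [_ _ _ H4] := Hg _ _ Hq.
    by have [p [_ [_ Hp]]] := H4 u Hu; apply/rngE; exists p.
  + split; last exact: g_fun.
    by move=> p u Hp; split; [case: (Hg _ _ Hp)|apply/rngE; exists p].
  + by move=> u /rngE.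
- by case: By => q [_ Hq]; apply/rngE; exists q.
- apply/(Hel M S B _ _ _ _ _ (scons y e) (scons y' e)) => //.
  + move=> s v r u Bs Br; split; first exact: B_mem Bs Br.
    move=> Huv; have [r' [Hr' Br']] := B_surj _ _ _ Bs Huv.
    by rewrite (B_inj _ _ _ Br Br').
  + move=> s v r u Bs Br; split=> E; subst; first exact: B_fun Br Bs.
    exact: B_inj Br Bs.
  + move=> s v u Ss Bs Hu; have [r [Hr Br]] := B_surj _ _ _ Bs Hu.
    by exists r; split=> //; case: Br => q [Hq _]; exists q.
  + by move=> p Hp; apply: hsk; right.
  + by case=> [|i] /=; apply: hleaf; [right|left].
  + by case=> [|i] //=; apply: B_t.
Qed.

End LS.

(** * Initial segments that satisfy MOST *)

Definition has_pairs (M : Lstructure) := forall x y : M, exists z, x ∈ z /\ y ∈ z.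

(** One set containing the successive witnesses bounds them all, so a block of existential
    quantifiers contracts to a single one. *)
Lemma Sigma1_normal f : Sigma1 f -> exists g, Delta0 g /\
  forall (M : Lstructure) (e : nat -> M), has_pairs M ->
  (sat e f <-> exists Y, sat (scons Y e) g).
Proof.
elim=> {f} [f Hf|f _ [g [Hg H]]].
- exists (rename succn f); split; first exact: fc_rename.
  move=> M e _; split=> [Hs|[Y]]; last by rewrite sat_rename.
  by exists (e 0); rewrite sat_rename.
- pose r n := if n is k.+2 then k.+3 else n.
  exists (fEx_in 0 (fEx_in 1 (rename r g))); split.
    by do 2 constructor; apply: fc_rename.
  move=> M e HM /=.
  have E (Y a Y' : M) : sat (scons Y (scons a (scons Y' e))) (rename r g) <->
      sat (scons Y (scons a e)) g.
    rewrite sat_rename; set e1 := (X in sat X g); set e2 := (X in _ <-> sat X g).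
    suff -> : e1 = e2 by [].
    by apply: functional_extensionality => -[|[]].
  split.
  + move=> [a /(H M _ HM) [Y HY]]; have [Y' [Ha HYY]] := HM a Y.
    by exists Y', a; split=> //; exists Y; split=> //; apply/E.
  + move=> [Y' [a [Ha [Y [HYY /E HY]]]]]; exists a; apply/(H M _ HM).
    by exists Y.
Qed.

Section Good.
Variable M : Lstructure.
Context {HM : isMOST M}.
Implicit Types x y z u v w p q r s t a : M.

(** Conditions shared by the fixed segment of an automorphism and the standard part of a coded
    chain. [g_onto] absorbs the collapsed Skolem hull, [g_bound] turns Delta_0^P formulas over [D]
    into Delta_0 formulas of [M], and [g_coll] speaks of [D] although no formula of [M] has to
    define it. *)
Record good (D : M -> Prop) : Prop := Good {
  g_trans : forall x y, D y -> x ∈ y -> D x;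
  g_sub : forall x y, D y -> subset_in x y -> D x;
  g_pw : forall y, D y -> D (Pw y);
  g_upr : forall x y, D x -> D y -> D (upr x y);
  g_un : forall x, D x -> D (Un x);
  g_tc : forall x, D x -> exists t, [/\ D t, transitive_in t & x ∈ t];
  g_onto : forall Q F t, D Q -> onto_trans Q F t -> D t;
  g_inf : exists X o, [/\ D X, o ∈ X, is_empty o
            & forall y, y ∈ X -> exists w, w ∈ X /\ is_succ w y];
  g_bound : exists C, strans C /\ forall x, D x -> x ∈ C;
  g_coll : forall P : M -> M -> Prop, Def Delta0 true (fun e => P (e 1) (e 0)) ->
    forall w, D w -> (forall x, x ∈ w -> exists y, D y /\ P x y) ->
    exists c, D c /\ forall x, x ∈ w -> exists y, y ∈ c /\ P x y }.

Variable D : M -> Prop.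
Hypothesis gD : good D.
Let N := substructure D.

Lemma sval_inj (x y : N) : sval x = sval y -> x = y.
Proof.
case: x y => [x Hx] [y Hy] /= E; subst y.
by rewrite (proof_irrelevance _ Hx Hy).
Qed.

Lemma sval_scons (a : N) (e : nat -> N) :
  (fun i => sval (scons a e i)) = scons (sval a) (fun i => sval (e i)).
Proof. by apply: functional_extensionality => -[]. Qed.

(** Absoluteness: [D] contains every element and every subset of its members, so both kinds of
    bounded quantifier range over the same sets. *)
Lemma sat_sub f : Delta0P f -> forall e : nat -> N,
  sat e f <-> sat (fun i => sval (e i)) f.
Proof.
have HS (x : N) (y : M) : y ∈ sval x -> D y by apply: g_trans (proj2_sig x).
have Hsub (x y : N) : subset_in x y <-> subset_in (sval x) (sval y).
  split=> H z Hz; last exact: (H (sval z)).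
  exact: (H (exist _ z (HS _ _ Hz))).
elim=> {f} /=.
- by [].
- by move=> i j e; split=> [->//|/sval_inj].
- by move=> f _ IH e; rewrite IH.
- by move=> f g _ IH _ IH' e; rewrite IH IH'.
- by move=> f g _ IH _ IH' e; rewrite IH IH'.
- by move=> f g _ IH _ IH' e; rewrite IH IH'.
- move=> i f _ IH e; split=> H a Ha.
  + by have /IH := H (exist _ a (HS _ _ Ha)) Ha; rewrite sval_scons.
  + by apply/IH; rewrite sval_scons; apply: H.
- move=> i f _ IH e; split=> -[a [Ha H]].
  + by exists (sval a); split=> //; move/IH: H; rewrite sval_scons.
  + by exists (exist _ a (HS _ _ Ha)); split=> //; apply/IH; rewrite sval_scons.
- move=> i f _ IH e; split=> H a Ha.
  + have HDa : D a := g_sub gD (proj2_sig (e i)) Ha.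
    have Hs : subset_in (exist _ a HDa : N) (e i) by apply/Hsub.
    by have /IH := H (exist _ a HDa) Hs; rewrite sval_scons.
  + by apply/IH; rewrite sval_scons; apply: H; apply/Hsub.
- move=> i f _ IH e; split=> -[a [Ha H]].
  + by exists (sval a); split; [apply/Hsub|move/IH: H; rewrite sval_scons].
  + have HDa : D a := g_sub gD (proj2_sig (e i)) Ha.
    exists (exist _ a HDa); split; last by apply/IH; rewrite sval_scons.
    by apply/(Hsub (exist _ a HDa) (e i)).
Qed.

Lemma good_cup x y : D x -> D y -> D (Cup x y).
Proof. by move=> Hx Hy; apply: g_un => //; apply: g_upr. Qed.

(** The relevant parameters are collected in one transitive set [t] of [D]. The reflected witness
    lies in a transitive image of [Pw (Pw (Cup X t))], which belongs to [D]. *)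
Lemma good_reflect f (e : nat -> M) y : Delta0 f -> (forall i, D (e i)) ->
  sat (scons y e) f -> exists y', D y' /\ sat (scons y' e) f.
Proof.
move=> Hf He Hs; have [k Hk] := free_below_exists f.
have [X [o [DX oX o_e X_s]]] := g_inf gD.
have [s [Ds Hes]] : exists s, D s /\ forall i, i < k.+1 -> e i ∈ s.
  elim: {Hk} k => [|k [s [Ds Hs']]].
    exists (sg (e 0)); split; first exact: g_upr.
    by case=> // _; apply/sgE.
  exists (Cup s (sg (e k.+1))); split.
    by apply: good_cup => //; apply: g_upr.
  move=> i; rewrite ltnS leq_eqVlt => /orP[/eqP ->|/Hs' ?]; apply/CupE; last by left.
  by right; apply/sgE.
have [t [Dt t_trans st]] := g_tc gD Ds.
pose e' i := if i < k then e i else e 0.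
have He' i : e' i ∈ t.
  by apply: (t_trans s) => //; rewrite /e'; case: ifP => Hi; apply: Hes => //; lia.
have E v : sat (scons v e) f <-> sat (scons v e') f.
  by apply: (sat_free_below Hk) => -[|i] //= Hi; rewrite /e' (ltnW Hi).
move/E: Hs => Hs.
have [F [t' [y' [Ho Hy' Hs']]]] := Delta0_reflect o_e oX X_s t_trans He' Hf Hs.
exists y'; split; last exact/E.
apply: g_trans Hy' => //; apply: g_onto Ho => //.
by do 2 apply: g_pw => //; apply: good_cup.
Qed.

Lemma sub_has_pairs : has_pairs N.
Proof.
move=> x y; exists (exist _ _ (g_upr gD (proj2_sig x) (proj2_sig y))).
by split; apply/uprE; [left|right].
Qed.

Lemma Delta0_Delta0P f : Delta0 f -> Delta0P f.
Proof. by elim=> *; constructor. Qed.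

Lemma sat_sub_Sigma1 f : Sigma1 f -> forall e : nat -> N,
  sat e f <-> sat (fun i => sval (e i)) f.
Proof.
move=> /Sigma1_normal [g [Hg H]] e.
have HMp : has_pairs M by move=> x y; exists (upr x y); rewrite !uprE; auto.
rewrite (H N e sub_has_pairs) (H M _ HMp); split.
- move=> [Y /(sat_sub (Delta0_Delta0P Hg))]; rewrite sval_scons => HY; by exists (sval Y).
- move=> [Y HY]; have [|Y' [DY' HY']] := good_reflect Hg _ HY.
    by move=> i; apply: (proj2_sig (e i)).
  exists (exist _ Y' DY'); apply/(sat_sub (Delta0_Delta0P Hg)).
  by rewrite sval_scons.
Qed.

Lemma sub_collP : Collection N Delta0P.
Proof.
move=> f Hf e w Hex.
have [C [HC DC]] := g_bound gD.
have [P [HP HPE]] := Delta0P_restrict Hf HC.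
pose R x y := P (scons y (scons x (fun i => sval (e i)))).
have HR : Def Delta0 true (fun e => R (e 1) (e 0)).
  by apply: (Def_comp HP) => -[|[|i]] /=; dterm.
have E (x y : N) : sat (scons y (scons x e)) f <-> R (sval x) (sval y).
  rewrite sat_sub // sval_scons sval_scons /R HPE //.
  by case=> [|[|i]] /=; apply: DC; apply: proj2_sig.
have [x Hx|c [Dc Hc]] := g_coll gD HR (proj2_sig w).
  have Dx : D x := g_trans gD (proj2_sig w) Hx.
  have [y Hy] := Hex (exist _ x Dx) Hx.
  by exists (sval y); split; [apply: proj2_sig|move/E: Hy].
exists (exist _ c Dc) => x Hx; have [y [Hy Ry]] := Hc _ Hx.
exists (exist _ y (g_trans gD Dc Hy)); split=> //; exact/E.
Qed.

Lemma sub_opair (p x y : N) : is_opair p x y <-> sval p = opr (sval x) (sval y).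
Proof.
have Hu (a b c : N) : is_upair a b c <-> sval a = upr (sval b) (sval c).
  split=> [H|E z].
  - apply: ext => z; rewrite uprE; split.
    + move=> Hz; have Dz := g_trans gD (proj2_sig a) Hz.
      by have := H (exist _ z Dz) => -[/(_ Hz) [] <-] _; auto.
    + by case=> ->; apply/H; auto.
  - rewrite /= E uprE; split=> [[] /sval_inj|[] ->]; auto.
split=> [H|E w].
- apply: ext => z; rewrite uprE; split.
  + move=> Hz; have Dz := g_trans gD (proj2_sig p) Hz.
    have [/(_ Hz) H' _] := H (exist _ z Dz).
    by case: H' => /Hu /= ->; auto.
  + have Dxx := g_upr gD (proj2_sig x) (proj2_sig x).
    have Dxy := g_upr gD (proj2_sig x) (proj2_sig y).
    case=> ->.
    * by apply/(H (exist _ _ Dxx)); left; apply/Hu.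
    * by apply/(H (exist _ _ Dxy)); right; apply/Hu.
- by rewrite /= E uprE !Hu.
Qed.

Lemma sub_WO : WellOrdering N.
Proof.
move=> x.
have [[_ [_ [_ [_ [_ [_ [_ [_ [_ HW]]]]]]]]] _ _] := (most_ax : MOST M).
have [r [H1 H2 H3 H4 H5]] := HW (sval x).
have Dr : D r.
  apply: (@g_sub _ gD _ (Pw (Pw (sval x)))).
    by do 2 apply: g_pw => //; apply: proj2_sig.
  move=> p /H1 [u [v [Hu Hv /is_opairE ->]]]; apply/PwE => z /uprE Hz.
  by apply/PwE => z'; case: Hz => -> /uprE [] ->.
have HR (u v : N) : related (exist _ r Dr : N) u v <-> related r (sval u) (sval v).
  split.
  - by move=> [p [Hp /sub_opair E]]; exists (sval p); split=> //; apply/is_opairE.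
  - move=> [p [Hp /is_opairE E]]; exists (exist _ p (g_trans gD Dr Hp)).
    by split=> //; apply/sub_opair.
exists (exist _ r Dr); split.
- move=> p /H1 [u [v [Hu Hv /is_opairE E]]].
  exists (exist _ u (g_trans gD (proj2_sig x) Hu)).
  exists (exist _ v (g_trans gD (proj2_sig x) Hv)); split=> //; exact/sub_opair.
- by move=> u Hu /HR; apply: H2.
- by move=> u v w Hu Hv Hw /HR ? /HR ?; apply/HR; apply: (H3 _ (sval v)).
- move=> u v Hu Hv; case: (H4 _ _ Hu Hv) => [/HR|/sval_inj|/HR].
  + by constructor 1.
  + by constructor 2.
  + by constructor 3.
- move=> s Hs [u Hu].
  have [|| v [Hv Hmin]] := H5 (sval s).
  + move=> z Hz; exact: (Hs (exist _ z (g_trans gD (proj2_sig s) Hz)) Hz).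
  + by exists (sval u).
  + exists (exist _ v (g_trans gD (proj2_sig s) Hv)); split=> // w Hw.
    case: (Hmin _ Hw) => [E|H]; first by left; apply: sval_inj.
    by right; apply/HR.
Qed.

Theorem good_MOST : MOST N /\ Collection N Delta0P.
Proof.
split; last exact: sub_collP.
have DS (x : N) (y : M) : y ∈ sval x -> D y by apply: g_trans (proj2_sig x).
split.
- split; [|split; [|split; [|split; [|split; [|split; [|split; [|split; [|split]]]]]]]].
  + move=> x y H; apply: sval_inj; apply: ext => z; split=> Hz.
    * exact: (proj1 (H (exist _ z (DS _ _ Hz)))).
    * exact: (proj2 (H (exist _ z (DS _ _ Hz)))).
  + move=> x y; exists (exist _ _ (g_upr gD (proj2_sig x) (proj2_sig y))) => z.
    by rewrite /= uprE; split=> [[/sval_inj|/sval_inj]|[->|->]]; auto.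
  + have [X [o [DX oX o_e _]]] := g_inf gD.
    by exists (exist _ o (g_trans gD DX oX)) => y; apply: o_e.
  + move=> x; exists (exist _ _ (g_un gD (proj2_sig x))) => z.
    rewrite /= UnE; split=> [[w [Hw Hz]]|[w [Hw Hz]]]; last by exists (sval w).
    by exists (exist _ w (DS _ _ Hw)).
  + have [X [o [DX oX o_e X_s]]] := g_inf gD.
    exists (exist _ X DX); split.
      by exists (exist _ o (g_trans gD DX oX)); split=> // y; apply: o_e.
    move=> y Hy; have [w [Hw Hs]] := X_s _ Hy.
    exists (exist _ w (g_trans gD DX Hw)); split=> // z.
    by rewrite /= Hs; split=> [[|/sval_inj]|[|->]]; auto.
  + move=> x; exists (exist _ _ (g_pw gD (proj2_sig x))) => z.
    rewrite /= PwE; split=> H u Hu; first exact: H.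
    exact: (H (exist _ u (DS _ _ Hu))).
  + move=> x; have [t [Dt Ht Hx]] := g_tc gD (proj2_sig x).
    exists (exist _ t Dt); split; last by move=> z Hz; apply: Ht Hx _ Hz.
    by move=> y Hy z Hz; apply: Ht Hy _ Hz.
  + move=> f Hf e x.
    pose P z := sat (scons z (fun i => sval (e i))) f.
    have HP : Def Delta0 true (fun e => P (e 0)).
      by apply: Def_sat => // -[|i] /=; dterm.
    have Dy : D (sep (sval x) P).
      by apply: g_sub (proj2_sig x) _ => // z /(sepE _ _ HP) [].
    exists (exist _ _ Dy) => z; rewrite /= sepE // /P.
    by rewrite (sat_sub (Delta0_Delta0P Hf)) sval_scons.
  + move=> x [y Hy]; have [|u [Hu Hmin]] := @found _ _ (sval x); first by exists (sval y).
    exists (exist _ u (DS _ _ Hu)); split=> // z [Hz1 Hz2].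
    exact: Hmin Hz1 Hz2.
  + exact: sub_WO.
- move=> f Hf e x; have [_ HS _] := (most_ax : MOST M).
  have [y Hy] := HS f Hf (fun i => sval (e i)) (sval x).
  have Dy : D y by apply: g_sub (proj2_sig x) _ => // z /Hy [].
  exists (exist _ y Dy) => z; rewrite /= Hy.
  by rewrite (sat_sub_Sigma1 Hf) sval_scons.
- by move=> f /Delta0_Delta0P; apply: sub_collP.
Qed.

End Good.

(** * Isomorphic structures *)

Section Transfer.
Variables (M N : Lstructure) (f : M -> N).
Hypotheses (f_bij : bijective f) (f_mem : forall x y, f x ∈ f y <-> x ∈ y).

Lemma iso_inj x y : f x = f y -> x = y.
Proof. exact: bij_inj. Qed.

Lemma iso_surj y : exists x, y = f x.
Proof. by case: f_bij => g _ fK; exists (g y); rewrite fK. Qed.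

Lemma iso_all (P : N -> Prop) : (forall y, P y) <-> forall x, P (f x).
Proof. by split=> H // y; have [x ->] := iso_surj y. Qed.

Lemma iso_ex (P : N -> Prop) : (exists y, P y) <-> exists x, P (f x).
Proof.
split=> [[y]|[x Hx]]; last by exists (f x).
by have [x ->] := iso_surj y; exists x.
Qed.

Lemma iso_eq x y : f x = f y <-> x = y.
Proof. by split=> [/iso_inj|->]. Qed.

Lemma iso_scons a (e : nat -> M) : (fun i => f (scons a e i)) = scons (f a) (fun i => f (e i)).
Proof. by apply: functional_extensionality => -[]. Qed.

Lemma iso_sat phi (e : nat -> M) : sat (fun i => f (e i)) phi <-> sat e phi.
Proof.
elim: phi e => /= [i j|i j|g IH|g IHg h IHh|g IHg h IHh|g IHg h IHh|g IH|g IH] e.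
- exact: f_mem.
- exact: iso_eq.
- by rewrite IH.
- by rewrite IHg IHh.
- by rewrite IHg IHh.
- by rewrite IHg IHh.
- by rewrite iso_all; split=> H a; move: (H a); rewrite -iso_scons IH.
- by rewrite iso_ex; split=> -[a H]; exists a; move: H; rewrite -iso_scons IH.
Qed.

Lemma iso_env (e : nat -> N) : exists e', e = fun i => f (e' i).
Proof.
case: f_bij => g _ fK; exists (fun i => g (e i)).
by apply: functional_extensionality => i; rewrite fK.
Qed.

Lemma iso_upair w x y : is_upair (f w) (f x) (f y) <-> is_upair w x y.
Proof.
rewrite /is_upair iso_all.
by split=> H z; move: (H z); rewrite f_mem !iso_eq.
Qed.

Lemma iso_opair p x y : is_opair (f p) (f x) (f y) <-> is_opair p x y.
Proof.
rewrite /is_opair iso_all.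
by split=> H w; move: (H w); rewrite f_mem !iso_upair.
Qed.

Lemma iso_related r x y : related (f r) (f x) (f y) <-> related r x y.
Proof.
rewrite /related iso_ex.
by split=> -[p H]; exists p; move: H; rewrite f_mem iso_opair.
Qed.

Lemma iso_subset x y : subset_in (f x) (f y) <-> subset_in x y.
Proof.
rewrite /subset_in iso_all.
by split=> H z; move: (H z); rewrite !f_mem.
Qed.

Lemma iso_trans x : transitive_in (f x) <-> transitive_in x.
Proof.
rewrite /transitive_in iso_all.
by split=> H z; move: (H z); rewrite !f_mem iso_subset.
Qed.

Lemma iso_empty x : is_empty (f x) <-> is_empty x.
Proof. by rewrite /is_empty iso_all; split=> H z; move: (H z); rewrite f_mem. Qed.

Lemma iso_succ w x : is_succ (f w) (f x) <-> is_succ w x.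
Proof.
rewrite /is_succ iso_all.
by split=> H z; move: (H z); rewrite !f_mem iso_eq.
Qed.

Lemma iso_sep Gam : Separation M Gam -> Separation N Gam.
Proof.
move=> H phi Hphi e x; have [e' ->] := iso_env e; have [x' ->] := iso_surj x.
have [y Hy] := H phi Hphi e' x'; exists (f y).
by apply/iso_all => z; rewrite !f_mem -iso_scons iso_sat.
Qed.

Lemma iso_coll Gam : Collection M Gam -> Collection N Gam.
Proof.
move=> H phi Hphi e w; have [e' ->] := iso_env e; have [w' ->] := iso_surj w => Hex.
have [x Hx|c Hc] := H phi Hphi e' w'.
  have /iso_ex [y] := Hex (f x) (proj2 (f_mem _ _) Hx).
  by rewrite -!iso_scons iso_sat => Hy; exists y.
exists (f c); apply/iso_all => x /f_mem Hx; apply/iso_ex.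
have [y [Hy Hs]] := Hc x Hx; exists y.
by rewrite -!iso_scons iso_sat f_mem.
Qed.

Lemma iso_infinity : Infinity M -> Infinity N.
Proof.
move=> [x [[y [Hy Ey]] H]]; exists (f x); split.
  by exists (f y); rewrite f_mem iso_empty.
apply/iso_all => z /f_mem /H [w [Hw Hs]]; exists (f w).
by rewrite f_mem iso_succ.
Qed.

Lemma iso_WO : WellOrdering M -> WellOrdering N.
Proof.
move=> H; apply/iso_all => x; have [r [H1 H2 H3 H4 H5]] := H x; exists (f r); split.
- apply/iso_all => p /f_mem /H1 [u [v [Hu Hv Hp]]]; exists (f u), (f v).
  by split; rewrite ?f_mem ?iso_opair.
- by apply/iso_all => u; rewrite f_mem iso_related; apply: H2.
- apply/iso_all => u; apply/iso_all => v; apply/iso_all => w.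
  by rewrite !f_mem !iso_related; apply: H3.
- apply/iso_all => u; apply/iso_all => v; rewrite !f_mem => Hu Hv.
  by case: (H4 _ _ Hu Hv) => Huv;
    [constructor 1; rewrite iso_related|rewrite Huv; constructor 2
    |constructor 3; rewrite iso_related].
- apply/iso_all => s; rewrite iso_subset iso_ex => Hs [u]; rewrite f_mem => Hu.
  have [|v [Hv Hmin]] := H5 s Hs; first by exists u.
  exists (f v); rewrite f_mem; split=> //; apply/iso_all => w.
  by rewrite f_mem iso_eq iso_related; apply: Hmin.
Qed.

Lemma iso_MOST : MOST M -> MOST N.
Proof.
move=> [[A1 [A2 [A3 [A4 [A5 [A6 [A7 [A8 [A9 A10]]]]]]]]] S1 C0].
split; [|exact: iso_sep|exact: iso_coll].
split; [|split; [|split; [|split; [|split; [|split; [|split; [|split; [|split]]]]]]]].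
- apply/iso_all => x; apply/iso_all => y; rewrite iso_all iso_eq => H.
  by apply: A1 => z; rewrite -f_mem H f_mem.
- apply/iso_all => x; apply/iso_all => y; have [w Hw] := A2 x y.
  by exists (f w); rewrite iso_upair.
- by have [x Hx] := A3; exists (f x); rewrite iso_empty.
- apply/iso_all => x; have [y Hy] := A4 x; exists (f y); apply/iso_all => z.
  rewrite f_mem Hy iso_ex.
  by split=> -[w Hw]; exists w; move: Hw; rewrite !f_mem.
- exact: iso_infinity.
- apply/iso_all => x; have [y Hy] := A6 x; exists (f y); apply/iso_all => z.
  by rewrite f_mem Hy iso_subset.
- apply/iso_all => x; have [y [H1 H2]] := A7 x; exists (f y).
  by rewrite iso_trans iso_subset.
- exact: iso_sep.
- apply/iso_all => x; rewrite iso_ex => -[y]; rewrite f_mem => Hy.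
  have [|z [Hz Hmin]] := A9 x; first by exists y.
  exists (f z); rewrite f_mem; split=> //; apply/iso_all => w.
  by rewrite !f_mem; apply: Hmin.
- exact: iso_WO.
Qed.

End Transfer.

(** * Ordinals and transitive closures *)

Section Ordinals.
Variable M : Lstructure.
Context {HM : isMOST M}.
Implicit Types x y z u v w p q r s t a : M.

Definition ord a := transitive_in a /\
  forall x y, x ∈ a -> y ∈ a -> [\/ x ∈ y, x = y | y ∈ x].

Lemma no_3cycle x y z : x ∈ y -> y ∈ z -> ~ z ∈ x.
Proof.
move=> Hxy Hyz Hzx.
have HE u : u ∈ Cup (upr x y) (sg z) <-> (u = x \/ u = y) \/ u = z.
  by rewrite CupE uprE sgE.
have [|u [/HE Hu Hmin]] := @found _ _ (Cup (upr x y) (sg z)).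
  by exists x; apply/HE; auto.
case: Hu => [[]|] E; subst u.
- by apply: (Hmin z) => //; apply/HE; auto.
- by apply: (Hmin x) => //; apply/HE; auto.
- by apply: (Hmin y) => //; apply/HE; auto.
Qed.

Lemma ord_mem a x : ord a -> x ∈ a -> ord x.
Proof.
move=> [Ht Hc] Hx; split; last first.
  by move=> u v Hu Hv; apply: Hc; apply: Ht Hx _ _.
move=> y Hy z Hz.
have Hya := Ht _ Hx _ Hy; have Hza := Ht _ Hya _ Hz.
case: (Hc z x Hza Hx) => [//|E|Hxz].
- by subst z; case: (mem_asym Hy).
- by case: (no_3cycle Hxz Hz).
Qed.

Lemma ord_proper a d : ord a -> transitive_in d -> subset_in d a -> ~ d = a -> d ∈ a.
Proof.
move=> [Ht Hc] Hd Hda Hne.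
have HP : Def Delta0 true (fun e : nat -> M => ~ e 0 ∈ d) by ddef.
have [|g [/(sepE _ _ HP) [Hg Hgd] Hmin]] := @found _ _ (sep a (fun z => ~ z ∈ d)).
  apply: NNPP => HN; apply: Hne; apply: ext => z; split=> [/Hda //|Hz].
  apply: NNPP => Hzd; apply: HN; exists z; exact/sepE.
suff -> : d = g by [].
apply: ext => z; split=> Hz.
- case: (Hc z g (Hda _ Hz) Hg) => [//|E|Hgz].
  + by case: Hgd; rewrite -E.
  + by case: Hgd; apply: Hd Hz _ Hgz.
- apply: NNPP => Hzd; apply: (Hmin z Hz); apply/sepE => //; split=> //.
  exact: Ht Hg _ Hz.
Qed.

Lemma ord_cmp a b : ord a -> ord b -> [\/ a ∈ b, a = b | b ∈ a].
Proof.
move=> Ha Hb.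
have HP : Def Delta0 true (fun e : nat -> M => e 0 ∈ b) by ddef.
pose d := sep a (fun z => z ∈ b).
have dE z : z ∈ d <-> z ∈ a /\ z ∈ b by apply: sepE.
have Hd : transitive_in d.
  move=> y /dE [Hya Hyb] z Hz; apply/dE; split.
    exact: (Ha.1) Hya _ Hz.
  exact: (Hb.1) Hyb _ Hz.
have Hda : subset_in d a by move=> z /dE [].
have Hdb : subset_in d b by move=> z /dE [].
case: (classic (d = a)) => [Ea|Na]; case: (classic (d = b)) => [Eb|Nb].
- by constructor 2; rewrite -Ea.
- by constructor 1; rewrite -Ea; apply: ord_proper.
- by constructor 3; rewrite -Eb; apply: ord_proper.
- case: (@mem_irrefl _ _ d); apply/dE; split; exact: ord_proper.
Qed.

Definition smap a G b := [/\ forall p u, opr p u ∈ G -> p ∈ a /\ u ∈ b,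
  forall p u, opr p u ∈ G -> forall u', opr p u' ∈ G -> u = u'
  & forall u, u ∈ b -> exists p, p ∈ a /\ opr p u ∈ G].

Lemma smap_onto a G b : transitive_in b -> smap a G b -> onto_trans a G b.
Proof.
move=> Hb [H1 H2 H3]; split=> //.
  by split=> // p u u' Hu Hu'; apply: (H2 p u).
by move=> u /H3 [p []]; exists p.
Qed.

(** The ordinal is the collapse of a well-order of [x]. Linearity makes the collapsing map
    injective, so its converse is a function too. *)
Lemma order_type x : exists a G G', [/\ ord a, smap x G a & smap a G' x].
Proof.
have [[_ [_ [_ [_ [_ [_ [_ [_ [_ HW]]]]]]]]] _ _] := (most_ax : MOST M).
have [r [H1 H2 H3 H4 H5]] := HW x.
have RE u v : related r u v <-> opr u v ∈ r.
  split; first by move=> [p [Hp /is_opairE <-]].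
  by move=> H; exists (opr u v); split=> //; apply/is_opairE.
have wf : wfr r x.
  move=> s Hs Hex; have [u [Hu Hmin]] := H5 s Hs Hex.
  exists u; split=> // p Hp /RE Hpu.
  case: (Hmin p Hp) => [E|Hup]; first by subst p; apply: (H2 u (Hs _ Hu)).
  by apply: (H2 u (Hs _ Hu)); apply: (H3 u p u) => //; apply: Hs.
have [g [Hg Hgd]] := mostowski wf.
have g_mem q v q' v' : opr q v ∈ g -> opr q' v' ∈ g -> opr q q' ∈ r -> v ∈ v'.
  move=> Hq Hq' Hr; have [Hqx Hf _ _] := Hg _ _ Hq; have [_ _ Hm _] := Hg _ _ Hq'.
  by have [u [/Hf -> Hu]] := Hm q Hqx Hr.
have g_cmp q v q' v' : opr q v ∈ g -> opr q' v' ∈ g ->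
    [\/ v ∈ v', q = q' | v' ∈ v].
  move=> Hq Hq'; have [Hqx _ _ _] := Hg _ _ Hq; have [Hqx' _ _ _] := Hg _ _ Hq'.
  case: (H4 q q' Hqx Hqx') => [/RE H|H|/RE H].
  - by constructor 1; apply: g_mem H.
  - by constructor 2.
  - by constructor 3; apply: g_mem H.
pose a := rng g.
have HP : Def Delta0 true (fun e : nat -> M => exists q v, opr q v ∈ g /\ e 0 = opr v q).
  by ddef.
pose G' := sep (prod a x) (fun z => exists q v, opr q v ∈ g /\ z = opr v q).
have G'E v q : opr v q ∈ G' <-> opr q v ∈ g.
  rewrite sepE // opr_prod; split; first by move=> [_ [q' [v' [H /opr_inj [-> ->]]]]].
  move=> H; split; last by exists q, v.
  by split; [apply/rngE; exists q|case: (Hg _ _ H)].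
exists a, g, G'; split.
- split.
  + move=> v /rngE [q Hq] u Hu; have [_ _ _ Hs] := Hg _ _ Hq.
    by have [p [_ [_ Hp]]] := Hs u Hu; apply/rngE; exists p.
  + move=> v v' /rngE [q Hq] /rngE [q' Hq'].
    case: (g_cmp _ _ _ _ Hq Hq') => H; first by constructor 1.
    * by subst q'; have [_ Hf _ _] := Hg _ _ Hq; rewrite (Hf _ Hq'); constructor 2.
    * by constructor 3.
- split.
  + by move=> p u Hp; split; [case: (Hg _ _ Hp)|apply/rngE; exists p].
  + by move=> p u Hp u' Hp'; have [_ Hf _ _] := Hg _ _ Hp'; apply: Hf.
  + by move=> u /rngE [p Hp]; exists p; split=> //; case: (Hg _ _ Hp).
- split.
  + by move=> p u /G'E Hp; split; [apply/rngE; exists u|case: (Hg _ _ Hp)].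
  + move=> p u /G'E Hp u' /G'E Hp'.
    by case: (g_cmp _ _ _ _ Hp Hp') => // /mem_irrefl.
  + move=> u Hu; have [v Hv] := Hgd u Hu; exists v; split; last exact/G'E.
    by apply/rngE; exists u.
Qed.

Lemma TC_singleton_exists x : exists t, is_TC_singleton t x.
Proof.
have [T [HT Hx]] := tc_exists x.
pose P z := forall s, s ∈ Pw T -> transitive_in s -> x ∈ s -> z ∈ s.
have HP : Def Delta0 true (fun e => P (e 0)) by rewrite /P; ddef.
exists (sep T P); split.
- move=> y /(sepE _ _ HP) [Hy Py] z Hz; apply/sepE => //; split.
    exact: HT Hy _ Hz.
  by move=> s Hs Hst Hxs; apply: Hst (Py s Hs Hst Hxs) _ Hz.
- by apply/(sepE _ _ HP); split=> // s.
- move=> s Hs Hxs z /(sepE _ _ HP) [Hz Pz].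
  have HQ : Def Delta0 true (fun e : nat -> M => e 0 ∈ s) by ddef.
  have : z ∈ sep T (fun z => z ∈ s); last by move=> /(sepE _ _ HQ) [].
  apply: Pz.
  + by apply/PwE => u /(sepE _ _ HQ) [].
  + move=> u /(sepE _ _ HQ) [Hu Hus] v Hv; apply/sepE => //; split.
      exact: HT Hu _ Hv.
    exact: Hs Hus _ Hv.
  + exact/sepE.
Qed.

End Ordinals.

(** * The fixed initial segment of an automorphism *)

Section Fix.
Variable M : Lstructure.
Context {HM : isMOST M}.
Implicit Types x y z u v w p q r s t a : M.
Variable j : M -> M.
Hypotheses (j_aut : automorphism j) (j_nt : nontrivial j).

Definition fixed_seg x := forall y, in_TC_singleton y x -> j y = y.
Local Notation D := fixed_seg.

Lemma fixed_trans t x : transitive_in t -> (forall z, z ∈ t -> j z = z) -> x ∈ t -> D x.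
Proof. by move=> Ht Hz Hx y [t' [[_ _ Hmin] Hy]]; apply: Hz; apply: (Hmin t). Qed.

Lemma fixed_TC x : D x -> exists t, [/\ transitive_in t, x ∈ t & forall z, z ∈ t -> D z].
Proof.
move=> Hx; have [t Ht] := TC_singleton_exists x; have [H1 H2 _] := Ht.
exists t; split=> // z Hz; apply: (fixed_trans H1) => // u Hu; apply: Hx.
by exists t.
Qed.

Lemma fixed_fix x : D x -> j x = x.
Proof.
move=> Hx; apply: Hx; have [t Ht] := TC_singleton_exists x; exists t; split=> //.
by case: Ht.
Qed.

Lemma fixed_mem x y : D y -> x ∈ y -> D x.
Proof. by move=> /fixed_TC [t [Ht Hy H]] Hx; apply: H; apply: Ht Hy _ Hx. Qed.

Lemma j_memE x y : j x ∈ j y <-> x ∈ y.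
Proof. by case: j_aut. Qed.

Lemma j_surj y : exists x, y = j x.
Proof. by case: j_aut => -[g _ gK] _; exists (g y); rewrite gK. Qed.

Lemma fix_ext x : (forall y, y ∈ x -> j y = y) -> j x = x.
Proof.
move=> H; apply: ext => z; split=> Hz; last by rewrite -(H z Hz); apply/j_memE.
by have [w E] := j_surj z; subst z; move/j_memE: Hz => Hw; rewrite H.
Qed.

(** The union [U] of the transitive closures of the elements of [x] is fixed pointwise, and then [x]
    is fixed by extensionality. Closure of [D] under subsets, pairs, unions and power sets all
    follow from this. *)
Lemma fixed_intro x : (forall y, y ∈ x -> D y) -> D x.
Proof.
move=> Hx; have [T [HT HxT]] := tc_exists x.
pose P u := exists z, z ∈ x /\ forall s, s ∈ Pw T -> transitive_in s -> z ∈ s -> u ∈ s.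
have HP : Def Delta0 true (fun e => P (e 0)) by rewrite /P; ddef.
pose U := sep T P.
have UD u : u ∈ U -> D u.
  move=> /(sepE _ _ HP) [Hu [z [Hz Hmin]]].
  have [t [[H1 H2 H3] Ht]] : exists t, is_TC_singleton t z /\ forall v, v ∈ t -> D v.
    have [t Ht] := TC_singleton_exists z; exists t; split=> // v Hv.
    have [t' [H1 H2 H3]] := fixed_TC (Hx z Hz).
    by apply: H3; case: Ht => _ _ Hm; apply: Hm Hv.
  apply: Ht; apply: Hmin => //; apply/PwE; apply: H3 => //.
  exact: HT HxT _ Hz.
apply: (@fixed_trans (Cup U (sg x))).
- move=> y /CupE [/(sepE _ _ HP) [Hy [z [Hz Hmin]]]|/sgE ->] v Hv; apply/CupE; left.
  + apply/sepE => //; split; first exact: HT Hy _ Hv.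
    by exists z; split=> // s Hs Hst Hzs; apply: Hst (Hmin s Hs Hst Hzs) _ Hv.
  + apply/sepE => //; split; first exact: HT HxT _ Hv.
    by exists v.
- move=> z /CupE [/UD /fixed_fix //|/sgE ->].
  by apply: fix_ext => y /Hx /fixed_fix.
- by apply/CupE; right; apply/sgE.
Qed.

Lemma j_upr x y : j (upr x y) = upr (j x) (j y).
Proof.
apply: ext => z; have [w ->] := j_surj z.
have j_eq a b : j a = j b <-> a = b.
  by split=> [|->//]; case: j_aut => /bij_inj H _ /H.
by rewrite j_memE !uprE !j_eq.
Qed.

Lemma j_opr x y : j (opr x y) = opr (j x) (j y).
Proof. by rewrite /opr /sg !j_upr. Qed.

(** The set of moved elements of [t] is definable from the parameters [F] and [j F], so foundation
    applies to it. A minimal moved element has only fixed elements and would itself be fixed. *)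
Lemma fixed_onto Q F t : D Q -> onto_trans Q F t -> D t.
Proof.
move=> HQ [Ht [H1 H2] H3].
(* As [p] is fixed and [F] is functional, [j F] relates [p] to [j s] and to nothing else. *)
have jF p s : p ∈ Q -> opr p s ∈ F -> (opr p s ∈ j F <-> j s = s).
  move=> Hp Hs; have jp : j p = p by apply: fixed_fix; apply: fixed_mem Hp.
  have Hjs : opr p (j s) ∈ j F by rewrite -{1}jp -j_opr j_memE.
  split=> [Hs'|E]; last by rewrite -{1}E.
  have [z Ez] := j_surj s.
  have : opr p z ∈ F by rewrite -j_memE j_opr jp -Ez.
  by move=> Hz; rewrite {2}Ez (H2 _ _ _ Hz Hs).
have Hfix s : s ∈ t -> j s = s.
  pose P s := exists p, p ∈ Q /\ (opr p s ∈ F /\ ~ opr p s ∈ j F).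
  have HP : Def Delta0 true (fun e => P (e 0)) by rewrite /P; ddef.
  move=> Hs; apply: NNPP => Hne.
  have [|s0 [/(sepE _ _ HP) [Hs0 [p0 [Hp0 [Hps0 Hn]]]] Hmin]] := @found _ _ (sep t P).
    exists s; apply/sepE => //; split=> //.
    have [p Hp] := H3 s Hs; have [HpQ _] := H1 _ _ Hp.
    by exists p; do 2 split=> //; move/(jF _ _ HpQ Hp).
  apply: Hn; apply/jF => //; apply: fix_ext => u Hu.
  apply: NNPP => Hnu; apply: (Hmin u Hu); apply/sepE => //.
  have Hut : u ∈ t by apply: Ht Hs0 _ Hu.
  split=> //; have [p Hp] := H3 u Hut; have [HpQ _] := H1 _ _ Hp.
  by exists p; do 2 split=> //; move/(jF _ _ HpQ Hp).
by apply: fixed_intro => s Hs; apply: (fixed_trans Ht).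
Qed.

Lemma fixed_smap a G t : D a -> transitive_in t -> smap a G t -> D t.
Proof. by move=> Ha Ht Hs; apply: fixed_onto Ha (smap_onto Ht Hs). Qed.

(** The order type of a transitive set containing a moved point maps onto that set, so it cannot lie
    in [D]. *)
Lemma ord_not_fixed : exists b, ord b /\ ~ D b.
Proof.
have [x Hx] := j_nt; have [t [Ht Hxt]] := tc_exists x.
have [a [G [G' [Ha _ HG']]]] := order_type t.
exists a; split=> // Da; apply: Hx; apply: fixed_fix.
by apply: fixed_mem Hxt; apply: fixed_smap HG'.
Qed.

Lemma fixed_ord_below b t : ord b -> ~ D b -> D t ->
  exists a G, [/\ ord a, D a, a ∈ b & smap a G t].
Proof.
move=> Hb HDb Dt; have [a [G [G' [Ha HG HG']]]] := order_type t.
have Da : D a by apply: fixed_smap HG => //; case: Ha.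
exists a, G'; split=> //.
case: (ord_cmp Ha Hb) => // [E|Hba]; case: HDb; first by rewrite -E.
exact: fixed_mem Hba.
Qed.

Lemma smap_mono a b G t : subset_in a b -> smap a G t -> smap b G t.
Proof.
move=> Hab [H1 H2 H3]; split=> //.
  by move=> p u /H1 [/Hab].
by move=> u /H3 [p [/Hab Hp Hpu]]; exists p.
Qed.

(** Every transitive member of [D] is an image of the same ordinal [b] outside [D], hence is covered
    by the collapse of a relation on [b]. One set contains such a collapse for each relation, and a
    supertransitive set around it covers [D]. *)
Lemma fixed_bound : exists C, strans C /\ forall x, D x -> x ∈ C.
Proof.
have [b [Hb HDb]] := ord_not_fixed.
have [z Hz] := coll_closed_exists b (Pw (Pw b)).
have [C [HC HzC]] := strans_exists z.
exists C; split=> // y Dy; have [t [Ht Hy H]] := fixed_TC Dy.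
have Dt : D t by apply: fixed_intro.
have [a [G [Ha Da Hab HG]]] := fixed_ord_below Hb HDb Dt.
have Hon : onto_trans b G t.
  by apply: smap_onto => //; apply: smap_mono HG; apply: Hb.1.
have Hpm : partial_map b G t by case: Hon.
have [|g [Hg Hgc]] := Hz (pullback b G) _ (pullback_wf Hpm).
  move=> e; rewrite /pullback sepE; last by ddef.
  move=> [/prodE [p [Hp [q [Hq ->]]]] _].
  apply/PwE => u /uprE Hu; apply/PwE => v.
  by case: Hu => -> /uprE [] ->.
have [p [_ Hp]] : exists p, p ∈ a /\ opr p y ∈ G by case: HG => _ _; apply.
have Hpg : opr p y ∈ g by apply: pullback_coll Hon Hgc _ _ Hp.
have [u [Hu [_ Hyu]]] := opr_parts p y.
have HgC := HC.1 _ HzC _ Hg; have HpC := HC.1 _ HgC _ Hpg.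
by have HuC := HC.1 _ HpC _ Hu; apply: HC.1 _ HuC _ Hyu.
Qed.

(** [A a] says that witnesses occur in transitive images of [a]; it holds for every ordinal below
    [b] outside [D]. The least [a0] satisfying it has all its elements in [D], so it is in [D], and
    so are the transitive images of [a0]. *)
Lemma fixed_coll (P : M -> M -> Prop) : Def Delta0 true (fun e => P (e 1) (e 0)) ->
  forall w, D w -> (forall x, x ∈ w -> exists y, D y /\ P x y) ->
  exists c, D c /\ forall x, x ∈ w -> exists y, y ∈ c /\ P x y.
Proof.
move=> HP w Dw Hex.
have [b [Hb HDb]] := ord_not_fixed; have [C [HC DC]] := fixed_bound.
(* Transitive sets and maps are both confined to a set, so that [small] is a Delta_0 predicate. *)
pose PG := Pw (prod b C).
pose small a y := exists t, t ∈ C /\ ((transitive_in t /\ y ∈ t) /\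
  exists G, G ∈ PG /\ (((forall p u, opr p u ∈ G -> p ∈ a /\ u ∈ t) /\
  (forall p u, opr p u ∈ G -> forall u', opr p u' ∈ G -> u = u')) /\
  (forall u, u ∈ t -> exists p, p ∈ a /\ opr p u ∈ G))).
have smallE a y : small a y <-> exists t G,
    [/\ t ∈ C, transitive_in t, y ∈ t, G ∈ PG & smap a G t].
  split.
  - by move=> [t [H1 [[H2 H3] [G [H4 [[H5 H6] H7]]]]]]; exists t, G; do 2 split=> //.
  - move=> [t [G [H1 H2 H3 H4 [H5 H6 H7]]]]; exists t; do 2 split=> //; by exists G.
have Dsmall a y : D a -> small a y -> D y.
  move=> Da /smallE [t [G [_ Ht Hy _ HG]]].
  by apply: fixed_mem Hy; apply: fixed_smap HG.
pose A a := forall x, x ∈ w -> exists y, y ∈ C /\ (P x y /\ small a y).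
have HA : Def Delta0 true (fun e => A (e 0)).
  by rewrite /A /small; ddef.
have big c : c ∈ b -> ~ D c -> A c.
  move=> Hcb HDc x Hx; have [y [Dy Pxy]] := Hex x Hx.
  exists y; split; [exact: DC|split=> //].
  have [t [Ht Hy H]] := fixed_TC Dy.
  have Dt : D t by apply: fixed_intro.
  have Hc : ord c by apply: ord_mem Hcb.
  have [a [G [Ha Da Hac HG]]] := fixed_ord_below Hc HDc Dt.
  have HGc : smap c G t by apply: smap_mono HG; apply: Hc.1.
  have HQ : Def Delta0 true (fun e : nat -> M => e 0 ∈ G) by ddef.
  pose G1 := sep (prod c t) (fun z => z ∈ G).
  have [G_1 G_2 G_3] := HGc.
  have G1E p u : opr p u ∈ G1 <-> opr p u ∈ G.
    by rewrite sepE // opr_prod; split=> [[]//|Hpu]; split=> //; apply: G_1.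
  apply/smallE; exists t, G1; split=> //; first exact: DC.
  - apply/PwE => z /(sepE _ _ HQ) [/prodE [p [Hp [q [Hq ->]]]] _].
    apply/opr_prod; split; first exact: Hb.1 _ Hcb _ Hp.
    by apply: DC; apply: fixed_mem Hq.
  - split.
    + by move=> p u /G1E /G_1.
    + by move=> p u /G1E Hu u' /G1E; apply: G_2.
    + by move=> u /G_3 [p [Hp /G1E Hpu]]; exists p.
have [c [Hcb HDc]] : exists c, c ∈ b /\ ~ D c.
  apply: NNPP => HN; apply: HDb; apply: fixed_intro => c Hc.
  by apply: NNPP => HDc; apply: HN; exists c.
have [|a0 [/(sepE _ _ HA) [Ha0 Aa0] Hmin]] := @found _ _ (sep b A).
  by exists c; apply/sepE => //; split=> //; apply: big.
have Da0 : D a0.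
  apply: fixed_intro => d Hd; apply: NNPP => HDd; apply: (Hmin d Hd).
  have Hdb : d ∈ b by apply: Hb.1 _ Ha0 _ Hd.
  by apply/sepE => //; split=> //; apply: big.
have Hs : Def Delta0 true (fun e => small a0 (e 0)) by rewrite /small; ddef.
exists (sep C (small a0)); split.
  by apply: fixed_intro => y /(sepE _ _ Hs) [_]; apply: Dsmall.
move=> x Hx; have [y [Hy [Pxy Hsm]]] := Aa0 x Hx.
by exists y; split=> //; apply/sepE.
Qed.

Lemma fixed_good : Infinity (Ifix j) -> good D.
Proof.
move=> [[X DX] [[[o Do] [/= oX o_e]] X_s]]; split.
- by move=> x y; apply: fixed_mem.
- by move=> x y Dy Hxy; apply: fixed_intro => z /Hxy; apply: fixed_mem.
- move=> y Dy; apply: fixed_intro => z /PwE Hz.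
  by apply: fixed_intro => u /Hz; apply: fixed_mem.
- by move=> x y Dx Dy; apply: fixed_intro => z /uprE [] ->.
- move=> x Dx; apply: fixed_intro => z /UnE [w [Hw Hz]].
  by apply: fixed_mem Hz; apply: fixed_mem Hw.
- move=> x /fixed_TC [t [Ht Hx H]]; exists t; split=> //; exact: fixed_intro.
- exact: fixed_onto.
- exists X, o; split=> //.
    move=> y Hy; have Dy : D y by apply: fixed_mem Hy.
    exact: (o_e (exist _ y (fixed_mem Do Hy)) Hy).
  move=> y Hy; have Dy : D y by apply: fixed_mem Hy.
  have [[w Dw] [/= Hw Hs]] := X_s (exist _ y Dy) Hy.
  exists w; split=> // z; split.
  + move=> Hz; have Dz : D z by apply: fixed_mem Hz.
    have [/(_ Hz) H _] := Hs (exist _ z Dz).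
    by case: H => [|[]]; [left|right].
  + case=> [Hz|->].
    * have Dz : D z by apply: fixed_mem Hz.
      by apply: (proj2 (Hs (exist _ z Dz))); left.
    * by apply: (proj2 (Hs (exist _ y Dy))); right.
- exact: fixed_bound.
- exact: fixed_coll.
Qed.

End Fix.

(** * Recursive functions *)

(* The k arguments of f are read off an environment, which is 0 beyond k. *)
Definition rec_env k (f : (nat -> nat) -> nat) :=
  recursive (fun v : k.-tuple nat => f (fun i => nth 0 v i)).

Lemma rec_env_eq k f g : (forall e, (forall i, k <= i -> e i = 0) -> f e = g e) ->
  rec_env k f -> rec_env k g.
Proof.
rewrite /rec_env => E; suff -> : (fun v : k.-tuple nat => f (fun i => nth 0 v i)) =
  (fun v : k.-tuple nat => g (fun i => nth 0 v i)) by [].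
apply: functional_extensionality => v; apply: E => i Hi.
by rewrite nth_default // size_tuple.
Qed.

Lemma rec_env_var k i : i < k -> rec_env k (fun e => e i).
Proof.
move=> Hi; rewrite /rec_env; have := rec_proj (Ordinal Hi).
suff -> : (fun v : k.-tuple nat => tnth v (Ordinal Hi)) = (fun v => nth 0 v i) by [].
by apply: functional_extensionality => v; rewrite (tnth_nth 0).
Qed.

Lemma rec_env_comp k m f (g : nat -> (nat -> nat) -> nat) : rec_env m f ->
  (forall i, i < m -> rec_env k (g i)) ->
  rec_env k (fun e => f (fun i => if i < m then g i e else 0)).
Proof.
rewrite /rec_env => Hf Hg.
have := rec_comp Hf (fun i : 'I_m => Hg i (ltn_ord i)).
set F := (X in recursive X -> _); set F' := (X in _ -> recursive X).
suff -> : F = F' by [].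
apply: functional_extensionality => v; rewrite /F /F'; congr f.
apply: functional_extensionality => i; case: ifP => Hi; last first.
  by rewrite nth_default // size_tuple leqNgt Hi.
by rewrite -(tnth_nth 0 _ (Ordinal Hi)) tnth_mktuple.
Qed.

Lemma rec_env_cst k c : rec_env k (fun _ => c).
Proof.
elim: c => [|c IH].
  exact: (@rec_env_comp k 0 (fun _ => 0) (fun _ _ => 0) rec_zero).
apply: (@rec_env_comp k 1 (fun e => (e 0).+1) (fun _ _ => c)) => //.
rewrite /rec_env; have := rec_succ.
suff -> : (fun v : 1.-tuple nat => (thead v).+1) =
  (fun v : 1.-tuple nat => (nth 0 v 0).+1) by [].
by apply: functional_extensionality => v; rewrite /thead (tnth_nth 0).
Qed.

Lemma rec_env_succ k f : rec_env k f -> rec_env k (fun e => (f e).+1).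
Proof.
move=> Hf; apply: (@rec_env_comp k 1 (fun e => (e 0).+1) (fun _ => f)) => //.
rewrite /rec_env; have := rec_succ.
suff -> : (fun v : 1.-tuple nat => (thead v).+1) =
  (fun v : 1.-tuple nat => (nth 0 v 0).+1) by [].
by apply: functional_extensionality => v; rewrite /thead (tnth_nth 0).
Qed.

Lemma rec_env_prim k f g t : rec_env k f ->
  rec_env k.+2 (fun e => g (e 0) (e 1) (fun i => e i.+2)) -> rec_env k t ->
  rec_env k (fun e => nat_rect (fun _ => nat) (f e) (fun c acc => g c acc e) (t e)).
Proof.
move=> Hf Hg Ht.
pose h (e : nat -> nat) := nat_rect (fun _ => nat) (f (fun i => e i.+1))
  (fun c acc => g c acc (fun i => e i.+1)) (e 0).
have Hh : rec_env k.+1 h.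
  by apply: (rec_prim (h := fun v => h (fun i => nth 0 v i)) Hf Hg).
have := @rec_env_comp k k.+1 h (fun i e => if i is i'.+1 then e i' else t e) Hh.
move=> H; apply: (rec_env_eq _ (H _)).
- move=> e He; rewrite /h /=.
  suff -> : (fun i => if i.+1 < k.+1 then e i else 0) = e by [].
  apply: functional_extensionality => i; rewrite ltnS.
  by case: ltnP => // /He.
- by case=> // i Hi; apply: rec_env_var.
Qed.

Definition rec1 (f : nat -> nat) := rec_env 1 (fun e => f (e 0)).
Definition rec2 (f : nat -> nat -> nat) := rec_env 2 (fun e => f (e 0) (e 1)).

Lemma rec_env_app1 f k t : rec1 f -> rec_env k t -> rec_env k (fun e => f (t e)).
Proof. by move=> Hf Ht; apply: (rec_env_comp (g := fun _ => t) Hf). Qed.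

Lemma rec_env_app2 f k t u : rec2 f -> rec_env k t -> rec_env k u ->
  rec_env k (fun e => f (t e) (u e)).
Proof.
move=> Hf Ht Hu.
by apply: (rec_env_comp (g := fun i => if i is 0 then t else u) Hf) => -[].
Qed.

Ltac recur := repeat (cbv beta; first
  [ exact: rec_env_cst | apply: rec_env_var; done | assumption
  | apply: rec_env_succ ]).

Lemma rec2_add : rec2 addn.
Proof.
apply: (@rec_env_eq 2 (fun e => nat_rect (fun _ => nat) (e 1) (fun c acc => acc.+1) (e 0))).
  by move=> e _; elim: (e 0) => //= n ->.
by apply: rec_env_prim; recur.
Qed.

Lemma rec2_mul : rec2 muln.
Proof.
apply: (@rec_env_eq 2 (fun e => nat_rect (fun _ => nat) 0 (fun c acc => e 1 + acc) (e 0))).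
  by move=> e _; elim: (e 0) => //= n ->; rewrite mulSn.
apply: (@rec_env_prim 2 _ (fun c acc e => e 1 + acc)); recur.
by apply: (rec_env_app2 rec2_add); recur.
Qed.

Lemma rec1_pred : rec1 predn.
Proof.
apply: (@rec_env_eq 1 (fun e => nat_rect (fun _ => nat) 0 (fun c acc => c) (e 0))).
  by move=> e _; case: (e 0).
by apply: rec_env_prim; recur.
Qed.

Lemma rec2_sub : rec2 subn.
Proof.
apply: (@rec_env_eq 2 (fun e => nat_rect (fun _ => nat) (e 0) (fun c acc => acc.-1) (e 1))).
  by move=> e _; elim: (e 1) => [|n /= ->]; rewrite ?subn0 ?subnS.
by apply: rec_env_prim; recur; apply: (rec_env_app1 rec1_pred); recur.
Qed.

Lemma rec1_pow2 : rec1 (expn 2).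
Proof.
apply: (@rec_env_eq 1 (fun e => nat_rect (fun _ => nat) 1 (fun c acc => 2 * acc) (e 0))).
  by move=> e _; elim: (e 0) => //= n ->; rewrite expnS.
by apply: rec_env_prim; recur; apply: (rec_env_app2 rec2_mul); recur.
Qed.

(** One step of [CodeSeq.code]; it serves both for Gödel numbers and as a pairing function. *)
Definition consn n m := 2 ^ n * m.*2.+1.

Lemma rec2_consn : rec2 consn.
Proof.
apply: (@rec_env_eq 2 (fun e => 2 ^ e 0 * (e 1 + e 1).+1)).
  by move=> e _; rewrite /consn addnn.
apply: (rec_env_app2 rec2_mul); first by apply: (rec_env_app1 rec1_pow2); recur.
by recur; apply: (rec_env_app2 rec2_add); recur.
Qed.

Definition ifz (x a b : nat) := if x is 0 then a else b.

Lemma rec_env_ifz k x a b : rec_env k x -> rec_env k a -> rec_env k b ->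
  rec_env k (fun e => ifz (x e) (a e) (b e)).
Proof.
move=> Hx Ha Hb.
have H3 : rec_env 3 (fun e => ifz (e 0) (e 1) (e 2)).
  apply: (@rec_env_eq 3 (fun e => nat_rect (fun _ => nat) (e 1) (fun c acc => e 2) (e 0))).
    by move=> e _; case: (e 0).
  by apply: (@rec_env_prim 3 _ (fun c acc e => e 2)); recur.
by apply: (rec_env_comp (g := fun i => match i with 0 => x | 1 => a | _ => b end) H3)
  => -[|[]].
Qed.

Definition oddn (n : nat) : nat := odd n.

Lemma rec1_odd : rec1 oddn.
Proof.
apply: (@rec_env_eq 1 (fun e => nat_rect (fun _ => nat) 0 (fun c acc => 1 - acc) (e 0))).
  by move=> e _; elim: (e 0) => //= n ->; rewrite /oddn /=; case: (odd n).
by apply: rec_env_prim; recur; apply: (rec_env_app2 rec2_sub); recur.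
Qed.

Lemma rec1_half : rec1 half.
Proof.
apply: (@rec_env_eq 1 (fun e => nat_rect (fun _ => nat) 0 (fun c acc => oddn c + acc) (e 0))).
  by move=> e _; elim: (e 0) => //= n ->; rewrite uphalf_half.
apply: (@rec_env_prim 1 _ (fun c acc e => oddn c + acc)); recur.
by apply: (rec_env_app2 rec2_add); recur; apply: (rec_env_app1 rec1_odd); recur.
Qed.

Definition halves k x := iter k half x.

Lemma rec2_halves : rec2 halves.
Proof.
apply: (@rec_env_eq 2 (fun e => nat_rect (fun _ => nat) (e 1) (fun c acc => acc./2) (e 0))).
  by move=> e _; rewrite /halves; elim: (e 0) => //= n ->.
by apply: rec_env_prim; recur; apply: (rec_env_app1 rec1_half); recur.
Qed.

(** The exponent of 2 in a positive [x]: the counter grows while the quotient is even, and [x]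
    rounds suffice because the exponent is less than [x]. *)
Definition hdn x := nat_rect (fun _ => nat) 0
  (fun c acc => ifz (oddn (halves acc x)) acc.+1 acc) x.
Definition tln x := half (halves (hdn x) x).

Lemma rec1_hdn : rec1 hdn.
Proof.
apply: (@rec_env_prim 1 (fun _ => 0)
  (fun c acc e => ifz (oddn (halves acc (e 0))) acc.+1 acc) (fun e => e 0)); recur.
by apply: rec_env_ifz; recur; apply: (rec_env_app1 rec1_odd);
  apply: (rec_env_app2 rec2_halves); recur.
Qed.

Lemma rec1_tln : rec1 tln.
Proof.
apply: (rec_env_app1 rec1_half); apply: (rec_env_app2 rec2_halves); recur.
exact: rec1_hdn.
Qed.

Lemma halves_pow k n q : k <= n -> halves k (2 ^ n * q) = 2 ^ (n - k) * q.
Proof.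
elim: k => [|k IH] Hk; first by rewrite subn0.
rewrite /halves iterS -/(halves k _) IH ?(ltnW Hk) //.
have -> : n - k = (n - k.+1).+1 by lia.
by rewrite expnS -mulnA mul2n doubleK.
Qed.

Lemma hdn_consn n m : hdn (consn n m) = n.
Proof.
rewrite /hdn; have [x Ex] : exists x, x = consn n m by exists (consn n m).
rewrite -{1}Ex.
suff H i : nat_rect (fun _ => nat) 0
    (fun c acc => ifz (oddn (halves acc x)) acc.+1 acc) i = minn i n.
  rewrite -?Ex H; apply/minn_idPr; apply: ltnW; rewrite ?Ex.
  apply: leq_trans (ltn_expl n (isT : 1 < 2)) _.
  by rewrite /consn leq_pmulr.
elim: i => [|i /= ->]; first by rewrite min0n.
have [Hi|Hi] : i <= n \/ n < i by lia.
- rewrite (minn_idPl Hi) Ex /consn halves_pow //.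
  move: Hi; rewrite leq_eqVlt => /orP[/eqP ->|Hi].
    by rewrite subnn mul1n /oddn /= odd_double /=; lia.
  have -> : n - i = (n - i.+1).+1 by lia.
  by rewrite expnS -mulnA mul2n /oddn odd_double /=; lia.
- rewrite (minn_idPr (ltnW Hi)) Ex /consn halves_pow // subnn mul1n.
  by rewrite /oddn /= odd_double /=; lia.
Qed.

Lemma tln_consn n m : tln (consn n m) = m.
Proof.
rewrite /tln hdn_consn halves_pow // subnn mul1n.
by rewrite -[m.*2.+1]/(true + m.*2) half_bit_double.
Qed.

Lemma consn_gt n m : n < consn n m /\ m < consn n m.
Proof.
rewrite /consn; have H : n < 2 ^ n by apply: ltn_expl.
have H0 : 0 < 2 ^ n by rewrite expn_gt0.
move: (2 ^ n) H H0 => q; nia.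
Qed.

Lemma consn_surj x : 0 < x -> x = consn (hdn x) (tln x).
Proof.
move=> Hx; suff [n [m ->]] : exists n m, x = consn n m by rewrite hdn_consn tln_consn.
elim/ltn_ind: x Hx => x IH Hx.
case Ho : (odd x).
  by exists 0, x./2; rewrite /consn mul1n -{1}(odd_double_half x) Ho.
have [||n [m E]] := IH x./2; [lia..|].
exists n.+1, m; rewrite /consn expnS -mulnA -/(consn n m) -E.
by rewrite -{1}(odd_double_half x) Ho mul2n.
Qed.

Lemma hdn_lt x : 0 < x -> hdn x < x.
Proof. by move=> Hx; rewrite {2}(consn_surj Hx); case: (consn_gt (hdn x) (tln x)). Qed.

Lemma tln_lt x : 0 < x -> tln x < x.
Proof. by move=> Hx; rewrite {2}(consn_surj Hx); case: (consn_gt (hdn x) (tln x)). Qed.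

(** * A recursive enumeration of the Delta0P formulas *)

(** Course-of-values enumeration: [m] is read as the code of a tag and two arguments, and [l] lists
    the earlier formulas, latest first. The remaining connectives and quantifiers are recovered up
    to equivalence. *)
Definition gstep (m : nat) (l : seq formula) : formula :=
  let a := hdn (tln m) in let b := hdn (tln (tln m)) in
  let look i := nth (fEq 0 0) l (m.-1 - i) in
  match hdn m with
  | 0 => fMem a b
  | 1 => fEq a b
  | 2 => fNot (look a)
  | 3 => fAnd (look a) (look b)
  | 4 => fAll_in a (look b)
  | _ => fAll_sub a (look b)
  end.

Fixpoint glist n := if n is m.+1 then gstep m (glist m) :: glist m else [::].
Definition gen n := gstep n (glist n).

Lemma size_glist n : size (glist n) = n.
Proof. by elim: n => //= n ->. Qed.

Lemma nth_glist d n i : i < n -> nth d (glist n) (n.-1 - i) = gen i.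
Proof.
elim: n => //= n IH; rewrite ltnS leq_eqVlt => /orP[/eqP ->|Hi].
  by rewrite subnn.
have -> : n - i = (n.-1 - i).+1 by lia.
by rewrite /= IH.
Qed.

Lemma args_lt n : 0 < n -> hdn (tln n) < n /\ hdn (tln (tln n)) < n.
Proof.
have H x : hdn x <= x by case: x => // x; apply: ltnW; apply: hdn_lt.
have T x : tln x <= x by case: x => // x; apply: ltnW; apply: tln_lt.
move=> Hn; have := tln_lt Hn; move: (H (tln n)) (H (tln (tln n))) (T (tln n)); lia.
Qed.

Lemma gen_step n : gen n =
  let a := hdn (tln n) in let b := hdn (tln (tln n)) in
  match hdn n with
  | 0 => fMem a b
  | 1 => fEq a b
  | 2 => fNot (gen a)
  | 3 => fAnd (gen a) (gen b)
  | 4 => fAll_in a (gen b)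
  | _ => fAll_sub a (gen b)
  end.
Proof.
case: n => [|n]; first by [].
have [Ha Hb] := @args_lt n.+1 isT.
by rewrite {1}/gen /gstep !nth_glist.
Qed.

Lemma gen_Delta0P n : Delta0P (gen n).
Proof.
elim/ltn_ind: n => -[|n] IH; first by constructor.
have [Ha Hb] := @args_lt n.+1 isT.
rewrite gen_step /=; case: (hdn _) => [|[|[|[|[|k]]]]]; constructor; exact: IH.
Qed.

Lemma gen_free n : free_below n.+1 (gen n).
Proof.
elim/ltn_ind: n => -[|n] IH; first by [].
have [Ha Hb] := @args_lt n.+1 isT.
have IHa k : n.+1 < k -> free_below k (gen (hdn (tln n.+1))).
  by move=> Hk; apply: free_below_le (IH _ Ha); lia.
have IHb k : n.+1 < k -> free_below k (gen (hdn (tln (tln n.+1)))).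
  by move=> Hk; apply: free_below_le (IH _ Hb); lia.
rewrite gen_step /=; case: (hdn _) => [|[|[|[|[|k]]]]] /=.
- by split; apply: ltnW.
- by split; apply: ltnW.
- exact: IHa.
- by split; [apply: IHa|apply: IHb].
- split; [split=> //; lia|apply: IHb; lia].
- split; [split=> //; split=> //; lia|apply: IHb; lia].
Qed.

Lemma gen_consn t a b : gen (consn t (consn a (consn b 0))) =
  match t with
  | 0 => fMem a b
  | 1 => fEq a b
  | 2 => fNot (gen a)
  | 3 => fAnd (gen a) (gen b)
  | 4 => fAll_in a (gen b)
  | _ => fAll_sub a (gen b)
  end.
Proof. by rewrite gen_step !(tln_consn, hdn_consn). Qed.

Lemma gen_surj f : Delta0P f ->
  exists n, forall (M : Lstructure) (e : nat -> M), sat e (gen n) <-> sat e f.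
Proof.
pose nt a := consn 2 (consn a (consn 0 0)).
have ntE (M : Lstructure) (e : nat -> M) a : sat e (gen (nt a)) <-> ~ sat e (gen a).
  by rewrite gen_consn.
pose an a b := consn 3 (consn a (consn b 0)).
have anE (M : Lstructure) (e : nat -> M) a b :
    sat e (gen (an a b)) <-> sat e (gen a) /\ sat e (gen b).
  by rewrite gen_consn.
pose al i a := consn 4 (consn i (consn a 0)).
have alE (M : Lstructure) (e : nat -> M) i a :
    sat e (gen (al i a)) <-> forall x, x ∈ e i -> sat (scons x e) (gen a).
  by rewrite gen_consn.
pose asb i a := consn 5 (consn i (consn a 0)).
have asbE (M : Lstructure) (e : nat -> M) i a :
    sat e (gen (asb i a)) <-> forall x, subset_in x (e i) -> sat (scons x e) (gen a).
  by rewrite gen_consn.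
elim=> {f} /=.
- by move=> i j; exists (consn 0 (consn i (consn j 0))) => M e; rewrite gen_consn.
- by move=> i j; exists (consn 1 (consn i (consn j 0))) => M e; rewrite gen_consn.
- by move=> f _ [n Hn]; exists (nt n) => M e; rewrite ntE Hn.
- by move=> f g _ [n Hn] _ [m Hm]; exists (an n m) => M e; rewrite anE Hn Hm.
- move=> f g _ [n Hn] _ [m Hm]; exists (nt (an (nt n) (nt m))) => M e.
  by rewrite ntE anE !ntE Hn Hm; tauto.
- move=> f g _ [n Hn] _ [m Hm]; exists (nt (an n (nt m))) => M e.
  by rewrite ntE anE !ntE Hn Hm; tauto.
- move=> i f _ [n Hn]; exists (al i n) => M e; rewrite alE.
  by split=> H x Hx; apply/Hn; apply: H.
- move=> i f _ [n Hn]; exists (nt (al i (nt n))) => M e; rewrite ntE alE; split.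
  + move=> H; apply: NNPP => HN; apply: H => x Hx; rewrite ntE Hn => Hs.
    by apply: HN; exists x.
  + by move=> [x [Hx Hs]] H; have := H x Hx; rewrite ntE Hn; apply.
- move=> i f _ [n Hn]; exists (asb i n) => M e; rewrite asbE.
  by split=> H x Hx; apply/Hn; apply: H.
- move=> i f _ [n Hn]; exists (nt (asb i (nt n))) => M e; rewrite ntE asbE; split.
  + move=> H; apply: NNPP => HN; apply: H => x Hx; rewrite ntE Hn => Hs.
    by apply: HN; exists x.
  + by move=> [x [Hx Hs]] H; have := H x Hx; rewrite ntE Hn; apply.
Qed.

Lemma codeE x s : CodeSeq.code (x :: s) = consn x (CodeSeq.code s).
Proof. by []. Qed.

Definition c1 t a := consn t (consn a 0).
Definition c2 t a b := consn t (consn a (consn b 0)).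

Lemma rec_env_c1 k t a : rec_env k t -> rec_env k a -> rec_env k (fun e => c1 (t e) (a e)).
Proof.
by move=> Ht Ha; apply: (rec_env_app2 rec2_consn) => //; apply: (rec_env_app2 rec2_consn) => //; recur.
Qed.

Lemma rec_env_c2 k t a b : rec_env k t -> rec_env k a -> rec_env k b ->
  rec_env k (fun e => c2 (t e) (a e) (b e)).
Proof.
move=> Ht Ha Hb; apply: (rec_env_app2 rec2_consn) => //.
by apply: (rec_env_app2 rec2_consn) => //; apply: (rec_env_app2 rec2_consn) => //; recur.
Qed.

Definition tlns k x := iter k tln x.

Lemma rec2_tlns : rec2 tlns.
Proof.
apply: (@rec_env_eq 2 (fun e => nat_rect (fun _ => nat) (e 1) (fun c acc => tln acc) (e 0))).
  by move=> e _; rewrite /tlns; elim: (e 0) => //= n ->.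
by apply: rec_env_prim; recur; apply: (rec_env_app1 rec1_tln); recur.
Qed.

Ltac recur1 := lazymatch goal with
  | |- rec_env _ (fun _ => ?c) => exact: rec_env_cst
  | |- rec_env ?k (fun e => e ?i) => exact: (@rec_env_var k i isT)
  | |- rec_env ?k (fun e => (@?f e).+1) => apply: (@rec_env_succ k f)
  | |- rec_env ?k (fun e => c1 (@?t e) (@?a e)) => apply: (@rec_env_c1 k t a)
  | |- rec_env ?k (fun e => c2 (@?t e) (@?a e) (@?b e)) => apply: (@rec_env_c2 k t a b)
  | |- rec_env ?k (fun e => ifz (@?t e) (@?a e) (@?b e)) => apply: (@rec_env_ifz k t a b)
  | |- rec_env ?k (fun e => hdn (@?a e)) => apply: (@rec_env_app1 hdn k a rec1_hdn)
  | |- rec_env ?k (fun e => tln (@?a e)) => apply: (@rec_env_app1 tln k a rec1_tln)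
  | |- rec_env ?k (fun e => predn (@?a e)) => apply: (@rec_env_app1 predn k a rec1_pred)
  | |- rec_env ?k (fun e => addn (@?a e) (@?b e)) => apply: (@rec_env_app2 addn k a b rec2_add)
  | |- rec_env ?k (fun e => subn (@?a e) (@?b e)) => apply: (@rec_env_app2 subn k a b rec2_sub)
  | |- rec_env ?k (fun e => muln (@?a e) (@?b e)) => apply: (@rec_env_app2 muln k a b rec2_mul)
  | |- rec_env ?k (fun e => consn (@?a e) (@?b e)) => apply: (@rec_env_app2 consn k a b rec2_consn)
  | |- rec_env ?k (fun e => tlns (@?a e) (@?b e)) => apply: (@rec_env_app2 tlns k a b rec2_tlns)
  end.
Ltac recur ::= repeat (cbv beta; recur1).

Lemma hdn_tlns s k : hdn (tlns k (CodeSeq.code s)) = nth 0 s k.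
Proof.
elim: s k => [|x s IH] k.
  by rewrite nth_nil; elim: k => //= k IH; suff -> : forall k, tlns k 0 = 0; [|elim=> //= ? ->].
case: k => [|k]; first by rewrite /= hdn_consn.
by rewrite /tlns iterSr codeE tln_consn -/(tlns _ _) IH.
Qed.

(** [gstep] on Gödel numbers, with [h] coding the list of earlier values. The leading numerals are
    the constructor tags of [godel]; the last two branches spell out [fAll_in] and [fAll_sub]. *)
Definition cstep (m h : nat) : nat :=
  let a := hdn (tln m) in let b := hdn (tln (tln m)) in
  let look i := hdn (tlns (m.-1 - i) h) in
  let t := hdn m in
  ifz t (c2 0 a b) (ifz t.-1 (c2 1 a b) (ifz t.-1.-1 (c1 2 (look a))
  (ifz t.-1.-1.-1 (c2 3 (look a) (look b)) (ifz t.-1.-1.-1.-1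
    (c1 6 (c2 5 (c2 0 0 a.+1) (look b)))
    (c1 6 (c2 5 (c1 6 (c2 5 (c2 0 0 1) (c2 0 0 a.+2))) (look b))))))).

Definition clist n := nat_rect (fun _ => nat) 0 (fun m h => consn (cstep m h) h) n.

Lemma clistE n : clist n = CodeSeq.code (map godel (glist n)) /\
  cstep n (clist n) = godel (gen n).
Proof.
elim: n => [|n [IH1 IH2]]; first by [].
have E : clist n.+1 = CodeSeq.code (map godel (glist n.+1)).
  by rewrite /= -/(clist n) IH2 IH1.
split=> //; rewrite E; have [Ha Hb] := @args_lt n.+1 isT.
have look i : i < n.+1 ->
    hdn (tlns (n - i) (CodeSeq.code (map godel (glist n.+1)))) = godel (gen i).
  move=> Hi; rewrite hdn_tlns (nth_map (fEq 0 0)); last by rewrite size_glist; lia.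
  by rewrite (nth_glist _ (n := n.+1)).
rewrite gen_step /cstep [n.+1.-1]/= !look //.
by case: (hdn n.+1) => [|[|[|[|[|k]]]]].
Qed.

Lemma rec1_gen : rec1 (fun n => godel (gen n)).
Proof.
apply: (@rec_env_eq 1 (fun e => cstep (e 0) (clist (e 0)))).
  by move=> e _; case: (clistE (e 0)).
have Hc : rec2 cstep.
  by rewrite /rec2 /cstep; recur.
apply: (rec_env_app2 Hc); recur.
by apply: rec_env_prim; recur; apply: (rec_env_app2 Hc); recur.
Qed.

(** * Recursive saturation for enumerated types *)

Definition dist x y := (x - y) + (y - x).

(** Because [n <= c n], a preimage of [k] is at most [k]. The product of the distances from [c n] to
    [k] over these [n] vanishes exactly when a preimage exists. *)
Lemma recursive_range (c : nat -> nat) : rec1 c -> (forall n, n <= c n) ->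
  recursive_set (fun k => exists n, c n = k).
Proof.
move=> Hc Hle.
pose h k := nat_rect (fun _ => nat) 1 (fun n acc => acc * dist (c n) k) k.+1.
have Hh : rec1 h.
  apply: (@rec_env_prim 1 (fun _ => 1) (fun n acc e => acc * dist (c n) (e 0)) (fun e => (e 0).+1));
    recur.
  by rewrite /dist; recur; apply: (rec_env_app1 Hc); recur.
exists (fun v => h (nth 0 v 0)); split; first exact: Hh.
move=> k /=; rewrite /h.
have E N : nat_rect (fun _ => nat) 1 (fun n acc => acc * dist (c n) k) N = 0 <->
    exists n, n < N /\ c n = k.
  elim: N => [|N IH]; first by split=> // -[n []].
  rewrite [nat_rect _ _ _ _]/=; split.
  - move/eqP; rewrite muln_eq0 => /orP[/eqP /IH [n [Hn En]]|].
      by exists n; split=> //; lia.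
    by rewrite /dist => H; exists N; split=> //; lia.
  - move=> [n [Hn En]]; case: (ltnP n N) => HnN.
      by apply/eqP; rewrite muln_eq0; apply/orP; left; apply/eqP/IH; exists n.
    have -> : N = n by lia.
    by rewrite En /dist subnn muln0.
rewrite E; split=> -[n]; last by move=> [_]; exists n.
by move=> En; exists n; split=> //; rewrite ltnS -En.
Qed.

Lemma saturation (M : Lstructure) m N (F : nat -> formula) (e : nat -> M) :
  recursively_saturated M ->
  rec1 (fun n => godel (F n)) -> (forall n, n <= godel (F n)) ->
  (forall n, free_below (m + N) (F n)) ->
  (forall K, exists a : m.-tuple M, forall n, n < K -> sat (foldr (@scons M) e a) (F n)) ->
  exists a : m.-tuple M, forall n, sat (foldr (@scons M) e a) (F n).
Proof.
move=> Hsat Hrec Hle Hfree Hfin.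
have [|||a Ha] := Hsat m N (fun f => exists n, F n = f) e.
- have [h [Hh H]] := recursive_range Hrec Hle.
  exists h; split=> // k; rewrite -H; split.
  + by move=> [f [[n <-] E]]; exists n.
  + by move=> [n E]; exists (F n); split=> //; exists n.
- by move=> f [n <-].
- move=> s Hs.
  have [K HK] : exists K, List.Forall (fun f => exists n, n < K /\ F n = f) s.
    elim: Hs => [|f l [n <-] _ [K HK]]; first by exists 0.
    exists (K + n).+1; constructor; first by exists n; split=> //; lia.
    by apply: List.Forall_impl HK => g [k [Hk <-]]; exists k; split=> //; lia.
  have [a Ha] := Hfin K; exists a.
  by apply: List.Forall_impl HK => g [k [Hk <-]]; apply: Ha.
- by exists a => n; apply: Ha; exists n.
Qed.

(** * Types whose clauses run through the enumeration *)

Definition FO (f : formula) := True.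

#[global] Instance FO_class : formula_class FO.
Proof. by []. Qed.

Definition envl (M : Lstructure) (a : seq M) (x : M) : nat -> M := fun i => nth x a i.

(* [gen n] has free variables below n.+1; the dummy binders set those beyond
   the parameter list to the value of the innermost variable. *)
Definition dum f := fEx (fAnd (fEq 0 1) f).
Definition dums n f := iter n dum f.

(** Substitution by equations: each new bound variable is set equal to the variable it replaces. The
    Gödel number of the result is recursive in that of the body, without a recursion over the codes
    of subformulas. *)
Fixpoint binds (r : seq nat) k f :=
  if r is x :: r' then fEx (fAnd (fEq 0 (x + k).+1) (binds r' k.+1 f)) else f.

Definition inst n L := dums n.+1 (binds (rev L) n.+2 (gen n)).

Lemma sat_dums (M : Lstructure) n f (e : nat -> M) :
  sat e (dums n f) <-> sat (fun i => e (i - n)) f.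
Proof.
elim: n e => [|n IH] e.
  suff -> : (fun i => e (i - 0)) = e by [].
  by apply: functional_extensionality => i; rewrite subn0.
rewrite /dums iterS -/(dums n f) /=.
suff E : sat (fun i => e (i - n.+1)) f <-> sat (scons (e 0) e) (dums n f).
  by rewrite E; split=> [[a [-> H]] //|H]; exists (e 0).
rewrite IH.
suff -> : (fun i => scons (e 0) e (i - n)) = (fun i => e (i - n.+1)) by [].
apply: functional_extensionality => i; case E : (i - n) => [|k] /=; congr e; lia.
Qed.

Lemma sat_binds (M : Lstructure) r k f (e b : nat -> M) :
  (forall x, e (x + k) = b x) ->
  sat e (binds r k f) <-> sat (foldl (fun en x => scons (b x) en) e r) f.
Proof.
elim: r k e => //= x r IH k e H.
rewrite -(IH k.+1); last by move=> y; rewrite addnS /= H.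
by rewrite H; split=> [[a [-> Hs]] //|Hs]; exists (b x).
Qed.

Lemma foldr_scons_nth (M : Lstructure) (b e : nat -> M) L i :
  foldr (fun x en => scons (b x) en) e L i =
  if i < size L then b (nth 0 L i) else e (i - size L).
Proof. by elim: L i => [|x L IH] [|i] //=; rewrite ?subn0 // IH. Qed.

Lemma sat_inst (M : Lstructure) n L (e : nat -> M) x :
  sat (scons x e) (inst n L) <-> sat (envl (map e L) x) (gen n).
Proof.
rewrite /inst sat_dums (@sat_binds M _ _ _ _ e); last first.
  by move=> y; have -> : y + n.+2 - n.+1 = y.+1 by lia.
rewrite foldl_rev; apply: (sat_free_below (gen_free n)) => i Hi.
rewrite foldr_scons_nth /envl; case: ifP => HL; first by rewrite (nth_map 0).
rewrite nth_default; last by rewrite size_map; lia.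
by have -> : i - size L - n.+1 = 0 by lia.
Qed.

(** Clause [n] of the type behind [reflects]; [typB] plays the same part for [indisc]. *)
Definition typA n L L' k := fImp (fEx (inst n L)) (fEx (fAnd (fMem 0 k.+1) (inst n L'))).
Definition typB n L L' k := fAll (fImp (fMem 0 k.+1)
  (fAnd (fImp (inst n L) (inst n L')) (fImp (inst n L') (inst n L)))).

Lemma sat_typA (M : Lstructure) n L L' k (e : nat -> M) : sat e (typA n L L' k) <->
  ((exists x, sat (envl (map e L) x) (gen n)) ->
   exists x, x ∈ e k /\ sat (envl (map e L') x) (gen n)).
Proof.
split=> /= H.
- move=> [x Hx]; have [|y [Hy Hs]] := H; first by exists x; apply/sat_inst.
  by exists y; split=> //; apply/sat_inst.
- move=> [x /sat_inst Hx]; have [|y [Hy Hs]] := H; first by exists x.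
  by exists y; split=> //; apply/sat_inst.
Qed.

Lemma sat_typB (M : Lstructure) n L L' k (e : nat -> M) : sat e (typB n L L' k) <->
  forall x, x ∈ e k -> (sat (envl (map e L) x) (gen n) <-> sat (envl (map e L') x) (gen n)).
Proof.
split=> H x Hx.
- have [H1 H2] : (sat (scons x e) (inst n L) -> sat (scons x e) (inst n L')) /\
    (sat (scons x e) (inst n L') -> sat (scons x e) (inst n L)) := H x Hx.
  by rewrite -!sat_inst.
- by have := H x Hx; rewrite -!sat_inst => -[H1 H2]; exact: (conj H1 H2).
Qed.

Lemma code_c1 t a : CodeSeq.code [:: t; a] = c1 t a.
Proof. by []. Qed.

Lemma code_c2 t a b : CodeSeq.code [:: t; a; b] = c2 t a b.
Proof. by []. Qed.

Lemma godelE : (forall i j, godel (fMem i j) = c2 0 i j) *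
  (forall i j, godel (fEq i j) = c2 1 i j) * (forall f, godel (fNot f) = c1 2 (godel f)) *
  (forall f g, godel (fAnd f g) = c2 3 (godel f) (godel g)) *
  (forall f g, godel (fOr f g) = c2 4 (godel f) (godel g)) *
  (forall f g, godel (fImp f g) = c2 5 (godel f) (godel g)) *
  (forall f, godel (fAll f) = c1 6 (godel f)) * (forall f, godel (fEx f) = c1 7 (godel f)).
Proof. by repeat split=> *; rewrite -?code_c1 -?code_c2. Qed.

Lemma c1_gt t a : a < c1 t a.
Proof. by rewrite /c1; move: (consn_gt t (consn a 0)) (consn_gt a 0); lia. Qed.

Lemma c2_gt t a b : a < c2 t a b /\ b < c2 t a b.
Proof.
rewrite /c2; move: (consn_gt t (consn a (consn b 0))) (consn_gt a (consn b 0)).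
by move: (consn_gt b 0); lia.
Qed.

Lemma dums_ge n f : n <= godel (dums n f).
Proof.
elim: n => // n IH; rewrite /dums iterS -/(dums n f) /dum !godelE.
have H1 := c1_gt 7 (c2 3 (c2 1 0 1) (godel (dums n f))).
have [_ H2] := c2_gt 3 (c2 1 0 1) (godel (dums n f)).
exact: leq_ltn_trans IH (ltn_trans H2 H1).
Qed.

Lemma inst_ge n L : n <= godel (inst n L).
Proof. by apply: ltnW; apply: dums_ge. Qed.

Lemma typA_ge n L L' k : n <= godel (typA n L L' k).
Proof.
rewrite /typA 2!godelE; apply: leq_trans (inst_ge n L) _.
by apply: ltnW; apply: ltn_trans (c1_gt 7 _) (c2_gt _ _ _).1.
Qed.

Lemma typB_ge n L L' k : n <= godel (typB n L L' k).
Proof.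
rewrite /typB !godelE; apply: leq_trans (inst_ge n L) _; apply: ltnW.
apply: ltn_trans _ (c1_gt _ _); apply: ltn_trans _ (c2_gt _ _ _).2.
by apply: ltn_trans _ (c2_gt _ _ _).1; apply: (c2_gt _ _ _).1.
Qed.

Lemma rec1_binds r c : rec1 (fun n => godel (binds r (n + c) (gen n))).
Proof.
elim: r c => [|x r IH] c; first exact: rec1_gen.
apply: (@rec_env_eq 1 (fun e => c1 7 (c2 3 (c2 1 0 (x + (e 0 + c)).+1)
   (godel (binds r (e 0 + c.+1) (gen (e 0))))))).
  by move=> e _; rewrite (addnS (e 0) c) /binds -/binds !godelE.
by recur; apply: IH.
Qed.

Lemma rec1_inst L : rec1 (fun n => godel (inst n L)).
Proof.
apply: (@rec_env_eq 1 (fun e => nat_rect (fun _ => nat)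
   (godel (binds (rev L) (e 0 + 2) (gen (e 0))))
   (fun c acc => c1 7 (c2 3 (c2 1 0 1) acc)) (e 0).+1)).
  move=> e _; rewrite /inst addn2.
  move: (binds _ _ _) => g.
  by elim: (e 0).+1 => // n IH; rewrite /dums iterS -/(dums n _) /dum !godelE -IH.
apply: (@rec_env_prim 1 _ (fun c acc e => c1 7 (c2 3 (c2 1 0 1) acc)) (fun e => (e 0).+1)).
- exact: rec1_binds.
- by recur.
- by recur.
Qed.

Lemma rec1_typA L L' k : rec1 (fun n => godel (typA n L L' k)).
Proof.
apply: (@rec_env_eq 1 (fun e => c2 5 (c1 7 (godel (inst (e 0) L)))
  (c1 7 (c2 3 (c2 0 0 k.+1) (godel (inst (e 0) L')))))).
  by move=> e _; rewrite /typA !godelE.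
by recur; apply: rec1_inst.
Qed.

Lemma rec1_typB L L' k : rec1 (fun n => godel (typB n L L' k)).
Proof.
apply: (@rec_env_eq 1 (fun e => c1 6 (c2 5 (c2 0 0 k.+1)
  (c2 3 (c2 5 (godel (inst (e 0) L)) (godel (inst (e 0) L')))
        (c2 5 (godel (inst (e 0) L')) (godel (inst (e 0) L))))))).
  by move=> e _; rewrite /typB !godelE.
by recur; apply: rec1_inst.
Qed.

Lemma free_dums j n f : 0 < j -> free_below (j + n) f -> free_below j (dums n f).
Proof.
elim: n j => [|n IH] j Hj; first by rewrite addn0.
move=> Hf; rewrite /dums iterS -/(dums n f) /=; split; first by [].
by apply: IH => //; rewrite addSnnS.
Qed.

Lemma free_binds j r k f : all (fun x => x + k < j) r -> free_below (j + size r) f ->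
  free_below j (binds r k f).
Proof.
elim: r j k => [|x r IH] j k /=; first by rewrite addn0.
move=> /andP[Hx Hr] Hf; split; first by split=> //; lia.
apply: IH; last by rewrite addSnnS.
by apply: sub_all Hr => y Hy; rewrite addnS.
Qed.

Lemma free_inst n L B : all (fun x => x < B) L -> free_below B.+1 (inst n L).
Proof.
move=> HL; apply: free_dums => //; apply: free_binds.
  by rewrite all_rev; apply: sub_all HL => y Hy; lia.
by apply: free_below_le (gen_free n); lia.
Qed.

Lemma free_typA n L L' k B : all (fun x => x < B) L -> all (fun x => x < B) L' -> k < B ->
  free_below B (typA n L L' k).
Proof.
move=> HL HL' Hk /=; split; first exact: free_inst.
by split; [|exact: free_inst].
Qed.

Lemma free_typB n L L' k B : all (fun x => x < B) L -> all (fun x => x < B) L' -> k < B ->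
  free_below B (typB n L L' k).
Proof.
move=> HL HL' Hk /=; split; first by [].
by split; split; exact: free_inst.
Qed.

Section Sources.
Variables (M : Lstructure) (m : nat) (d : M) (src : nat -> nat + M).

Definition venv (a : m.-tuple M) : nat -> M := foldr (@scons M) (fun _ => d) a.
Definition penv i : M :=
  match src i with inr c => c | inl _ => d end.
(** The variables of the type occupy the first [m] places, and a parameter from source [i] is placed
    at [m + i]. *)
Definition pidx i := if src i is inl j then (if j < m then j else m + i) else m + i.

Lemma foldr_scons_tuple (e : nat -> M) (a : m.-tuple M) i :
  foldr (@scons M) e a i = if i < m then nth d a i else e (i - m).
Proof.
case: a => s /= /eqP <-.
elim: s i => [|x s IH] [|i] //=; by rewrite IH.
Qed.

Lemma pidxE (a : m.-tuple M) i : foldr (@scons M) penv a (pidx i) = tmv (src i) (venv a).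
Proof.
rewrite /venv foldr_scons_tuple /pidx.
case E : (src i) => [j|c]; last first.
  by rewrite /= ltnNge leq_addr /= addKn /penv E.
case Hj : (j < m); rewrite /= foldr_scons_tuple Hj //.
by rewrite ltnNge leq_addr /= addKn /penv E.
Qed.

Lemma pidx_lt i : pidx i < m + i.+1.
Proof. by rewrite /pidx; case: (src i) => [j|c]; [case: ifP|]; lia. Qed.

End Sources.

(** Saturation in semantic form: the entries of [S] are variables of the type or parameters, and
    satisfiability is checked only for initial segments of the enumeration. The formula for [P] is
    conjoined to every clause. *)
Lemma saturation_gen (M : Lstructure) m (d : M) (P : (nat -> M) -> Prop)
    (S : seq (nat + M)) (X : seq nat -> nat -> formula)
    (Q : nat -> seq M -> Prop) :
  recursively_saturated M -> Def FO true P ->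
  (forall L, rec1 (fun n => godel (X L n))) ->
  (forall L n, n <= godel (X L n)) ->
  (forall L n B, size L = size S -> all (fun x => x < B) L -> free_below B (X L n)) ->
  (forall L n (e : nat -> M), size L = size S -> (sat e (X L n) <-> Q n (map e L))) ->
  (forall K, exists a : m.-tuple M, P (venv d a) /\
     forall n, n < K -> Q n (map (fun s => tmv s (venv d a)) S)) ->
  exists a : m.-tuple M, P (venv d a) /\
     forall n, Q n (map (fun s => tmv s (venv d a)) S).
Proof.
move=> Hsat [f [ts [_ _ Hf]]] Hrec Hge Hfree HX Hfin.
pose src i := if i < size S then nth (inr d) S i else ts (i - size S).
pose L := map (pidx m src) (iota 0 (size S)).
pose th := rename (fun n => pidx m src (size S + n)) f.
pose F n := fAnd th (X L n).
have HL : size L = size S by rewrite size_map size_iota.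
have Eth (a : m.-tuple M) : sat (foldr (@scons M) (penv d src) a) th <-> P (venv d a).
  rewrite -Hf sat_rename.
  set e1 := (Y in sat Y f); set e2 := (Y in _ <-> sat Y f).
  suff -> : e1 = e2 by [].
  apply: functional_extensionality => n; rewrite /e1 /e2 pidxE /src.
  by rewrite ltnNge leq_addr /= addKn.
have EL (a : m.-tuple M) : map (foldr (@scons M) (penv d src) a) L =
    map (fun s => tmv s (venv d a)) S.
  apply: (@eq_from_nth _ d); rewrite !size_map size_iota // => i Hi.
  rewrite (nth_map 0) ?size_map ?size_iota // (nth_map 0) ?size_iota // nth_iota //.
  rewrite pidxE add0n (nth_map (inr d)) // /src Hi //.
have EF (a : m.-tuple M) n : sat (foldr (@scons M) (penv d src) a) (F n) <->
    P (venv d a) /\ Q n (map (fun s => tmv s (venv d a)) S).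
  by rewrite /= Eth HX // EL.
have [B0 HB0] := free_below_exists th.
have [|||K|a Ha] := @saturation M m (size S + B0) F (penv d src) Hsat.
- apply: (@rec_env_eq 1 (fun e => c2 3 (godel th) (godel (X L (e 0))))).
    by move=> e _; rewrite /F godelE.
  by recur; apply: Hrec.
- move=> n; apply: leq_trans (Hge L n) _.
  by rewrite /F godelE; have [_ /ltnW] := c2_gt 3 (godel th) (godel (X L n)).
- move=> n; split; first by apply: free_below_le HB0; lia.
  apply: Hfree => //; apply/allP => x /mapP [i]; rewrite mem_iota => Hi ->.
  by have := pidx_lt m src i; lia.
- have [a [HP HQ]] := Hfin K; exists a => n Hn; apply/EF; split=> //; exact: HQ.
- by exists a; split=> [|n]; [case: (proj1 (EF a 0) (Ha 0))|case: (proj1 (EF a n) (Ha n))].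
Qed.

Definition tmvs (M : Lstructure) (E : nat -> M) (S : seq (nat + M)) :=
  map (fun s => tmv s E) S.

Lemma saturationA (M : Lstructure) m (d : M) (P : (nat -> M) -> Prop)
    (S S' : seq (nat + M)) (k : nat + M) :
  recursively_saturated M -> Def FO true P ->
  let Q (E : nat -> M) n := (exists x, sat (envl (tmvs E S) x) (gen n)) ->
     exists x, x ∈ tmv k E /\ sat (envl (tmvs E S') x) (gen n) in
  (forall K, exists a : m.-tuple M, P (venv d a) /\ forall n, n < K -> Q (venv d a) n) ->
  exists a : m.-tuple M, P (venv d a) /\ forall n, Q (venv d a) n.
Proof.
move=> Hsat HP Q Hfin.
pose s := size S.
pose Q' n (l : seq M) := (exists x, sat (envl (take s (behead l)) x) (gen n)) ->
  exists x, x ∈ head d l /\ sat (envl (drop s (behead l)) x) (gen n).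
have EQ E n : Q' n (map (fun s => tmv s E) (k :: S ++ S')) <-> Q E n.
  by rewrite /Q' /= map_cat take_size_cat ?drop_size_cat ?size_map.
have [|||||a [Ha HaQ]] := @saturation_gen M m d P (k :: S ++ S')
  (fun L n => typA n (take s (behead L)) (drop s (behead L)) (head 0 L)) Q' Hsat HP.
- by move=> L; apply: rec1_typA.
- by move=> L n; apply: typA_ge.
- move=> [//|x L] n B /= _ /andP[Hx HL]; apply: free_typA => //.
    by apply/allP => y /mem_take Hy; apply: (allP HL).
  by apply/allP => y /mem_drop Hy; apply: (allP HL).
- by move=> [//|x L] n e _; rewrite sat_typA /Q' /= map_take map_drop.
- move=> K; have [a [Ha HaQ]] := Hfin K; exists a; split=> // n Hn.
  by apply/EQ; apply: HaQ.
- by exists a; split=> // n; apply/EQ.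
Qed.

Lemma saturationB (M : Lstructure) m (d : M) (P : (nat -> M) -> Prop)
    (S S' : seq (nat + M)) (k : nat + M) :
  recursively_saturated M -> Def FO true P ->
  let Q (E : nat -> M) n := forall x, x ∈ tmv k E ->
    (sat (envl (tmvs E S) x) (gen n) <-> sat (envl (tmvs E S') x) (gen n)) in
  (forall K, exists a : m.-tuple M, P (venv d a) /\ forall n, n < K -> Q (venv d a) n) ->
  exists a : m.-tuple M, P (venv d a) /\ forall n, Q (venv d a) n.
Proof.
move=> Hsat HP Q Hfin.
pose s := size S.
pose Q' n (l : seq M) := forall x, x ∈ head d l ->
  (sat (envl (take s (behead l)) x) (gen n) <-> sat (envl (drop s (behead l)) x) (gen n)).
have EQ E n : Q' n (map (fun s => tmv s E) (k :: S ++ S')) <-> Q E n.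
  by rewrite /Q' /= map_cat take_size_cat ?drop_size_cat ?size_map.
have [|||||a [Ha HaQ]] := @saturation_gen M m d P (k :: S ++ S')
  (fun L n => typB n (take s (behead L)) (drop s (behead L)) (head 0 L)) Q' Hsat HP.
- by move=> L; apply: rec1_typB.
- by move=> L n; apply: typB_ge.
- move=> [//|x L] n B /= _ /andP[Hx HL]; apply: free_typB => //.
    by apply/allP => y /mem_take Hy; apply: (allP HL).
  by apply/allP => y /mem_drop Hy; apply: (allP HL).
- by move=> [//|x L] n e _; rewrite sat_typB /Q' /= map_take map_drop.
- move=> K; have [a [Ha HaQ]] := Hfin K; exists a; split=> // n Hn.
  by apply/EQ; apply: HaQ.
- by exists a; split=> // n; apply/EQ.
Qed.

(** * Saturation for chains of every finite length *)

Section Chains.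
Variables (nu : formula).
Hypothesis nu_free : free_below 2 nu.

Definition chw g f := fEx (fAnd (fMem 0 g.+1) (fAnd nu f)).
(** The nested formula is built from the inside outwards. Link [i] lies under [n.-1 - i] other
    links, and by this amount the index of the set that holds the chain is shifted. *)
Definition chg g n j := nat_rect (fun _ => formula) (fEq 0 0)
  (fun i acc => chw (g + (n.-1 - i)) acc) j.
Definition typC g k n := fEx (fAnd (fEq 0 k.+1) (chg g.+1 n n)).

Fixpoint chain (M : Lstructure) (R : M -> M -> Prop) (G x : M) (j : nat) : Prop :=
  if j is j'.+1 then exists y, [/\ y ∈ G, R x y & chain R G y j'] else True.

Lemma sat_chg (M : Lstructure) (R : M -> M -> Prop) g n j (e : nat -> M) G :
  (forall e : nat -> M, sat e nu <-> R (e 1) (e 0)) ->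
  j <= n -> e (g + (n - j)) = G -> sat e (chg g n j) <-> chain R G (e 0) j.
Proof.
move=> Hnu; elim: j e => [|j IH] e Hj HG; first by split.
have E y : sat (scons y e) (chg g n j) <-> chain R G y j.
  apply: (IH (scons y e)); first exact: ltnW.
  by have -> : g + (n - j) = (g + (n - j.+1)).+1 by lia.
have -> : chg g n j.+1 = chw (g + (n.-1 - j)) (chg g n j) by [].
have HG' : e (g + (n.-1 - j)) = G by rewrite -HG; congr e; lia.
split.
- by move=> [y [Hy [/Hnu HR /E Hc]]]; exists y; split=> //; rewrite -HG'.
- move=> [y [Hy HR Hc]]; exists y; split; first by rewrite /= HG'.
  by split; [apply/Hnu|apply/E].
Qed.

Lemma free_chg g n j B : j <= n -> g < B -> free_below (B + (n - j)) (chg g n j).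
Proof.
elim: j => [|j IH] Hj HB; first by split; lia.
have -> : chg g n j.+1 = chw (g + (n.-1 - j)) (chg g n j) by [].
split; first by split; lia.
split; first by apply: free_below_le nu_free; lia.
by have := IH (ltnW Hj) HB; apply: free_below_le; lia.
Qed.

Lemma chg_ge g n j : j <= godel (chg g n j).
Proof.
elim: j => // j IH.
have -> : chg g n j.+1 = chw (g + (n.-1 - j)) (chg g n j) by [].
rewrite /chw !godelE; apply: leq_ltn_trans IH _.
apply: ltn_trans _ (c1_gt _ _); apply: ltn_trans _ (c2_gt _ _ _).2.
exact: (c2_gt _ _ _).2.
Qed.

Lemma rec1_typC g k : rec1 (fun n => godel (typC g k n)).
Proof.
apply: (@rec_env_eq 1 (fun e => c1 7 (c2 3 (c2 1 0 k.+1)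
  (nat_rect (fun _ => nat) (c2 1 0 0)
     (fun i acc => c1 7 (c2 3 (c2 0 0 (g.+1 + ((e 0).-1 - i)).+1) (c2 3 (godel nu) acc)))
     (e 0))))).
  move=> e _; rewrite /typC 3!godelE.
  suff -> : godel (chg g.+1 (e 0) (e 0)) = nat_rect (fun _ => nat) (c2 1 0 0)
     (fun i acc => c1 7 (c2 3 (c2 0 0 (g.+1 + ((e 0).-1 - i)).+1) (c2 3 (godel nu) acc)))
     (e 0) by [].
  have H j : godel (chg g.+1 (e 0) j) = nat_rect (fun _ => nat) (c2 1 0 0)
     (fun i acc => c1 7 (c2 3 (c2 0 0 (g.+1 + ((e 0).-1 - i)).+1) (c2 3 (godel nu) acc))) j.
    elim: j => [|j IH]; first by rewrite godelE.
    have -> : chg g.+1 (e 0) j.+1 = chw (g.+1 + ((e 0).-1 - j)) (chg g.+1 (e 0) j) by [].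
    by rewrite /chw !godelE IH.
  exact: H.
recur.
apply: (@rec_env_prim 1 _ (fun i acc e =>
  c1 7 (c2 3 (c2 0 0 (g.+1 + ((e 0).-1 - i)).+1) (c2 3 (godel nu) acc))) (fun e => e 0));
  by recur.
Qed.

Lemma saturationC (M : Lstructure) (R : M -> M -> Prop) (d : M) (P : (nat -> M) -> Prop)
    (k : M) :
  recursively_saturated M -> Def FO true P ->
  (forall e : nat -> M, sat e nu <-> R (e 1) (e 0)) ->
  (forall n, exists G, P (scons G (fun _ => d)) /\ forall i, i < n -> chain R G k i) ->
  exists G, P (scons G (fun _ => d)) /\ forall n, chain R G k n.
Proof.
move=> Hsat HP Hnu Hfin.
pose Q' n (l : seq M) := chain R (nth d l 0) (nth d l 1) n.
have [|||||a [Ha HaQ]] := @saturation_gen M 1 d P [:: inl 0; inr k]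
  (fun L n => typC (nth 0 L 0) (nth 0 L 1) n) Q' Hsat HP.
- by move=> L; apply: rec1_typC.
- move=> L n; rewrite /typC 3!godelE; apply: leq_trans (chg_ge (nth 0 L 0).+1 n n) _.
  by apply: ltnW; apply: ltn_trans _ (c1_gt _ _); apply: (c2_gt _ _ _).2.
- move=> [//|g [//|k' [|//]]] n B _ /= /and3P[Hg Hk _]; split; first by [].
  by have := @free_chg g.+1 n n B.+1 (leqnn _) Hg; rewrite subnn addn0.
- move=> [//|g [//|k' [|//]]] n e _; rewrite /Q' [map _ _]/= [nth _ _ 0]/= [nth _ _ 1]/=.
  have E x : sat (scons x e) (chg g.+1 n n) <-> chain R (e g) x n.
    by apply: (@sat_chg _ _ _ _ _ _ _ Hnu) => //; rewrite subnn addn0.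
  split; first by move=> [x [/= -> /E]].
  by move=> H; exists (e k'); split=> //; apply/E.
- by move=> n; have [G [HG Hc]] := Hfin n; exists [tuple G]; split=> // i Hi; apply: Hc.
- by case: a Ha HaQ => -[//|x [|//]] Hsz Ha HaQ; exists x.
Qed.

End Chains.

(** * Definability of the notions used in the back-and-forth *)

Lemma Def_FO Gam (M : Lstructure) b (P : (nat -> M) -> Prop) : Def Gam b P -> Def FO b P.
Proof. by move=> [f [ts [_ Hb Hs]]]; exists f, ts. Qed.

Lemma Def_FO_ex (M : Lstructure) b (Q : M -> (nat -> M) -> Prop) :
  Def FO b (fun e => Q (e 0) (fun n => e n.+1)) -> Def FO b (fun e => exists x, Q x e).
Proof.
move=> HQ; have [f [ts [_ Hb H]]] := Def_bound (isterm_var M b 0) HQ.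
exists (fEx f), ts; split=> // e /=; have [_ Hx] := H e.
by split=> -[x Hs]; exists x; apply/Hx.
Qed.

Section DefBF.
Variable M : Lstructure.
Context {HM : isMOST M}.
Implicit Types x y z u v w p q r s t k K : M.

Lemma Def_eq_Pw b (z x : (nat -> M) -> M) : isterm b z -> isterm b x ->
  Def Delta0P b (fun e => z e = Pw (x e)).
Proof.
move=> Hz Hx.
apply: (@Def_iff _ _ _ (fun e => (forall u, u ∈ z e -> subset_in u (x e)) /\
  forall u, subset_in u (x e) -> u ∈ z e)); last by ddef.
move=> e; split=> [[H1 H2]|->].
- by apply: ext => u; rewrite PwE; split; auto.
- by split=> u /PwE.
Qed.

(** Pairs of elements of [x] lie in [Pw (Pw x)], so sets of such pairs, in particular coded finite
    parts of types over [x], are elements of the third power set. *)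
Definition P3 x := Pw (Pw (Pw x)).

Lemma Pw_self x : x ∈ Pw x.
Proof. by apply/PwE. Qed.

Lemma Def_eq_P3 b (z x : (nat -> M) -> M) : isterm b z -> isterm b x ->
  Def Delta0P b (fun e => z e = P3 (x e)).
Proof.
move=> Hz Hx.
apply: (@Def_iff _ _ _ (fun e => exists p2, p2 ∈ z e /\ exists p1, p1 ∈ p2 /\
  ((p1 = Pw (x e) /\ p2 = Pw p1) /\ z e = Pw p2))).
  move=> e; split; first by move=> [p2 [_ [p1 [_ [[-> ->] ->]]]]].
  move=> ->; exists (Pw (Pw (x e))); split; first exact: Pw_self.
  by exists (Pw (x e)); split; [exact: Pw_self|].
by ddef; apply: Def_eq_Pw; dterm.
Qed.

Lemma Def_P3_mem b (z x : (nat -> M) -> M) : isterm b z -> isterm b x ->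
  Def Delta0P b (fun e => P3 (x e) ∈ z e).
Proof.
move=> Hz Hx.
apply: (@Def_iff _ _ _ (fun e => exists p, p ∈ z e /\ p = P3 (x e))).
  by move=> e; split=> [[p [H <-]] //|H]; exists (P3 (x e)).
by ddef; apply: Def_eq_P3; dterm.
Qed.

Lemma Def_strans b (x : (nat -> M) -> M) : isterm b x ->
  Def Delta0P b (fun e => strans (x e)).
Proof. by move=> Hx; rewrite /strans; ddef. Qed.

Lemma Def_coll_closed b (k p z : (nat -> M) -> M) :
  isterm b k -> isterm b p -> isterm b z ->
  Def Delta0P b (fun e => coll_closed (k e) (p e) (z e)).
Proof.
move=> Hk Hp Hz.
apply: (@Def_iff _ _ _ (fun e => forall E, subset_in E (p e) ->
  (forall s, subset_in s (k e) -> (exists q, q ∈ s /\ q = q) ->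
   exists q, q ∈ s /\ forall p, p ∈ s -> ~ opr p q ∈ E) ->
  exists g, g ∈ z e /\ (pcoll E (k e) g /\ forall q, q ∈ k e -> exists v, opr q v ∈ g))).
  move=> e; split=> H E HE Hwf; apply: H => // s Hs [q Hq]; apply: Hwf => //.
  + by case: Hq; exists q.
  + by exists q.
by ddef.
Qed.

Variable o : M.
Hypothesis o_empty : is_empty o.

(* Zermelo numerals *)
Definition num n : M := iter n (@sg M) o.

Lemma num_inj n m : num n = num m -> n = m.
Proof.
elim: n m => [|n IH] [|m] //= E.
- by case: (@o_empty (num m)); rewrite -[X in _ ∈ X]/(num 0) [num 0]E; apply/sgE.
- by case: (@o_empty (num n)); rewrite -[X in _ ∈ X]/(num 0) -[num 0]E; apply/sgE.
- by rewrite (IH m) //; apply: sg_inj.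
Qed.

Lemma Def_num Gam (GC : formula_class Gam) b n (z : (nat -> M) -> M) : isterm b z ->
  Def Gam b (fun e => z e = num n).
Proof.
elim: n z => [|n IH] z Hz.
  apply: (@Def_iff _ _ _ (fun e => forall u, u ∈ z e -> False)); last by ddef.
  move=> e; split=> [H|->]; last exact: o_empty.
  by apply: ext => u; split=> [/H|/o_empty].
apply: (@Def_iff _ _ _ (fun e => (exists u, u ∈ z e /\ u = num n) /\
   forall u, u ∈ z e -> u = num n)); last by ddef; apply: IH; dterm.
have -> : num n.+1 = sg (num n) by [].
move=> e; split=> [[[u [Hu Eu]] H]|->].
- by apply: ext => v; rewrite sgE; split=> [/H|->] //; rewrite -Eu.
- by split; [exists (num n); split=> //; apply/sgE|move=> u /sgE].
Qed.

Definition extend l (e : nat -> M) v x : nat -> M :=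
  fun i => if i < l then e i else if i == l then v else x.

Lemma envl_rcons (a : seq M) v x y : envl (rcons a v) x = extend (size a) (envl a y) v x.
Proof.
apply: functional_extensionality => i; rewrite /envl /extend nth_rcons.
by case: ifP => // Hi; apply: set_nth_default.
Qed.

Lemma Def_extend Gam (GC : formula_class Gam) b l (A : nat -> (nat -> M) -> M)
    (v x : (nat -> M) -> M) f : Gam f -> (forall i, isterm b (A i)) ->
  isterm b v -> isterm b x ->
  Def Gam b (fun e => sat (extend l (fun i => A i e) (v e) (x e)) f).
Proof.
move=> Hf HA Hv Hx; apply: Def_sat => // i; rewrite /extend.
by case: (i < l); [exact: HA|case: (i == l)].
Qed.

End DefBF.

Ltac ddef_atom ::= first
  [ apply: Def_pcoll; dterm
  | apply: Def_eq_upr; dterm | apply: Def_eq_opr; dterm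
  | apply: Def_opr_mem; dterm | apply: Def_trans; dterm
  | apply: Def_ex_opr0; dterm
  | apply: Def_eq_P3; dterm | apply: Def_P3_mem; dterm
  | apply: Def_eq_Pw; dterm | apply: Def_strans; dterm
  | apply: Def_coll_closed; dterm
  | apply: Def_ex_opr; [dterm|dterm|] | apply: Def_all_opr; [dterm|dterm|]
  | apply: Def_ex_opr2; [dterm|] | apply: Def_all_opr2; [dterm|] ].

(** * The back-and-forth steps *)

Section Steps.
Variable M : Lstructure.
Context {HM : isMOST M}.
Hypothesis collP : Collection M Delta0P.
Hypothesis Hsat : recursively_saturated M.
Implicit Types x y z u v w p q r s t k K : M.
Implicit Types a b c d : seq M.

(* Every Sigma1 property of a in the powerset language holds of a', with a witness in K. *)
Definition reflects a a' K := forall f, Delta0P f -> forall x, sat (envl a x) f ->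
  exists x', x' ∈ K /\ sat (envl a' x') f.

Definition indisc c d K := forall f, Delta0P f -> forall x, x ∈ K ->
  (sat (envl c x) f <-> sat (envl d x) f).

Lemma reflects_def a a' K P x : reflects a a' K -> Def Delta0P false P ->
  P (envl a x) -> exists x', x' ∈ K /\ P (envl a' x').
Proof.
move=> HA /Def_formula [f Hf E] HP.
have [|x' [Hx' Hs]] := HA f Hf x; first exact/E.
by exists x'; split=> //; apply/E.
Qed.

Lemma indisc_def c d K P x : indisc c d K -> Def Delta0P false P -> x ∈ K ->
  (P (envl c x) <-> P (envl d x)).
Proof. by move=> HB /Def_formula [f Hf E] Hx; rewrite -!E; apply: HB. Qed.

Lemma reflects_gen a a' K : reflects a a' K <-> forall n,
  (exists x, sat (envl a x) (gen n)) -> exists x, x ∈ K /\ sat (envl a' x) (gen n).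
Proof.
split=> [HA n [x Hx]|H f Hf x Hx]; first exact: (HA _ (gen_Delta0P n) x).
have [n Hn] := gen_surj Hf.
have [|x' [Hx' Hs]] := H n; first by exists x; apply/Hn.
by exists x'; split=> //; apply/Hn.
Qed.

Lemma indisc_gen c d K : indisc c d K <-> forall n x, x ∈ K ->
  (sat (envl c x) (gen n) <-> sat (envl d x) (gen n)).
Proof.
split=> [HB n|H f Hf]; first exact: (HB _ (gen_Delta0P n)).
by have [n Hn] := gen_surj Hf; move=> x Hx; rewrite -!Hn; apply: H.
Qed.

Lemma indisc_mono c d K K' : subset_in K' K -> indisc c d K -> indisc c d K'.
Proof. by move=> Hs HB f Hf x /Hs; apply: HB. Qed.

Lemma indisc_sym c d K : indisc c d K -> indisc d c K.
Proof. by move=> HB f Hf x Hx; rewrite (HB f Hf x Hx). Qed.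

Lemma tmvs_inr (E : nat -> M) a : tmvs E (map inr a) = a.
Proof. by rewrite /tmvs -map_comp map_id. Qed.

Lemma tmvs_rcons (E : nat -> M) S (s : nat + M) : tmvs E (rcons S s) = rcons (tmvs E S) (tmv s E).
Proof. exact: map_rcons. Qed.

Lemma collectP w (P : M -> M -> Prop) : Def Delta0P true (fun e => P (e 1) (e 0)) ->
  (forall x, x ∈ w -> exists y, P x y) ->
  exists z, forall x, x ∈ w -> exists y, y ∈ z /\ P x y.
Proof.
move=> HP Hex.
have [f [e0 [Hf Hs]]] := Def_params w HP.
pose r n := if odd n then n./2.+2 else if n is 0 then 0 else 1.
have E u v : sat (scons v (scons u e0)) (rename r f) <-> P u v.
  rewrite sat_rename -(Hs (scons v (fun _ => u))).
  set e1 := (X in sat X f); set e2 := (X in _ <-> sat X f).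
  suff -> : e1 = e2 by [].
  apply: functional_extensionality => n; rewrite /e1 /e2 /r.
  by case: n => [|[|n]] //=; case: ifP.
have [|z Hz] := collP (fc_rename r Hf) (e := e0) (w := w).
  by move=> x /Hex [y Hy]; exists y; apply/E.
exists z => x /Hz [y [Hy Hyc]]; exists y; split=> //; exact/E.
Qed.

Lemma witnesses a N : exists s, forall n, n < N ->
  (exists x, sat (envl a x) (gen n)) -> exists x, x ∈ s /\ sat (envl a x) (gen n).
Proof.
have H n : exists x : option M, (exists x, sat (envl a x) (gen n)) ->
    if x is Some x then sat (envl a x) (gen n) else False.
  case: (classic (exists x, sat (envl a x) (gen n))) => [[x Hx]|HN].
    by exists (Some x).
  by exists None.
pose w n := proj1_sig (constructive_indefinite_description _ (H n)).
have Hw n : (exists x, sat (envl a x) (gen n)) ->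
    if w n is Some x then sat (envl a x) (gen n) else False.
  by rewrite /w; case: constructive_indefinite_description.
have [o _] : exists o : M, is_empty o.
  by have [[_ [_ [H3 _]]] _ _] := (most_ax : MOST M).
have [s Hs] := fin_set (fun n => odflt o (w n)) N.
exists s => n Hn Hex; have := Hw n Hex; have := Hs n Hn.
by case: (w n) => //= x Hx Hsx; exists x.
Qed.

(** For finitely many formulas, [y] and the witnesses are bundled in one set [X], and the existence
    of a suitable element of [X] is reflected. The image of [X] is in the transitive set [K], hence
    so are the new witnesses; saturation handles all formulas together. *)
Lemma forward a a' K y : size a = size a' -> strans K -> reflects a a' K ->
  exists v, reflects (rcons a y) (rcons a' v) K.
Proof.
move=> Hsz HK HA.
have [N|av [_ Hav]] := @saturationA M 1 y (fun _ => True) (map inr (rcons a y))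
  (rcons (map inr a') (inl 0)) (inr K) Hsat (Def_const _ _ _); last first.
  exists (thead av); apply/reflects_gen => n; have := Hav n.
  rewrite tmvs_inr tmvs_rcons tmvs_inr /= /venv.
  by case: av {Hav} => -[//|v [|//]] Hs.
have [s Hs] := witnesses (rcons a y) N.
pose X := Cup s (sg y).
pose Ex n := exists x, sat (envl (rcons a y) x) (gen n).
pose P (e : nat -> M) := exists v, v ∈ e (size a) /\ forall n, n < N -> (Ex n ->
  exists x, x ∈ e (size a) /\ sat (extend (size a) e v x) (gen n)).
have HP : Def Delta0P false P.
  apply: Def_exin; first dterm; cbv beta; apply: Def_bigand => n _.
  apply: Def_imp; first exact: Def_const.
  apply: Def_exin; first dterm; cbv beta.
  apply: (@Def_extend M _ _ _ (size a) (fun i e => e i.+2) (fun e => e 1) (fun e => e 0)).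
  - exact: gen_Delta0P.
  - by move=> i; dterm.
  - by dterm.
  - by dterm.
have [|X' [HX' [v [Hv Hvn]]]] := @reflects_def a a' K P X HA HP.
  exists y; rewrite /envl nth_default //; split; first by apply/CupE; right; apply/sgE.
  move=> n Hn Hex; have [x [Hx Hsx]] := Hs n Hn Hex.
  by exists x; split; [apply/CupE; left|rewrite -envl_rcons].
exists [tuple v]; split=> // n Hn; rewrite tmvs_inr tmvs_rcons tmvs_inr => Hex.
have [x [Hx Hsx]] := Hvn n Hn Hex; exists x.
have EX : envl a' X' (size a) = X' by rewrite /envl nth_default // Hsz.
rewrite EX in Hx; split; first exact: HK.1 _ HX' _ Hx.
by rewrite (envl_rcons _ _ _ X') -Hsz.
Qed.

(** If no [v] worked for the formulas below [N], each [v] in the [i]-th entry of [a] would satisfy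
    one of them that fails for [w] over [K]. Delta_0^P-collection bounds the witnesses by a set, and
    the resulting statement reflects to [a'], where [w] contradicts it. *)
Lemma back a a' K i w : size a = size a' -> strans K -> reflects a a' K ->
  i < size a -> w ∈ nth w a' i ->
  exists v, v ∈ nth w a i /\ reflects (rcons a v) (rcons a' w) K.
Proof.
move=> Hsz HK HA Hi Hw.
have HPi : Def FO true (fun e : nat -> M => e 0 ∈ nth w a i) by ddef.
have [N|av [HPa Hav]] := @saturationA M 1 w (fun e => e 0 ∈ nth w a i)
  (rcons (map inr a) (inl 0)) (map inr (rcons a' w)) (inr K) Hsat HPi; last first.
  exists (thead av); move: HPa Hav; rewrite /venv.
  case: av => -[//|v [|//]] Hs /= Hv Hav; split=> //; apply/reflects_gen => n.
  by have := Hav n; rewrite tmvs_inr tmvs_rcons tmvs_inr.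
apply: NNPP => HN.
pose Bn n := ~ exists x, x ∈ K /\ sat (envl (rcons a' w) x) (gen n).
have Hex v : v ∈ nth w a i -> exists x, exists n, n < N /\
    (Bn n /\ sat (envl (rcons a v) x) (gen n)).
  move=> Hv; apply: NNPP => HNv; apply: HN; exists [tuple v]; split=> // n Hn.
  rewrite tmvs_inr tmvs_rcons tmvs_inr => -[x Hx].
  by apply: NNPP => HNx; apply: HNv; exists x, n.
have HQ : Def Delta0P true (fun e : nat -> M => exists n, n < N /\
    (Bn n /\ sat (envl (rcons a (e 1)) (e 0)) (gen n))).
  apply: Def_bigor => n _; apply: Def_and; first exact: Def_const.
  apply: (@Def_iff _ _ _ (fun e => sat (extend (size a) (fun i => (fun _ => nth w a i) e)
    (e 1) (e 0)) (gen n))).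
    by move=> e; rewrite (envl_rcons _ _ _ w).
  apply: Def_extend.
  - exact: gen_Delta0P.
  - by move=> j; dterm.
  - by dterm.
  - by dterm.
have [z Hz] := @collectP (nth w a i) (fun v x => exists n, n < N /\
    (Bn n /\ sat (envl (rcons a v) x) (gen n))) HQ Hex.
pose P (e : nat -> M) := forall v, v ∈ e i -> exists x, x ∈ e (size a) /\
  exists n, n < N /\ (Bn n /\ sat (extend (size a) e v x) (gen n)).
have HP : Def Delta0P false P.
  apply: Def_allin; first dterm; cbv beta; apply: Def_exin; first dterm; cbv beta.
  apply: Def_bigor => n _; apply: Def_and; first exact: Def_const.
  apply: (@Def_extend M _ _ _ (size a) (fun i e => e i.+2) (fun e => e 1) (fun e => e 0)).
  - exact: gen_Delta0P.
  - by move=> j; dterm.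
  - by dterm.
  - by dterm.
have [|z' [Hz' HPz]] := @reflects_def a a' K P z HA HP.
  move=> v Hv; rewrite /envl (set_nth_default w) // in Hv.
  have [x [Hx [n [Hn [HB Hs]]]]] := Hz v Hv; exists x; split.
    by rewrite /envl nth_default.
  by exists n; split=> //; split=> //; rewrite -envl_rcons.
have [|x [Hx [n [Hn [HB Hs]]]]] := HPz w.
  by rewrite /envl (set_nth_default w) // -Hsz.
apply: HB; exists x; split.
  by move: Hx; rewrite /envl nth_default ?Hsz // => Hx; apply: HK.1 _ Hz' _ Hx.
by rewrite (envl_rcons _ _ _ z') -Hsz.
Qed.

Lemma sat_small a a' K (th : M -> Prop) : Def FO true (fun e => th (e 0)) ->
  (forall N, exists k, [/\ strans k, P3 k ∈ K, th k & forall n, n < N ->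
     (exists x, sat (envl a x) (gen n)) -> exists x, x ∈ k /\ sat (envl a' x) (gen n)]) ->
  exists k, [/\ strans k, P3 k ∈ K, th k & reflects a a' k].
Proof.
move=> Hth Hfin.
have HP : Def FO true (fun e : nat -> M => (strans (e 0) /\ P3 (e 0) ∈ K) /\ th (e 0)).
  apply: Def_and => //; apply: (@Def_FO Delta0P).
  by apply: Def_and; [apply: Def_strans|apply: Def_P3_mem]; dterm.
have [N|av [HPa Hav]] := @saturationA M 1 K
  (fun e => (strans (e 0) /\ P3 (e 0) ∈ K) /\ th (e 0))
  (map inr a) (map inr a') (inl 0) Hsat HP.
  have [k [H1 H2 H3 H4]] := Hfin N; exists [tuple k]; split=> // n Hn.
  by rewrite !tmvs_inr; apply: H4.
case: av HPa Hav => -[//|k [|//]] Hs; rewrite /venv /= => -[[H1 H2] H3] Hav.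
exists k; split=> //; apply/reflects_gen => n.
by have := Hav n; rewrite !tmvs_inr.
Qed.

Lemma pre_small a N : exists k, strans k /\ forall n, n < N ->
  (exists x, sat (envl a x) (gen n)) -> exists x, x ∈ k /\ sat (envl a x) (gen n).
Proof.
have [s Hs] := witnesses a N; have [k [Hk Hsk]] := strans_exists s.
exists k; split=> // n Hn /(Hs n Hn) [x [Hx Hsx]]; exists x; split=> //.
exact: Hk.1 _ Hsk _ Hx.
Qed.

(** The properties of [k] pass to its image by reflection. Offering [P3 k] itself as the witness
    forces [P3 v] into [K]. *)
Lemma small_image a a' k v K N : size a = size a' ->
  reflects (rcons a k) (rcons a' v) K -> strans k ->
  (forall n, n < N -> (exists x, sat (envl a x) (gen n)) ->
    exists x, x ∈ k /\ sat (envl a x) (gen n)) ->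
  [/\ strans v, P3 v ∈ K & forall n, n < N -> (exists x, sat (envl a x) (gen n)) ->
    exists x, x ∈ v /\ sat (envl a' x) (gen n)].
Proof.
move=> Hsz HA Hk Hn.
have El x : envl (rcons a k) x (size a) = k.
  by rewrite /envl nth_rcons ltnn eqxx.
have El' x : envl (rcons a' v) x (size a) = v.
  by rewrite /envl nth_rcons Hsz ltnn eqxx.
have Ex x : envl (rcons a k) x (size a).+1 = x.
  by rewrite /envl nth_default // size_rcons.
have Ex' x : envl (rcons a' v) x (size a).+1 = x.
  by rewrite /envl nth_default // size_rcons Hsz.
have H1 : Def Delta0P false (fun e : nat -> M => strans (e (size a))).
  by apply: Def_strans; dterm.
have H2 : Def Delta0P false (fun e : nat -> M => e (size a).+1 = P3 (e (size a))).
  by apply: Def_eq_P3; dterm.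
have [|x1 [_]] := reflects_def (x := k) HA H1; first by rewrite El.
have [|x2 [Hx2]] := reflects_def (x := P3 k) HA H2; first by rewrite Ex El.
rewrite El' Ex' El' => E2 Hv; split=> //; first by rewrite -E2.
move=> n Hlt Hex.
pose P (e : nat -> M) := exists x, x ∈ e (size a) /\
  sat (extend (size a) e x x) (gen n).
have HP : Def Delta0P false P.
  apply: Def_exin; first dterm; cbv beta.
  apply: (@Def_extend M _ _ _ (size a) (fun i e => e i.+1) (fun e => e 0) (fun e => e 0)).
  - exact: gen_Delta0P.
  - by move=> j; dterm.
  - by dterm.
  - by dterm.
have Eenv b u x y : envl b x = extend (size b) (envl (rcons b u) y) x x.
  apply: functional_extensionality => i; rewrite /envl /extend nth_rcons.
  case: (ltnP i (size b)) => Hi; first exact: set_nth_default.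
  by rewrite nth_default //; case: ifP.
have [|x3 [_ [x [Hx Hs]]]] := reflects_def (x := k) HA HP.
  have [x [Hx Hs]] := Hn n Hlt Hex; exists x; split; first by rewrite El.
  by rewrite -(Eenv a k x k).
rewrite El' in Hx; exists x; split=> //.
by rewrite (Eenv a' v x x3) -Hsz.
Qed.

Lemma shrink a a' K : size a = size a' -> strans K -> reflects a a' K ->
  exists k, [/\ strans k, P3 k ∈ K & reflects a a' k].
Proof.
move=> Hsz HK HA.
have [N|k [H1 H2 _ H4]] := @sat_small a a' K (fun _ => True) (Def_const _ _ _).
  have [k [Hk Hn]] := pre_small a N; have [v Hv] := forward k Hsz HK HA.
  by have [H1 H2 H3] := small_image Hsz Hv Hk Hn; exists v.
by exists k.
Qed.

Variable o : M.
Hypothesis o_empty : is_empty o.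

(** The numeral is the only solution of its defining formula, so a solution in [K] must be the
    numeral itself. *)
Lemma num_mem a a' K n : size a = size a' -> reflects a a' K -> num o n ∈ K.
Proof.
move=> Hsz HA.
have HP : Def Delta0P false (fun e : nat -> M => e (size a) = num o n).
  by apply: Def_num => //; dterm.
have [|x [Hx]] := reflects_def (x := num o n) HA HP.
  by rewrite /envl nth_default.
by rewrite /envl nth_default ?Hsz // => <-.
Qed.

(* [tset c N K v] codes the set of pairs (n, x) with n < N and x in K such
   that [gen n] holds of (c, v, x), together with its complement. *)
Definition tpred c N K v w := exists n, n < N /\ exists x, x ∈ K /\
  ((w = opr (num o n.*2) x /\ sat (envl (rcons c v) x) (gen n)) \/
   (w = opr (num o n.*2.+1) x /\ ~ sat (envl (rcons c v) x) (gen n))).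

Definition tset c N K v := sep (Pw (Pw K)) (tpred c N K v).

Lemma Def_tpred c N K (v w : (nat -> M) -> M) : isterm true v -> isterm true w ->
  Def Delta0P true (fun e => tpred c N K (v e) (w e)).
Proof.
move=> Hv Hw; apply: Def_bigor => n _; apply: Def_exin; first dterm; cbv beta.
have Hs : Def Delta0P true (fun e : nat -> M =>
    sat (envl (rcons c (v (fun n => e n.+1))) (e 0)) (gen n)).
  apply: (@Def_iff _ _ _ (fun e => sat (extend (size c) (fun i => (fun _ => nth K c i) e)
    (v (fun n => e n.+1)) (e 0)) (gen n))).
    by move=> e; rewrite (envl_rcons _ _ _ K).
  apply: Def_extend.
  - exact: gen_Delta0P.
  - by move=> j; dterm.
  - by dterm.
  - by dterm.
by apply: Def_or; apply: Def_and => //; try apply: Def_not => //; apply: Def_eq_opr; dterm.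
Qed.

Lemma tsetE c N K v w : w ∈ tset c N K v <-> w ∈ Pw (Pw K) /\ tpred c N K v w.
Proof. by apply: sepPE; apply: Def_tpred; dterm. Qed.

Lemma tset_sat c N K v n x : (forall n, num o n ∈ K) -> n < N -> x ∈ K ->
  (opr (num o n.*2) x ∈ tset c N K v <-> sat (envl (rcons c v) x) (gen n)) /\
  (opr (num o n.*2.+1) x ∈ tset c N K v <-> ~ sat (envl (rcons c v) x) (gen n)).
Proof.
move=> Hnum Hn Hx.
have HPP i : opr (num o i) x ∈ Pw (Pw K).
  by apply/PwE => u /uprE Hu; apply/PwE => u'; case: Hu => -> /uprE [] ->.
rewrite !tsetE; split; split.
- move=> [_ [m [_ [x' [_ [[/opr_inj [/(num_inj o_empty) E ->]]|[/opr_inj [/(num_inj o_empty) E]]]]]]]].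
  + by have -> : n = m by lia.
  + by lia.
- by move=> Hs; split=> //; exists n; split=> //; exists x; split=> //; left.
- move=> [_ [m [_ [x' [_ [[/opr_inj [/(num_inj o_empty) E]]|[/opr_inj [/(num_inj o_empty) E ->]]]]]]]].
  + by lia.
  + by have -> : n = m by lia.
- by move=> Hs; split=> //; exists n; split=> //; exists x; split=> //; right.
Qed.

Lemma tset_P3 c N K v : tset c N K v ∈ P3 K.
Proof. by apply/PwE => w /tsetE []. Qed.

(** After shrinking to [K'], the part [T] of the type of [y] over [K'] given by [N] formulas is an
    element of [K]. That some member of the [i]-th entry realises [T] is a Delta_0^P statement about
    [T], so it passes from [c] to [d]. Since [T] records failures as well, the two finite types
    agree, and saturation gives agreement for all formulas. *)
Lemma extend_auto a a' c d K i y : size a = size a' -> size c = size d ->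
  strans K -> reflects a a' K -> indisc c d K -> i < size c ->
  y ∈ nth y c i -> exists v K', [/\ strans K', subset_in K' K, reflects a a' K',
    v ∈ nth y d i & indisc (rcons c y) (rcons d v) K'].
Proof.
move=> Hsz Hszc HK HA HB Hi Hy.
have [K' [HK' HP3 HA']] := shrink Hsz HK HA.
have Hsub : subset_in K' K.
  have H2 : Pw (Pw K') ∈ K by apply: HK.1 _ HP3 _ (Pw_self _).
  have H1 : Pw K' ∈ K by apply: HK.1 _ H2 _ (Pw_self _).
  by apply: HK.1; apply: HK.1 _ H1 _ (Pw_self _).
have Hnum n : num o n ∈ K' := num_mem n Hsz HA'.
have HPi : Def FO true (fun e : nat -> M => e 0 ∈ nth y d i) by ddef.
have [N|av [HPa Hav]] := @saturationB M 1 y (fun e => e 0 ∈ nth y d i)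
  (map inr (rcons c y)) (rcons (map inr d) (inl 0)) (inr K') Hsat HPi; last first.
  case: av HPa Hav => -[//|v [|//]] Hs; rewrite /venv /= => Hv Hav.
  exists v, K'; split=> //; apply/indisc_gen => n.
  by have := Hav n; rewrite tmvs_inr tmvs_rcons tmvs_inr.
pose T := tset c N K' y.
have HT : T ∈ K by apply: HK.1 _ HP3 _ (tset_P3 _ _ _ _).
pose l := size c.
pose P (e : nat -> M) := exists v, v ∈ e i /\ forall n, n < N ->
  (forall p x, opr p x ∈ e l -> p = num o n.*2 -> sat (extend l e v x) (gen n)) /\
  (forall p x, opr p x ∈ e l -> p = num o n.*2.+1 -> ~ sat (extend l e v x) (gen n)).
have HP : Def Delta0P false P.
  apply: Def_exin; first dterm; cbv beta; apply: Def_bigand => n _.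
  have Hs : Def Delta0P false (fun e : nat -> M =>
      sat (extend l (fun i => e i.+3) (e 2) (e 0)) (gen n)).
    apply: (@Def_extend M _ _ _ l (fun i e => e i.+3) (fun e => e 2) (fun e => e 0)).
    - exact: gen_Delta0P.
    - by move=> j; dterm.
    - by dterm.
    - by dterm.
  apply: Def_and; apply: Def_all_opr2; try dterm; cbv beta; apply: Def_imp => //.
  - by apply: Def_num => //; dterm.
  - by apply: Def_num => //; dterm.
  - exact: Def_not.
have El b x : size b = l -> envl b x l = x by move=> E; rewrite /envl nth_default // E.
have Hmem p x : opr p x ∈ T -> x ∈ K'.
  move=> /tsetE [_ [n [_ [x' [Hx' H]]]]].
  by case: H => -[/opr_inj [_ ->]].
have : P (envl c T).
  exists y; split; first by rewrite /envl (set_nth_default y).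
  move=> n Hn; rewrite El //; split=> p x Hp E; subst p; have Hx := Hmem _ _ Hp;
    have [E1 E2] := tset_sat c y Hnum Hn Hx.
  - by rewrite -envl_rcons; apply/E1.
  - by rewrite -envl_rcons; apply/E2.
rewrite (indisc_def HB HP HT) => -[v [Hv Hvn]].
exists [tuple v]; split.
  by rewrite /venv /=; move: Hv; rewrite /envl (set_nth_default y) // -Hszc.
move=> n Hn x Hx; rewrite tmvs_inr tmvs_rcons tmvs_inr /venv /=.
have [E1 E2] := tset_sat c y Hnum Hn Hx.
have [H1 H2] := Hvn n Hn; rewrite El // in H1 H2.
rewrite (envl_rcons d v x T) -Hszc; split=> Hs.
- by apply: (H1 _ _ _ erefl); apply/E1.
- by apply: NNPP => HN; apply: (H2 (num o n.*2.+1) x) => //; apply/E2.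
Qed.

(** Only the converse of [h] has to be functional; it is a partial map of [p] onto [t], the form in
    which [pullback] is applied. *)
Definition injects h t p := (forall v, v ∈ t -> exists T, T ∈ p /\ opr v T ∈ h) /\
  forall v T, opr v T ∈ h -> (v ∈ t /\ T ∈ p) /\ forall v', v' ∈ t -> opr v' T ∈ h -> v' = v.

(** Sending [v] to [tset c N K v] cannot inject [t] into [P3 K]. So for every [N] two elements agree
    on [N] formulas, and saturation finds two that agree on all. *)
Lemma same_type c K t : (forall n, num o n ∈ K) -> ~ (exists h, injects h t (P3 K)) ->
  exists v1 v2, [/\ v1 ∈ t, v2 ∈ t, ~ v1 = v2 & indisc (rcons c v1) (rcons c v2) K].
Proof.
move=> Hnum Hinj.
have HP : Def FO true (fun e : nat -> M => (e 0 ∈ t /\ e 1 ∈ t) /\ ~ e 0 = e 1) by ddef.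
have [N|av [HPa Hav]] := @saturationB M 2 K
  (fun e => (e 0 ∈ t /\ e 1 ∈ t) /\ ~ e 0 = e 1)
  (rcons (map inr c) (inl 0)) (rcons (map inr c) (inl 1)) (inr K) Hsat HP; last first.
  case: av HPa Hav => -[//|v1 [//|v2 [|//]]] Hs; rewrite /venv /= => -[[H1 H2] H3] Hav.
  exists v1, v2; split=> //; apply/indisc_gen => n.
  by have := Hav n; rewrite !tmvs_rcons !tmvs_inr.
apply: NNPP => HN; apply: Hinj.
pose R z := exists v, v ∈ t /\ exists T, T ∈ P3 K /\ (z = opr v T /\
  forall w, w ∈ Pw (Pw K) -> (w ∈ T <-> tpred c N K v w)).
have HR : Def Delta0P true (fun e => R (e 0)).
  rewrite /R; ddef; apply: Def_tpred; dterm.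
exists (sep (prod t (P3 K)) R).
have hE v T : opr v T ∈ sep (prod t (P3 K)) R <-> v ∈ t /\ T = tset c N K v.
  rewrite sepPE // opr_prod; split.
  - move=> [[Hv HT] [v' [Hv' [T' [HT' [/opr_inj [E1 E2] H]]]]]]; subst v' T'.
    split=> //; apply: ext => w; rewrite tsetE; split.
      by move=> Hw; have HwP : w ∈ Pw (Pw K) by [move/PwE: HT; apply]; split=> //; apply/H.
    by move=> [HwP Hw]; apply/H.
  - move=> [Hv ->]; split; first by split=> //; exact: tset_P3.
    exists v; split=> //; exists (tset c N K v); split; first exact: tset_P3.
    by split=> // w Hw; rewrite tsetE; split=> [[]|].
split.
- move=> v Hv; exists (tset c N K v); split; first exact: tset_P3.
  exact/hE.
- move=> v T /hE [Hv ET]; split; first by split=> //; rewrite ET; exact: tset_P3.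
  move=> v' Hv' /hE [_ ET']; apply: NNPP => Hne; apply: HN.
  exists [tuple v'; v]; split=> // n Hn x Hx; rewrite !tmvs_rcons !tmvs_inr /venv /=.
  have [E1 _] := tset_sat c v' Hnum Hn Hx; have [E2 _] := tset_sat c v Hnum Hn Hx.
  by rewrite -E1 -E2 -ET -ET'.
Qed.

Lemma Def_injects (h t p : (nat -> M) -> M) (b : bool) : isterm b h -> isterm b t -> isterm b p ->
  Def Delta0P b (fun e => injects (h e) (t e) (p e)).
Proof. by move=> Hh Ht Hp; rewrite /injects; ddef. Qed.

(** If no small [k] resists an injection, then by saturation some finite [N] already forces
    injections. For a [k] chosen on the side of [a], let [k'] be its image: [t] injects into
    [P3 k'], so it is covered by a collapse of a relation there. The image [z'] of a collapse-closed
    set contains this collapse, and [y] lies below [z']. *)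
Lemma decide a a' K t y : size a = size a' -> strans K -> reflects a a' K ->
  transitive_in t -> y ∈ t ->
  (exists k, [/\ strans k, P3 k ∈ K, reflects a a' k & ~ exists h, injects h t (P3 k)]) \/
  (exists b b', [/\ size b = size b', reflects (a ++ b) (a' ++ b') K & List.In y b']).
Proof.
move=> Hsz HK HA Ht Hy.
pose th k := ~ exists h, injects h t (P3 k).
have Hth : Def FO true (fun e => th (e 0)).
  apply: Def_not; apply: (@Def_iff _ _ _ (fun e : nat -> M =>
    exists p, p = P3 (e 0) /\ exists h, injects h t p)).
    by move=> e; split=> [[p [-> //]]|H]; exists (P3 (e 0)).
  apply: Def_FO_ex; cbv beta; apply: Def_and.
    by apply: (@Def_FO Delta0P); apply: Def_eq_P3; dterm.
  apply: Def_FO_ex; cbv beta; apply: (@Def_FO Delta0P).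
  by apply: Def_injects; dterm.
case: (classic (exists k, [/\ strans k, P3 k ∈ K, th k & reflects a a' k])).
  by move=> [k [H1 H2 H3 H4]]; left; exists k.
move=> Hno; right.
have [N HN] : exists N, forall k, strans k -> P3 k ∈ K -> (forall n, n < N ->
     (exists x, sat (envl a x) (gen n)) -> exists x, x ∈ k /\ sat (envl a' x) (gen n)) ->
     exists h, injects h t (P3 k).
  apply: NNPP => HN; apply: Hno; apply: sat_small => // N.
  apply: NNPP => Hk; apply: HN; exists N => k H1 H2 H3; apply: NNPP => H4; apply: Hk.
  by exists k.
have [k [Hk Hkn]] := pre_small a N.
have [z Hz] := coll_closed_exists (P3 k) (Pw (Pw (P3 k))).
have [k' HA1] := forward k Hsz HK HA.
have Hsz1 : size (rcons a k) = size (rcons a' k') by rewrite !size_rcons Hsz.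
have [z' HA2] := forward z Hsz1 HK HA1.
have Hsz2 : size (rcons (rcons a k) z) = size (rcons (rcons a' k') z').
  by rewrite !size_rcons Hsz.
have [H1 H2 H3] := small_image Hsz HA1 Hk Hkn.
have [h [Hh1 Hh2]] := HN k' H1 H2 H3.
pose l := size a.
have [Ek Ez] : (forall x, envl (rcons (rcons a k) z) x l = k) /\
    (forall x, envl (rcons (rcons a k) z) x l.+1 = z).
  split=> x; rewrite /envl !nth_rcons !size_rcons; first by rewrite leqnn ltnn eqxx.
  by rewrite ltnn eqxx.
have [Ek' Ez'] : (forall x, envl (rcons (rcons a' k') z') x l = k') /\
    (forall x, envl (rcons (rcons a' k') z') x l.+1 = z').
  rewrite /l Hsz; split=> x; rewrite /envl !nth_rcons !size_rcons.
    by rewrite leqnn ltnn eqxx.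
  by rewrite ltnn eqxx.
have Hz' : coll_closed (P3 k') (Pw (Pw (P3 k'))) z'.
  pose P (e : nat -> M) := exists k1, k1 ∈ e l.+2 /\ exists p1, p1 ∈ e l.+2 /\
    exists p2, p2 ∈ e l.+2 /\ (((k1 = P3 (e l) /\ p1 = Pw k1) /\ p2 = Pw p1) /\
    coll_closed k1 p2 (e l.+1)).
  have HP : Def Delta0P false P by rewrite /P; ddef.
  have Ex x : envl (rcons (rcons a k) z) x l.+2 = x.
    by rewrite /envl nth_default // !size_rcons.
  (* The witness collects [P3 k] and its next two power sets, which bounds the quantifiers of
     [P]. *)
  have [|x [_]] := reflects_def (x := Cup (upr (P3 k) (Pw (P3 k))) (sg (Pw (Pw (P3 k))))) HA2 HP.
    have HX : forall u, u ∈ Cup (upr (P3 k) (Pw (P3 k))) (sg (Pw (Pw (P3 k)))) <->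
      (u = P3 k \/ u = Pw (P3 k)) \/ u = Pw (Pw (P3 k)) by move=> u; rewrite CupE uprE sgE.
    exists (P3 k); rewrite Ex Ek Ez; split; first by apply/HX; auto.
    exists (Pw (P3 k)); split; first by apply/HX; auto.
    by exists (Pw (Pw (P3 k))); split; first by apply/HX; auto.
  rewrite /P Ek' Ez' => -[k1 [_ [p1 [_ [p2 [_ [[[E1 E2] E3] H]]]]]]].
  by rewrite -E1 -E2 -E3.
pose R w := exists v T, opr v T ∈ h /\ w = opr T v.
have HR : Def Delta0 true (fun e => R (e 0)) by rewrite /R; ddef.
pose F := sep (prod (P3 k') t) R.
have FE T v : opr T v ∈ F <-> opr v T ∈ h.
  rewrite sepE // opr_prod; split; first by move=> [_ [v' [T' [H /opr_inj [-> ->]]]]].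
  by move=> H; split; [case: (Hh2 _ _ H) => -[]|exists v, T].
have HF : onto_trans (P3 k') F t.
  split=> //.
  - split; first by move=> T v /FE /Hh2 [[]].
    by move=> T v v' /FE Hv /FE Hv'; apply: (proj2 (Hh2 _ _ Hv')) => //; case: (Hh2 _ _ Hv) => -[].
  - by move=> v /Hh1 [T [_ HT]]; exists T; apply/FE.
have HFp : partial_map (P3 k') F t by case: HF.
have [|g [Hg Hgc]] := Hz' (pullback (P3 k') F) _ (pullback_wf HFp).
  move=> e; rewrite /pullback sepE; last by ddef.
  move=> [/prodE [p [Hp [q [Hq ->]]]] _].
  apply/PwE => u /uprE Hu; apply/PwE => v.
  by case: Hu => -> /uprE [] ->.
have [T [_ HT]] := Hh1 y Hy.
have Hyg : opr T y ∈ g by apply: (pullback_coll HF Hgc); apply/FE.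
have [u [Hu [_ Hyu]]] := opr_parts T y.
have step b b' w w' : size b = size b' -> reflects b b' K -> List.In w b' -> w' ∈ w ->
    exists v, reflects (rcons b v) (rcons b' w') K.
  move=> Hszb HAb /(In_nth w') [i [Hi Ei]] Hw'.
  have Hib : i < size b by rewrite Hszb.
  have Hwi : w' ∈ nth w' b' i by rewrite Ei.
  by have [v [_ HAv]] := back Hszb HK HAb Hib Hwi; exists v.
have InL b w : List.In w (rcons b w) by elim: b => [|x b IH] /=; auto.
(* Four membership steps lead from [z'] down to [y]; [back] supplies a preimage for each. *)
have [v1 HA3] := step _ _ _ _ Hsz2 HA2 (InL _ _) Hg.
have [|v2 HA4] := step _ _ _ _ _ HA3 (InL _ _) Hyg; first by rewrite !size_rcons Hsz.
have [|v3 HA5] := step _ _ _ _ _ HA4 (InL _ _) Hu; first by rewrite !size_rcons Hsz.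
have [|v4 HA6] := step _ _ _ _ _ HA5 (InL _ _) Hyu; first by rewrite !size_rcons Hsz.
exists [:: k; z; v1; v2; v3; v4], [:: k'; z'; g; opr T y; u; y]; split=> //.
- by move: HA6; rewrite -!cats1 -!catA.
- by rewrite /=; auto 7.
Qed.

End Steps.

(** * The ambient model: the standard part of a coded chain *)

Lemma free_below_rename f k j r : (forall i, i < k -> r i < j) ->
  free_below k f -> free_below j (rename r f).
Proof.
elim: f k j r => /= [x y|x y|f IH|f IHf g IHg|f IHf g IHg|f IHf g IHg|f IH|f IH] k j r Hr.
- by move=> [? ?]; split; apply: Hr.
- by move=> [? ?]; split; apply: Hr.
- exact: IH.
- by move=> [? ?]; split; [apply: IHf Hr _|apply: IHg Hr _].
- by move=> [? ?]; split; [apply: IHf Hr _|apply: IHg Hr _].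
- by move=> [? ?]; split; [apply: IHf Hr _|apply: IHg Hr _].
- by apply: IH => -[|i] //= Hi; apply: Hr.
- by apply: IH => -[|i] //= Hi; apply: Hr.
Qed.

Section Chain.
Variable M : Lstructure.
Context {HM : isMOST M}.
Hypothesis Hsat : recursively_saturated M.
Implicit Types x y z u v w p q r s t k K : M.

(** The distance kept between consecutive terms: power sets of [x] and a collapse-closed set for [x]
    lie in [y]. This makes the union of the standard terms closed under power sets and transitive
    images. *)
Definition far x y := [/\ strans y, P3 x ∈ y &
  exists z, z ∈ y /\ coll_closed x (Pw (Pw x)) z].

Lemma far_exists x : exists y, far x y.
Proof.
have [z Hz] := coll_closed_exists x (Pw (Pw x)).
have [y [Hy Hzy]] := strans_exists (upr (P3 x) z).
exists y; split=> //.
- by apply: Hy.1 _ Hzy _ _; apply/uprE; left.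
- by exists z; split=> //; apply: Hy.1 _ Hzy _ _; apply/uprE; right.
Qed.

Lemma far_levels x y : far x y -> [/\ x ∈ y, Pw x ∈ y & Pw (Pw x) ∈ y].
Proof.
move=> [Hy H3 _].
have H2 : Pw (Pw x) ∈ y by apply: Hy.1 _ H3 _ (Pw_self _).
have H1 : Pw x ∈ y by apply: Hy.1 _ H2 _ (Pw_self _).
by split=> //; apply: Hy.1 _ H1 _ (Pw_self _).
Qed.

Lemma Def_far (b : bool) (x y : (nat -> M) -> M) : isterm b x -> isterm b y ->
  Def Delta0P b (fun e => far (x e) (y e)).
Proof.
move=> Hx Hy.
apply: (@Def_iff _ _ _ (fun e => (strans (y e) /\ P3 (x e) ∈ y e) /\
  exists p1, p1 ∈ y e /\ exists p2, p2 ∈ y e /\ ((p1 = Pw (x e) /\ p2 = Pw p1) /\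
  exists z, z ∈ y e /\ coll_closed (x e) p2 z))); last by ddef.
move=> e; split.
- by move=> [[H1 H2] [p1 [_ [p2 [_ [[E1 E2] H]]]]]]; split=> //; rewrite -E1 -E2.
- move=> Hf; have [_ HP1 HP2] := far_levels Hf; case: Hf => H1 H2 H3; split=> //.
  by exists (Pw (x e)); split=> //; exists (Pw (Pw (x e))).
Qed.

Lemma far_formula : exists2 nu, free_below 2 nu &
  forall e : nat -> M, sat e nu <-> far (e 1) (e 0).
Proof.
have [f _ Hf] : exists2 f, Delta0P f & forall e : nat -> M, sat e f <-> far (e 1) (e 0).
  by apply: Def_formula; apply: Def_far; dterm.
have [k Hk] := free_below_exists f.
exists (rename (fun n => if n < 2 then n else 0) f).
  by apply: free_below_rename Hk => i _; case: ifP.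
by move=> e; rewrite sat_rename Hf.
Qed.

Variable K0 : M.

(** A Delta_0^P description that fits chains of any length and needs no index set. The last term
    guarantees a term beyond the standard part. *)
Definition coded_chain G := ((forall x, x ∈ G -> strans x) /\
  (forall x, x ∈ G -> forall y, y ∈ G -> x ∈ y \/ (x = y \/ y ∈ x))) /\
  ((forall y, y ∈ G -> (far K0 y /\ forall x, x ∈ G -> ~ x ∈ y) \/
     exists x, x ∈ G /\ (far x y /\ forall x', x' ∈ G -> x' ∈ y -> x' = x \/ x' ∈ x)) /\
   exists m, m ∈ G /\ forall x, x ∈ G -> x = m \/ x ∈ m).

Lemma Def_coded_chain : Def Delta0P true (fun e : nat -> M => coded_chain (e 0)).
Proof. by rewrite /coded_chain; ddef; apply: Def_far; dterm. Qed.

Lemma finite_chain n : exists G, coded_chain G /\ forall i, i < n -> chain far G K0 i.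
Proof.
pose nx x := proj1_sig (constructive_indefinite_description _ (far_exists x)).
have Hnx x : far x (nx x) by rewrite /nx; case: constructive_indefinite_description.
pose s i := iter i.+1 nx K0.
have Hs0 : far K0 (s 0) by apply: Hnx.
have Hs i : far (s i) (s i.+1) by apply: Hnx.
have Hst i : strans (s i) by case: i => [|i]; [case: Hs0|case: (Hs i)].
have Hlt i j : i < j -> s i ∈ s j.
  elim: j => // j IH; rewrite ltnS leq_eqVlt => /orP[/eqP ->|/IH Hij].
    by case: (far_levels (Hs j)).
  by case: (far_levels (Hs j)) => Hj _ _; apply: (Hst j.+1).1 _ Hj _ Hij.
have Hlt' i j : s i ∈ s j -> i < j.
  move=> H; case: (ltngtP i j) => // [/Hlt /mem_asym H'|E]; first by case: H'.
  by subst j; case: (mem_irrefl H).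
have [G HG] : exists G, forall z, z ∈ G <-> exists i, i < n.+1 /\ z = s i.
  elim: n.+1 => [|m [G HG]].
    have [[_ [_ [[o Ho] _]]] _ _] := (most_ax : MOST M).
    by exists o => z; split=> [/Ho|[i []]].
  exists (Cup G (sg (s m))) => z; rewrite CupE HG sgE; split.
  + move=> [[i [Hi ->]]|->]; [exists i|exists m]; split=> //; lia.
  + move=> [i [Hi ->]]; case: (ltnP i m) => Him; first by left; exists i.
    by right; have -> : i = m by lia.
exists G; split.
- split; split.
  + by move=> x /HG [i [_ ->]].
  + move=> x /HG [i [_ ->]] y /HG [j [_ ->]].
    by case: (ltngtP i j) => [/Hlt|/Hlt|->]; auto.
  + move=> y /HG [[|i] [Hi ->]].
      by left; split=> // x /HG [j [_ ->]] /Hlt'.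
    right; exists (s i); split; first by apply/HG; exists i; split=> //; lia.
    split=> // x' /HG [j [_ ->]] /Hlt' Hj.
    case: (ltnP j i) => Hji; first by right; apply: Hlt.
    by left; have -> : j = i by lia.
  + exists (s n); split; first by apply/HG; exists n.
    move=> x /HG [i [Hi ->]]; case: (ltnP i n) => Hin; first by right; apply: Hlt.
    by left; have -> : i = n by lia.
- have H j i : i + j <= n -> chain far G (iter i nx K0) j.
    elim: j i => //= j IH i Hij; exists (s i); split.
    + by apply/HG; exists i; split=> //; lia.
    + exact: Hnx.
    + by apply: (IH i.+1); lia.
  by move=> i Hi; apply: (H i 0); lia.
Qed.

Lemma long_chain : exists G, coded_chain G /\ forall n, chain far G K0 n.
Proof.
have [nu Hnu HR] := far_formula.
apply: (@saturationC nu Hnu M far K0 (fun e => coded_chain (e 0)) K0 Hsat) => //.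
- by apply: (@Def_FO Delta0P); apply: Def_coded_chain.
- exact: finite_chain.
Qed.

Variable G : M.
Hypothesis chG : coded_chain G.
Hypothesis longG : forall n, chain far G K0 n.

Fixpoint lev n y : Prop := if n is m.+1 then
    y ∈ G /\ exists x, [/\ lev m x, far x y & forall x', x' ∈ G -> x' ∈ y -> x' = x \/ x' ∈ x]
  else [/\ y ∈ G, far K0 y & forall x, x ∈ G -> ~ x ∈ y].

Lemma lev_G n y : lev n y -> y ∈ G.
Proof. by case: n => [|n] []. Qed.

Lemma lev_below n y x : lev n y -> x ∈ G -> x ∈ y -> exists m, m < n /\ lev m x.
Proof.
elim: n y => [|n IH] y; first by move=> [_ _ H] /H.
move=> [_ [x1 [Hx1 _ H]]] Hx Hxy; case: (H x Hx Hxy) => [->|Hxx].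
- by exists n.
- by have [m [Hm Hl]] := IH _ Hx1 Hx Hxx; exists m; split=> //; lia.
Qed.

Lemma lev_level n m y : lev n y -> lev m y -> n = m.
Proof.
elim: n m y => [|n IH] [|m] y //.
- move=> [_ _ H] [_ [x [Hx Hf _]]]; case: (H x (lev_G Hx)).
  by case: (far_levels Hf).
- move=> [_ [x [Hx Hf _]]] [_ _ H]; case: (H x (lev_G Hx)).
  by case: (far_levels Hf).
- move=> [_ [x [Hx Hf H]]] [_ [x' [Hx' Hf' H']]].
  have [Hxy _ _] := far_levels Hf; have [Hxy' _ _] := far_levels Hf'.
  suff E : x = x' by subst x'; rewrite (IH m x).
  case: (H x' (lev_G Hx') Hxy') => [-> //|H1].
  case: (H' x (lev_G Hx) Hxy) => [-> //|H2]; by case: (mem_asym H1).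
Qed.

(** If the term at level [n] were last, all of [G] would lie on levels up to [n], which leaves no
    room for a chain of [n.+2] steps. *)
Lemma lev_exists n : exists y, lev n y.
Proof.
have [[G1 G2] [G3 G4]] := chG.
elim: n => [|n [x Hx]].
  have [m [Hm _]] := G4.
  have [|y [Hy Hmin]] := @found _ _ G; first by exists m.
  exists y; case: (G3 y Hy) => [[Hf H]|[x [Hx [Hf _]]]]; first by split.
  by case: (Hmin x) => //; case: (far_levels Hf).
have HxG := lev_G Hx.
have [y0 [Hy0 Hxy0]] : exists y, y ∈ G /\ x ∈ y.
  apply: NNPP => HN.
  have Hall z : z ∈ G -> exists i, i <= n /\ lev i z.
    move=> Hz; case: (G2 z Hz x HxG) => [H|[->|H]].
    - by have [m [Hm Hl]] := lev_below Hx Hz H; exists m; split=> //; lia.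
    - by exists n.
    - by case: HN; exists z.
  have Hch m i z : lev i z -> chain far G z m -> i + m <= n.
    elim: m i z => [|m IH] i z Hz /=.
      by move=> _; have [i' [Hi' /(lev_level Hz) ->]] := Hall z (lev_G Hz); lia.
    move=> [y [Hy Hf Hc]]; have [j [Hj Hl]] := Hall y Hy.
    have [Hzy _ _] := far_levels Hf.
    have [i' [Hi' /(lev_level Hz) E]] := lev_below Hl (lev_G Hz) Hzy.
    by have := IH j y Hl Hc; lia.
  have [y [Hy _ Hc]] := longG n.+2.
  have [j [Hj Hl]] := Hall y Hy; have := Hch n.+1 _ _ Hl Hc; lia.
have HP : Def Delta0 true (fun e : nat -> M => x ∈ e 0) by ddef.
have [|y [/(sepE _ _ HP) [Hy Hxy] Hmin]] := @found _ _ (sep G (fun y => x ∈ y)).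
  by exists y0; apply/sepE.
exists y; split=> //.
case: (G3 y Hy) => [[_ H]|[x1 [Hx1 [Hf H]]]]; first by case: (H x HxG).
suff E : x = x1 by exists x; subst x1.
case: (H x HxG Hxy) => [//|Hxx1].
case: (Hmin x1); first by case: (far_levels Hf).
exact/sepE.
Qed.

Definition N n : M := proj1_sig (constructive_indefinite_description _ (lev_exists n)).

Lemma levN n : lev n (N n).
Proof. by rewrite /N; case: constructive_indefinite_description. Qed.

Lemma lev_uniq n y : lev n y -> y = N n.
Proof.
move=> Hy; have HN := levN n; have [[_ G2] _] := chG.
case: (G2 _ (lev_G Hy) _ (lev_G HN)) => [H|[//|H]].
- by have [m [Hm /(lev_level Hy)]] := lev_below HN (lev_G Hy) H; lia.
- by have [m [Hm /(lev_level HN)]] := lev_below Hy (lev_G HN) H; lia.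
Qed.

Lemma N_far n : far (N n) (N n.+1).
Proof. by have [_ [x [/lev_uniq -> Hf _]]] := levN n.+1. Qed.

Lemma N0_far : far K0 (N 0).
Proof. by case: (levN 0). Qed.

Lemma N_strans n : strans (N n).
Proof. by have [[G1 _] _] := chG; apply: G1; apply: lev_G (levN n). Qed.

Lemma N_sub n m : n <= m -> subset_in (N n) (N m).
Proof.
elim: m => [|m IH]; first by rewrite leqn0 => /eqP ->.
rewrite leq_eqVlt => /orP[/eqP -> //|/IH Hs] x /Hs Hx.
by have [Hm _ _] := far_levels (N_far m); apply: (N_strans m.+1).1 _ Hm _ Hx.
Qed.

(** A definition of the next term from [G] and [N n]; it will force the automorphism to fix every
    [N n]. *)
Lemma N_next_uniq n y : y ∈ G ->
  (N n ∈ y /\ forall x, x ∈ G -> x ∈ y -> x = N n \/ x ∈ N n) <-> y = N n.+1.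
Proof.
move=> Hy; split; last first.
  move=> ->; split; first by case: (far_levels (N_far n)).
  by have [_ [x [/lev_uniq -> _ H]]] := levN n.+1.
move=> [H1 H2]; have HN := levN n.+1; have [[_ G2] _] := chG.
have [_ [x [/lev_uniq Ex _ H]]] := HN; subst x.
have [Hnn _ _] := far_levels (N_far n).
case: (G2 _ Hy _ (lev_G HN)) => [Hyn|[//|Hny]].
- by case: (H y Hy Hyn) => [E|/mem_asym //]; case: (@mem_irrefl _ _ (N n)); rewrite -{2}E.
- by case: (H2 _ (lev_G HN) Hny) => [E|/mem_asym //];
    case: (@mem_irrefl _ _ (N n)); rewrite -{2}E.
Qed.

Lemma N0_uniq y : y ∈ G -> (forall x, x ∈ G -> ~ x ∈ y) <-> y = N 0.
Proof.
move=> Hy; have [HN _ Hl] := levN 0; split=> [H|-> //].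
by have [[_ G2] _] := chG; case: (G2 _ Hy _ HN) => [/(Hl _ Hy)|[//|/(H _ HN)]].
Qed.

Definition std x := exists n, x ∈ N n.

Lemma std_N n : std (N n).
Proof. by exists n.+1; case: (far_levels (N_far n)). Qed.

Lemma std_sub n x : subset_in x (N n) -> std x.
Proof.
move=> Hx; exists n.+1; have [_ HP _] := far_levels (N_far n).
by apply: (N_strans n.+1).1 _ HP _ _; apply/PwE.
Qed.

Lemma std_G y : y ∈ G -> std y -> exists n, y = N n.
Proof.
move=> Hy [n Hn]; have [m [_ Hl]] := lev_below (levN n) Hy Hn.
by exists m; apply: lev_uniq.
Qed.

(** Overspill: every nonstandard term of [G] bounds the witnesses. The least term with this property
    is standard, since a nonstandard term has a nonstandard predecessor. *)
Lemma std_coll (P : M -> M -> Prop) : Def Delta0 true (fun e => P (e 1) (e 0)) ->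
  forall w, std w -> (forall x, x ∈ w -> exists y, std y /\ P x y) ->
  exists c, std c /\ forall x, x ∈ w -> exists y, y ∈ c /\ P x y.
Proof.
move=> HP w Hw Hex; have [[G1 G2] [G3 [m [Hm Hmax]]]] := chG.
pose A k := forall x, x ∈ w -> exists y, y ∈ k /\ P x y.
have HA : Def Delta0 true (fun e => A (e 0)) by rewrite /A; ddef.
have big k : k ∈ G -> ~ std k -> A k.
  move=> Hk Hns x Hx; have [y [[n Hn] Pxy]] := Hex x Hx; exists y; split=> //.
  case: (G2 _ (lev_G (levN n)) _ Hk) => [HNk|[E|HkN]].
  - exact: (G1 _ Hk).1 _ HNk _ Hn.
  - by rewrite -E.
  - by case: Hns; exists n.
have Hnm : ~ std m.
  move=> /(std_G Hm) [n E]; subst m.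
  have [HN _ _] := far_levels (N_far n).
  case: (Hmax _ (lev_G (levN n.+1))) => [E|/mem_asym //].
  by case: (@mem_irrefl _ _ (N n)); rewrite -{2}E.
have [|k [/(sepE _ _ HA) [Hk Ak] Hmin]] := @found _ _ (sep G A).
  by exists m; apply/sepE => //; split=> //; apply: big.
exists k; split=> //; apply: NNPP => Hns.
case: (G3 k Hk) => [[_ /(N0_uniq Hk) E]|[x [Hx [Hf H]]]].
  by apply: Hns; rewrite E; apply: std_N.
have [Hxk _ _] := far_levels Hf.
apply: (Hmin x Hxk); apply/sepE => //; split=> //; apply: big => //.
move=> /(std_G Hx) [n E]; subst x; apply: Hns.
by have /(N_next_uniq n Hk) -> : N n ∈ k /\ forall x, x ∈ G -> x ∈ k -> x = N n \/ x ∈ N n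
  by []; apply: std_N.
Qed.

Lemma std_good X o : X ∈ K0 -> o ∈ X -> is_empty o ->
  (forall y, y ∈ X -> exists w, w ∈ X /\ is_succ w y) -> good std.
Proof.
move=> HX oX o_e X_s; split.
- by move=> x y [n Hn] Hx; exists n; apply: (N_strans n).1 _ Hn _ Hx.
- by move=> x y [n Hn] Hx; exists n; apply: (N_strans n).2 _ Hn _ Hx.
- move=> y [n Hn]; apply: (@std_sub n) => z /PwE Hz.
  exact: (N_strans n).2 _ Hn _ Hz.
- move=> x y [n Hn] [m Hm]; apply: (@std_sub (n + m)) => z /uprE [] ->.
    exact: N_sub (leq_addr m n) _ Hn.
  exact: N_sub (leq_addl n m) _ Hm.
- move=> x [n Hn]; apply: (@std_sub n) => z /UnE [w [Hw Hz]].
  by have Hwn := (N_strans n).1 _ Hn _ Hw; apply: (N_strans n).1 _ Hwn _ Hz.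
- move=> x [n Hn]; exists (N n); split=> //; first exact: std_N.
  by case: (N_strans n).
- move=> Q F t [n Hn] [Ht [H1 H2] H3].
  (* Seen as a partial map on [N n], [F] is recovered from a relation on [N n], and a collapse of
     that relation lies in the next term. *)
  have HF : onto_trans (N n) F t.
    split=> //; split=> // p u /H1 [Hp Hu]; split=> //.
    exact: (N_strans n).1 _ Hn _ Hp.
  have HFp : partial_map (N n) F t by case: HF.
  have [HS _ [z [Hz Hzc]]] := N_far n.
  have [|g [Hg Hgc]] := Hzc (pullback (N n) F) _ (pullback_wf HFp).
    move=> e; rewrite /pullback sepE; last by ddef.
    move=> [/prodE [p [Hp [q [Hq ->]]]] _].
    apply/PwE => u /uprE Hu; apply/PwE => v.
    by case: Hu => -> /uprE [] ->.
  apply: (@std_sub n.+1) => v Hv; have [p Hp] := H3 v Hv.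
  have Hpg : opr p v ∈ g by apply: pullback_coll HF Hgc _ _ Hp.
  have [u [Hu [_ Hvu]]] := opr_parts p v.
  have A1 := HS.1 _ Hz _ Hg; have A2 := HS.1 _ A1 _ Hpg; have A3 := HS.1 _ A2 _ Hu.
  exact: HS.1 _ A3 _ Hvu.
- exists X, o; split=> //; exists 0.
  have [H0 _ _] := far_levels N0_far; exact: (N_strans 0).1 _ H0 _ HX.
- have [C [HC HGC]] := strans_exists G; exists C; split=> // x [n Hn].
  have A1 := HC.1 _ HGC _ (lev_G (levN n)); exact: HC.1 _ A1 _ Hn.
- exact: std_coll.
Qed.

End Chain.

(** * The construction of the embedding and of the automorphism *)

Lemma In_zip (T : Type) (x y d : T) (a b : seq T) : size a = size b ->
  List.In (x, y) (zip a b) ->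
  exists i, [/\ i < size a, nth d a i = x & nth d b i = y].
Proof.
elim: a b => [|u a IH] [|v b] //= [Hs] [[-> ->]|/(IH b Hs) [i [H1 H2 H3]]].
  by exists 0.
by exists i.+1.
Qed.

Lemma In_zip_rcons (T : Type) (x y u v : T) (a b : seq T) : size a = size b ->
  List.In (x, y) (zip (rcons a u) (rcons b v)) <->
  List.In (x, y) (zip a b) \/ (x, y) = (u, v).
Proof.
elim: a b => [|u' a IH] [|v' b] //=; first by split=> [[->|]|[|->]]; auto.
by move=> [Hs]; rewrite IH //; tauto.
Qed.

Section Assembly.
Variable M : Lstructure.
Context {HM : isMOST M}.
Hypothesis collP : Collection M Delta0P.
Hypothesis Hsat : recursively_saturated M.
Implicit Types x y z u v w p q r t k K : M.
Implicit Types a b c d : seq M.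

Variables (o K0 G : M) (N : nat -> M) (tcf : M -> M) (g : M -> nat).
Hypothesis o_empty : is_empty o.
Hypothesis NG : forall n, N n ∈ G.
Hypothesis N0_def : forall y, y ∈ G -> (forall x, x ∈ G -> ~ x ∈ y) <-> y = N 0.
Hypothesis NS_def : forall n y, y ∈ G ->
  (N n ∈ y /\ forall x, x ∈ G -> x ∈ y -> x = N n \/ x ∈ N n) <-> y = N n.+1.
Hypothesis N_trans : forall n, transitive_in (N n).
Hypothesis K0_N : K0 ∈ N 0.
Hypothesis K0_strans : strans K0.
Hypothesis K0_refl : reflects [::] [::] K0.
Hypothesis g_inj : injective g.

Let D x := exists n, x ∈ N n.

Hypothesis tcf_ok : forall x, D x -> [/\ D (tcf x), transitive_in (tcf x) & x ∈ tcf x].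

(* [sa -> sa'] is the finite part of the embedding, [sc -> sd] that of the
   automorphism; the embedding will stay inside [sK], over which the automorphism
   preserves types, so that its image is fixed. *)
Record state := State { sa : seq M; sa' : seq M; sc : seq M; sd : seq M; sK : M }.

Definition inA s x y := List.In (x, y) (zip (sa s) (sa' s)).
Definition inC s x y := List.In (x, y) (zip (sc s) (sd s)).

Definition inv s := [/\ [/\ size (sa s) = size (sa' s), strans (sK s)
    & reflects (sa s) (sa' s) (sK s)],
  size (sc s) = size (sd s) /\ indisc (sc s) (sd s) (sK s), subset_in (sK s) K0,
  0 < size (sc s) & forall x, nth x (sc s) 0 = G /\ nth x (sd s) 0 = G].

Definition sle s s' := [/\ forall x y, inA s x y -> inA s' x y,
  forall x y, inC s x y -> inC s' x y & subset_in (sK s') (sK s)].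

Lemma sle_refl s : sle s s.
Proof. by split. Qed.

Lemma sle_trans s1 s2 s3 : sle s1 s2 -> sle s2 s3 -> sle s1 s3.
Proof.
move=> [H1 H2 H3] [H4 H5 H6]; split; auto.
by move=> x /H6 /H3.
Qed.

Lemma step_A s b b' : inv s -> size b = size b' ->
  reflects (sa s ++ b) (sa' s ++ b') (sK s) ->
  exists s', [/\ inv s', sle s s', sa s' = sa s ++ b & sa' s' = sa' s ++ b'].
Proof.
case: s => a a' c d K [[/= H1 H2 H3] H4 H5 H6 H7] Hsz HA.
exists (State (a ++ b) (a' ++ b') c d K); split=> //.
- by split=> //; split=> //; rewrite !size_cat H1 Hsz.
- split=> //= x y; rewrite /inA /= zip_cat //.
  by move=> H; apply/List.in_app_iff; left.
Qed.

Lemma mem_inA s y : inv s -> List.In y (sa' s) -> exists x, inA s x y.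
Proof.
move=> [[Hsz _ _] _ _ _ _]; rewrite /inA.
elim: (sa s) (sa' s) Hsz => [|u a IH] [|v b] //= [Hsz] [->|/(IH b Hsz) [x Hx]].
- by exists u; left.
- by exists x; right.
Qed.

Lemma step_B s y w : inv s -> exists s', [/\ inv s', sle s s' &
  exists v, inA s' y v /\ (w ∈ v -> exists x, inA s' x w)].
Proof.
move=> Hs; have [[Hsz HK HA] _ _ _ _] := Hs.
have [v Hv] := forward Hsat y Hsz HK HA.
have [|s1 [Hs1 Hle1 E1 E1']] := @step_A s [:: y] [:: v] Hs erefl; first by rewrite !cats1.
have Hin : inA s1 y v.
  by rewrite /inA E1 E1' !cats1; apply/In_zip_rcons; auto.
case: (classic (w ∈ v)) => Hw; last by exists s1; split=> //; exists v.
have [[Hsz1 HK1 HA1] _ _ _ _] := Hs1.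
have [i [Hi _ Ei]] := In_zip w Hsz1 Hin.
have Hwi : w ∈ nth w (sa' s1) i by rewrite Ei.
have [x [_ Hx]] := back collP Hsat Hsz1 HK1 HA1 Hi Hwi.
have [|s2 [Hs2 Hle2 E2 E2']] := @step_A s1 [:: x] [:: w] Hs1 erefl; first by rewrite !cats1.
exists s2; split=> //; first exact: sle_trans Hle1 Hle2.
exists v; split; first by case: Hle2 => H _ _; apply: H.
by move=> _; exists x; rewrite /inA E2 E2' !cats1; apply/In_zip_rcons; auto.
Qed.

Lemma step_C s K y v : inv s -> strans K -> subset_in K (sK s) ->
  reflects (sa s) (sa' s) K -> indisc (rcons (sc s) y) (rcons (sd s) v) K ->
  exists s', [/\ inv s', sle s s', inC s' y v & [/\ sa s' = sa s, sa' s' = sa' s, sK s' = K,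
    sc s' = rcons (sc s) y & sd s' = rcons (sd s) v]].
Proof.
case: s => a a' c d K1 [[/= H1 H2 H3] [H4 H4'] H5 H6 H7] HK Hsub HA HB.
exists (State a a' (rcons c y) (rcons d v) K); split=> //.
- split=> //=; first by rewrite !size_rcons H4.
  + by move=> x /Hsub /H5.
  + by rewrite size_rcons.
  + by move=> x; rewrite !nth_rcons -H4 H6; apply: H7.
- by split=> //= x u Hx; apply/In_zip_rcons => //; left.
- by apply/In_zip_rcons; auto.
Qed.

(** The same formula defines [Y] within [G] over [c] and over [d], and [G] occupies slot 0 on both
    sides; a mention of [Y] can therefore be eliminated. *)
Lemma indisc_add c d K Y (Q : M -> (nat -> M) -> Prop) :
  size c = size d -> 0 < size c -> (forall x, nth x c 0 = G /\ nth x d 0 = G) ->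
  Y ∈ G -> Def Delta0P false (fun e => Q (e 0) (fun n => e n.+1)) ->
  (forall x y, y ∈ G -> (Q y (envl c x) <-> y = Y)) ->
  (forall x y, y ∈ G -> (Q y (envl d x) <-> y = Y)) ->
  indisc c d K -> indisc (rcons c Y) (rcons d Y) K.
Proof.
move=> Hsz H0 HG HY HQ Hc Hd HB f Hf x Hx.
pose l := size c.
pose P (e : nat -> M) := exists y, y ∈ e 0 /\ (Q y e /\ sat (extend l e y (e l)) f).
have HP : Def Delta0P false P.
  apply: Def_exin; first dterm; cbv beta; apply: Def_and => //.
  apply: (@Def_extend M _ _ _ l (fun i e => e i.+1) (fun e => e 0) (fun e => e l.+1)) => //.
  - by move=> j; dterm.
  - by dterm.
  - by dterm.
have E b : size b = l -> (forall x, nth x b 0 = G) ->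
    (forall x y, y ∈ G -> (Q y (envl b x) <-> y = Y)) ->
    P (envl b x) <-> sat (envl (rcons b Y) x) f.
  move=> Hb HbG HbQ.
  have El : envl b x l = x by rewrite /envl nth_default // Hb.
  have EG : envl b x 0 = G by rewrite /envl HbG.
  rewrite /P El EG (envl_rcons b Y x x) Hb; split.
  - by move=> [y [Hy [/(HbQ x y Hy) ->]]].
  - by move=> Hs; exists Y; split=> //; split=> //; apply/HbQ.
rewrite -(E c) //; last by move=> x'; case: (HG x').
rewrite -(E d) //; last by move=> x'; case: (HG x').
exact: (indisc_def HB HP Hx).
Qed.

(** Once [N m] is matched with itself, images of its elements can be chosen inside [N m], which
    keeps the automorphism within [D]. *)
Lemma step_N m s : inv s -> exists s', [/\ inv s', sle s s' & inC s' (N m) (N m)].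
Proof.
elim: m s => [|m IH] s Hs.
  have [[H1 H2 H3] [H4 H4'] H5 H6 H7] := Hs.
  have Hi : indisc (rcons (sc s) (N 0)) (rcons (sd s) (N 0)) (sK s).
    apply: (@indisc_add _ _ _ _ (fun y e => forall x, x ∈ e 0 -> ~ x ∈ y)) => //.
    - by ddef.
    - by move=> x y Hy; rewrite /envl (proj1 (H7 x)); apply: N0_def.
    - by move=> x y Hy; rewrite /envl (proj2 (H7 x)); apply: N0_def.
  have [s' [Hs' Hle Hin _]] := step_C Hs H2 (fun x Hx => Hx) H3 Hi.
  by exists s'.
have [s1 [Hs1 Hle1 Hin1]] := IH s Hs.
have [[H1 H2 H3] [H4 H4'] H5 H6 H7] := Hs1.
have [i [Hi Ei Ei']] := In_zip K0 H4 Hin1.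
have Hi' : i < size (sd s1) by rewrite -H4.
have Hind : indisc (rcons (sc s1) (N m.+1)) (rcons (sd s1) (N m.+1)) (sK s1).
  apply: (@indisc_add _ _ _ _ (fun y e => e i ∈ y /\
    forall x, x ∈ e 0 -> x ∈ y -> x = e i \/ x ∈ e i)) => //.
  - by ddef.
  - move=> x y Hy; rewrite /envl (proj1 (H7 x)) (set_nth_default K0) // Ei.
    exact: NS_def.
  - move=> x y Hy; rewrite /envl (proj2 (H7 x)) (set_nth_default K0) // Ei'.
    exact: NS_def.
have [s' [Hs' Hle Hin _]] := step_C Hs1 H2 (fun x Hx => Hx) H3 Hind.
by exists s'; split=> //; apply: sle_trans Hle1 Hle.
Qed.

(** The conditions on [sc] and [sd] are symmetric, so surjectivity of the automorphism comes from
    the totality step with the two exchanged. *)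
Definition sswap s := State (sa s) (sa' s) (sd s) (sc s) (sK s).

Lemma inv_swap s : inv s -> inv (sswap s).
Proof.
move=> [H1 [H2 H3] H4 H5 H6]; split=> //=; first by split=> //; apply: indisc_sym.
- by rewrite -H2.
- by move=> x; case: (H6 x).
Qed.

Lemma inC_swap s x y : inC (sswap s) x y <-> inC s y x.
Proof.
rewrite /inC /=; elim: (sc s) (sd s) => [|u c IH] [|v d] //=.
by rewrite IH; split=> [[[-> ->]|]|[[-> ->]|]]; auto.
Qed.

Lemma sle_swap s s' : sle (sswap s) s' -> sle s (sswap s').
Proof.
move=> [H1 H2 H3]; split=> // x y Hxy; apply/inC_swap; apply: H2.
exact/inC_swap.
Qed.

Lemma step_J s x : inv s -> D x ->
  exists s', [/\ inv s', sle s s' & exists v, inC s' x v /\ D v].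
Proof.
move=> Hs [m Hm]; have [s1 [Hs1 Hle1 Hin1]] := step_N m Hs.
have [[H1 H2 H3] [H4 H4'] H5 H6 H7] := Hs1.
have [i [Hi Ei Ei']] := In_zip x H4 Hin1.
have Hxi : x ∈ nth x (sc s1) i by rewrite Ei.
have [v [K' [HK' Hsub HA Hv HB]]] := extend_auto Hsat o_empty H1 H4 H2 H3 H4' Hi Hxi.
have [s' [Hs' Hle Hin _]] := step_C Hs1 HK' Hsub HA HB.
exists s'; split=> //; first exact: sle_trans Hle1 Hle.
by exists v; split=> //; exists m; rewrite Ei' in Hv.
Qed.

Lemma step_Jb s x : inv s -> D x ->
  exists s', [/\ inv s', sle s s' & exists v, inC s' v x /\ D v].
Proof.
move=> /inv_swap Hs Dx; have [s' [Hs' Hle [v [Hv Dv]]]] := step_J Hs Dx.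
exists (sswap s'); split; [exact: inv_swap|exact: sle_swap|].
by exists v; split=> //; apply/inC_swap.
Qed.

Lemma step_M s x : inv s -> D x -> exists s', [/\ inv s', sle s s' &
  (exists y, inA s' y x) \/ exists y v, [/\ inC s' y v, y ∈ tcf x & ~ y = v]].
Proof.
move=> Hs Dx; have [[m Hm] Htr Hx] := tcf_ok Dx.
have [s1 [Hs1 Hle1 Hin1]] := step_N m Hs.
have [[H1 H2 H3] [H4 H4'] H5 H6 H7] := Hs1.
have [i [Hi Ei Ei']] := In_zip x H4 Hin1.
case: (decide collP Hsat H1 H2 H3 Htr Hx) => [[k [Hk HP3 HA Hno]]|[b [b' [Hsz HA Hin]]]];
  last first.
  have [s2 [Hs2 Hle2 E2 E2']] := step_A Hs1 Hsz HA.
  exists s2; split=> //; first exact: sle_trans Hle1 Hle2.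
  by left; apply: mem_inA => //; rewrite E2'; apply/List.in_app_iff; right.
have Hsub : subset_in k (sK s1).
  have A2 : Pw (Pw k) ∈ sK s1 by apply: H2.1 _ HP3 _ (Pw_self _).
  have A1 : Pw k ∈ sK s1 by apply: H2.1 _ A2 _ (Pw_self _).
  by apply: H2.1; apply: H2.1 _ A1 _ (Pw_self _).
have Hnum n : num o n ∈ k by apply: num_mem H1 HA.
have [v1 [v2 [Hv1 Hv2 Hne HB12]]] := same_type Hsat o_empty (sc s1) Hnum Hno.
have HBk : indisc (sc s1) (sd s1) k := indisc_mono Hsub H4'.
have Hv1i : v1 ∈ nth v1 (sc s1) i.
  by rewrite (set_nth_default x) // Ei; apply: N_trans Hm _ Hv1.
have [v [K' [HK' Hsub' HA' Hv HB]]] := extend_auto Hsat o_empty H1 H4 Hk HA HBk Hi Hv1i.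
have HsubK : subset_in K' (sK s1) by move=> u /Hsub' /Hsub.
(* If [v1] goes to itself, its twin [v2] is sent to [v] instead: [v2] has the same type over [K']
   and differs from [v]. *)
case: (classic (v1 = v)) => Hvv; last first.
  have [s2 [Hs2 Hle2 Hin _]] := step_C Hs1 HK' HsubK HA' HB.
  exists s2; split=> //; first exact: sle_trans Hle1 Hle2.
  by right; exists v1, v.
have HB2 : indisc (rcons (sc s1) v2) (rcons (sd s1) v) K'.
  by move=> f Hf u Hu; rewrite -(HB12 f Hf u (Hsub' _ Hu)); apply: HB.
have [s2 [Hs2 Hle2 Hin _]] := step_C Hs1 HK' HsubK HA' HB2.
exists s2; split=> //; first exact: sle_trans Hle1 Hle2.
by right; exists v2, v; split=> // E; apply: Hne; rewrite Hvv E.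
Qed.

Definition req x y s := (exists v, inA s x v /\ (y ∈ v -> exists u, inA s u y)) /\
  (D x -> [/\ exists v, inC s x v /\ D v, exists v, inC s v x /\ D v &
     (exists u, inA s u x) \/ exists u v, [/\ inC s u v, u ∈ tcf x & ~ u = v]]).

Lemma step_req x y s : inv s -> exists s', [/\ inv s', sle s s' & req x y s'].
Proof.
move=> Hs; have [s1 [Hs1 Hle1 Hr1]] := step_B x y Hs.
case: (classic (D x)) => Dx; last by exists s1; split.
have [s2 [Hs2 Hle2 Hr2]] := step_J Hs1 Dx.
have [s3 [Hs3 Hle3 Hr3]] := step_Jb Hs2 Dx.
have [s4 [Hs4 Hle4 Hr4]] := step_M Hs3 Dx.
have L34 := Hle4; have L24 := sle_trans Hle3 Hle4; have L14 := sle_trans Hle2 L24.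
exists s4; split=> //; first exact: sle_trans Hle1 L14.
split.
  have [v [Hv Hy]] := Hr1; have [H _ _] := L14.
  by exists v; split; [apply: H|move=> /Hy [u Hu]; exists u; apply: H].
move=> _; split=> //.
- by have [v [Hv Dv]] := Hr2; have [_ H _] := L24; exists v; split=> //; apply: H.
- by have [v [Hv Dv]] := Hr3; have [_ H _] := L34; exists v; split=> //; apply: H.
Qed.

(** Stage [n] serves the pair of elements coded by [n]. One visit suffices, because later states
    preserve the pairs already entered. *)
Definition reqn n s := forall x y, g x = hdn n -> g y = tln n -> req x y s.

Lemma step_n n (s : {s | inv s}) : exists s' : {s | inv s},
  sle (sval s) (sval s') /\ reqn n (sval s').
Proof.
case: s => s Hs /=.
case: (classic (exists x y, g x = hdn n /\ g y = tln n)) => [[x [y [Ex Ey]]]|HN].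
- have [s' [Hs' Hle Hr]] := step_req x y Hs; exists (exist _ s' Hs'); split=> //.
  by move=> x' y' /=; rewrite -Ex -Ey => /g_inj -> /g_inj ->.
- exists (exist _ s Hs); split; first exact: sle_refl.
  by move=> x y Ex Ey; case: HN; exists x, y.
Qed.

Lemma init_inv : inv (State [::] [::] [:: G] [:: G] K0).
Proof. by split=> //; split. Qed.

Fixpoint seqs n : {s | inv s} :=
  if n is m.+1 then
    proj1_sig (constructive_indefinite_description _ (step_n m (seqs m)))
  else exist _ _ init_inv.

Let st n := sval (seqs n).

Lemma st_step n : sle (st n) (st n.+1) /\ reqn n (st n.+1).
Proof. by rewrite /st /=; case: constructive_indefinite_description. Qed.

Lemma st_le n m : n <= m -> sle (st n) (st m).
Proof.
elim: m => [|m IH]; first by rewrite leqn0 => /eqP ->; apply: sle_refl.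
rewrite leq_eqVlt => /orP[/eqP -> |/IH H]; first exact: sle_refl.
by apply: sle_trans H _; case: (st_step m).
Qed.

Lemma st_inv n : inv (st n).
Proof. exact: proj2_sig. Qed.

Definition emb x y := exists n, inA (st n) x y.
Definition aut x y := exists n, inC (st n) x y.

Lemma req_all x y : exists n, req x y (st n).
Proof.
exists (consn (g x) (g y)).+1; have [_ H] := st_step (consn (g x) (g y)).
by apply: H; rewrite ?hdn_consn ?tln_consn.
Qed.

Lemma emb_idx x y x' y' : emb x y -> emb x' y' -> exists n i j,
  [/\ i < size (sa (st n)), j < size (sa (st n)) &
   forall z, [/\ envl (sa (st n)) z i = x, envl (sa' (st n)) z i = y,
                 envl (sa (st n)) z j = x' & envl (sa' (st n)) z j = y']].
Proof.
move=> [n Hn] [m Hm]; exists (n + m).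
have [H1 _ _] := st_le (leq_addr m n); have [H2 _ _] := st_le (leq_addl n m).
have [[Hsz _ _] _ _ _ _] := st_inv (n + m).
have [i [Hi Ei Ei']] := In_zip x Hsz (H1 _ _ Hn).
have [j [Hj Ej Ej']] := In_zip x Hsz (H2 _ _ Hm).
exists i, j; split=> // z; rewrite /envl !(set_nth_default x) -?Hsz //.
Qed.

(** Reflection applied to a formula and to its negation gives an equivalence. The formula ignores
    the free slot, so the place of the witness is immaterial. *)
Lemma emb_def (P : (nat -> M) -> Prop) n z z' : Def Delta0P false P ->
  (forall u, P (envl (sa (st n)) u) <-> P (envl (sa (st n)) z)) ->
  (forall u, P (envl (sa' (st n)) u) <-> P (envl (sa' (st n)) z')) ->
  P (envl (sa (st n)) z) <-> P (envl (sa' (st n)) z').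
Proof.
move=> HP E E'; have [[_ _ HA] _ _ _ _] := st_inv n.
split=> H.
- by have [u [_ /E']] := reflects_def HA HP H.
- apply: NNPP => HN.
  by have [u [_]] := reflects_def HA (Def_not HP) HN; rewrite E'; apply.
Qed.

Lemma emb_mem x y x' y' : emb x y -> emb x' y' -> (x ∈ x' <-> y ∈ y').
Proof.
move=> Hx Hy; have [n [i [j [Hi Hj E]]]] := emb_idx Hx Hy.
have HP : Def Delta0P false (fun e : nat -> M => e i ∈ e j) by ddef.
have [E1 E2 E3 E4] := E x; rewrite -{1}E1 -{1}E3 -{1}E2 -{1}E4.
apply: (emb_def (P := fun e => e i ∈ e j) (z := x) (z' := x) HP) => u;
  by have [F1 F2 F3 F4] := E u; rewrite ?F1 ?F2 ?F3 ?F4 ?E1 ?E2 ?E3 ?E4.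
Qed.

Lemma emb_eq x y x' y' : emb x y -> emb x' y' -> (x = x' <-> y = y').
Proof.
move=> Hx Hy; have [n [i [j [Hi Hj E]]]] := emb_idx Hx Hy.
have HP : Def Delta0P false (fun e : nat -> M => e i = e j) by ddef.
have [E1 E2 E3 E4] := E x; rewrite -{1}E1 -{1}E3 -{1}E2 -{1}E4.
apply: (emb_def (P := fun e => e i = e j) (z := x) (z' := x) HP) => u;
  by have [F1 F2 F3 F4] := E u; rewrite ?F1 ?F2 ?F3 ?F4 ?E1 ?E2 ?E3 ?E4.
Qed.

Lemma emb_trans x y : emb x y -> transitive_in x -> transitive_in y.
Proof.
move=> Hx; have [n [i [j [Hi Hj E]]]] := emb_idx Hx Hx.
have HP : Def Delta0P false (fun e : nat -> M => transitive_in (e i)) by ddef.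
have [E1 E2 _ _] := E x; rewrite -{1}E1 -{1}E2.
apply: (proj1 (emb_def (P := fun e => transitive_in (e i)) (z := x) (z' := x) HP _ _)) => u;
  by have [F1 F2 _ _] := E u; rewrite ?F1 ?F2 ?E1 ?E2.
Qed.

Lemma emb_total x : exists y, emb x y.
Proof. by have [n [[v [Hv _]] _]] := req_all x x; exists v, n. Qed.

Definition J y := exists x, emb x y.

Lemma J_mem y w : J y -> w ∈ y -> J w.
Proof.
move=> [x Hx] Hw; have [n [[v [Hv H]] _]] := req_all x w.
have Hxv : emb x v by exists n.
have E : v = y by apply/(emb_eq Hxv Hx).
by subst v; have [u Hu] := H Hw; exists u, n.
Qed.

(** The equation between the free slot and the entry for [x] has [y] as its only solution on the
    side of the image, so [y] belongs to every set over which reflection holds. *)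
Lemma J_K y n : J y -> y ∈ sK (st n).
Proof.
move=> [x [m Hm]]; have [H1 _ H2] := st_le (leq_addr m n).
have [H1' _ _] := st_le (leq_addl n m).
have [[Hsz _ HA] _ _ _ _] := st_inv (n + m).
have [i [Hi Ei Ei']] := In_zip x Hsz (H1' _ _ Hm).
apply: H2; set s := st (n + m) in Hsz HA Hi Ei Ei' *.
have HP : Def Delta0P false (fun e : nat -> M => e (size (sa s)) = e i) by ddef.
have [|u [Hu]] := reflects_def (x := x) HA HP.
  by rewrite /envl nth_default // Ei.
by rewrite /envl nth_default ?Hsz // (set_nth_default x) -?Hsz // Ei' => <-.
Qed.

Lemma J_D y : J y -> D y.
Proof.
move=> Hy; have H := J_K 0 Hy; exists 0; apply: N_trans K0_N _ _; exact: H.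
Qed.

Lemma J_K0 : ~ J K0.
Proof. by move=> H; have := J_K 0 H; apply: mem_irrefl. Qed.

Lemma aut_idx x y x' y' : aut x y -> aut x' y' -> exists n i j,
  forall z, [/\ envl (sc (st n)) z i = x, envl (sd (st n)) z i = y,
                 envl (sc (st n)) z j = x' & envl (sd (st n)) z j = y'].
Proof.
move=> [n Hn] [m Hm]; exists (n + m).
have [_ H1 _] := st_le (leq_addr m n); have [_ H2 _] := st_le (leq_addl n m).
have [_ [Hsz _] _ _ _] := st_inv (n + m).
have [i [Hi Ei Ei']] := In_zip x Hsz (H1 _ _ Hn).
have [j [Hj Ej Ej']] := In_zip x Hsz (H2 _ _ Hm).
by exists i, j => z; rewrite /envl !(set_nth_default x) -?Hsz.
Qed.

Lemma aut_def (P : (nat -> M) -> Prop) n : Def Delta0P false P ->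
  exists z, P (envl (sc (st n)) z) <-> P (envl (sd (st n)) z).
Proof.
move=> HP; have [[Hsz _ HA] [_ HB] _ _ _] := st_inv n.
have [x Hx] := emb_total K0; exists x.
by apply: (indisc_def HB HP); apply: J_K; exists K0.
Qed.

Lemma aut_mem x y x' y' : aut x y -> aut x' y' -> (x ∈ x' <-> y ∈ y').
Proof.
move=> Hx Hy; have [n [i [j E]]] := aut_idx Hx Hy.
have [|z] := @aut_def (fun e => e i ∈ e j) n; first by ddef.
by have [-> -> -> ->] := E z.
Qed.

Lemma aut_eq x y x' y' : aut x y -> aut x' y' -> (x = x' <-> y = y').
Proof.
move=> Hx Hy; have [n [i [j E]]] := aut_idx Hx Hy.
have [|z] := @aut_def (fun e => e i = e j) n; first by ddef.
by have [-> -> -> ->] := E z.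
Qed.

(** Being in [sK], the element [x] may fill the free slot, and its equation with the entry for [x]
    passes from [sc] to [sd]. *)
Lemma aut_J x y : aut x y -> J x -> x = y.
Proof.
move=> Hx Jx; have [n [i [j E]]] := aut_idx Hx Hx.
have [_ [Hsz HB] _ _ _] := st_inv n.
pose l := size (sc (st n)).
have HP : Def Delta0P false (fun e : nat -> M => e i = e l) by ddef.
have := indisc_def HB HP (J_K n Jx).
have [E1 E2 _ _] := E x; rewrite E1 E2.
have -> : envl (sc (st n)) x l = x by rewrite /envl nth_default.
have -> : envl (sd (st n)) x l = x by rewrite /envl nth_default // -Hsz.
by move=> [H _]; rewrite H.
Qed.

Lemma aut_total x : D x -> exists y, aut x y /\ D y.
Proof. by move=> Dx; have [n [_ /(_ Dx) [[v [Hv Dv]] _ _]]] := req_all x x; exists v; split=> //; exists n. Qed.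

Lemma aut_onto x : D x -> exists y, aut y x /\ D y.
Proof. by move=> Dx; have [n [_ /(_ Dx) [_ [v [Hv Dv]] _]]] := req_all x x; exists v; split=> //; exists n. Qed.

Lemma aut_moves x : D x -> J x \/ exists y v, [/\ aut y v, y ∈ tcf x & ~ y = v].
Proof.
move=> Dx; have [n [_ /(_ Dx) [_ _ H]]] := req_all x x.
case: H => [[u Hu]|[u [v [H1 H2 H3]]]]; first by left; exists u, n.
by right; exists u, v; split=> //; exists n.
Qed.

Theorem back_and_forth : exists emb aut : M -> M -> Prop,
  [/\ [/\ forall x, exists y, emb x y,
        forall x y x' y', emb x y -> emb x' y' -> (x ∈ x' <-> y ∈ y') /\ (x = x' <-> y = y'),
        forall x y, emb x y -> transitive_in x -> transitive_in y,
        forall x y w, emb x y -> w ∈ y -> exists u, emb u w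
      & forall x y, emb x y -> D y /\ ~ y = K0],
      forall x y x' y', aut x y -> aut x' y' -> (x ∈ x' <-> y ∈ y') /\ (x = x' <-> y = y'),
      forall x, D x -> (exists y, aut x y /\ D y) /\ (exists y, aut y x /\ D y),
      forall x y z, emb z x -> aut x y -> x = y
    & forall x, D x -> (exists z, emb z x) \/
        exists y v, [/\ aut y v, y ∈ tcf x & ~ y = v]].
Proof.
exists emb, aut; split.
- split.
  + exact: emb_total.
  + by move=> x y x' y' H H'; split; [apply: emb_mem|apply: emb_eq].
  + exact: emb_trans.
  + by move=> x y w Hx; apply: J_mem; exists x.
  + move=> x y Hx; split; first by apply: J_D; exists x.
    by move=> E; subst y; apply: J_K0; exists x.
- by move=> x y x' y' H H'; split; [apply: aut_mem|apply: aut_eq].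
- by move=> x Dx; split; [apply: aut_total|apply: aut_onto].
- by move=> x y z Hz H; apply: aut_J => //; exists z.
- exact: aut_moves.
Qed.

End Assembly.

Lemma inj_surj_bij (A B : Type) (f : A -> B) :
  injective f -> (forall y, exists x, f x = y) -> bijective f.
Proof.
move=> Hi Hs.
pose h y := proj1_sig (constructive_indefinite_description _ (Hs y)).
have hK y : f (h y) = y by rewrite /h; case: constructive_indefinite_description.
by exists h => [x|y]; [apply: Hi; rewrite hK|exact: hK].
Qed.

Lemma choice_fun (A B : Type) (R : A -> B -> Prop) :
  (forall x, exists y, R x y) -> exists f, forall x, R x (f x).
Proof.
move=> H; exists (fun x => proj1_sig (constructive_indefinite_description _ (H x))) => x.
by case: constructive_indefinite_description.
Qed.

(** Finitely many satisfiable formulas have witnesses in one supertransitive set; saturation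
    provides a set for all formulas. It starts the back-and-forth with empty tuples. *)
Lemma reflecting_set (M : Lstructure) {HM : isMOST M} : recursively_saturated M ->
  exists K : M, strans K /\ reflects [::] [::] K.
Proof.
move=> Hsat.
have [o _] : exists o : M, is_empty o.
  by have [[_ [_ [H3 _]]] _ _] := (most_ax : MOST M).
have HP : Def FO true (fun e : nat -> M => strans (e 0)).
  by apply: (@Def_FO Delta0P); apply: Def_strans; dterm.
have [n|av [HPa Hav]] := @saturationA M 1 o (fun e => strans (e 0))
  [::] [::] (inl 0) Hsat HP.
  have [k [Hk Hn]] := pre_small (M := M) [::] n.
  by exists [tuple k]; split=> // i Hi; apply: Hn.
case: av HPa Hav => -[//|k [|//]] Hs; rewrite /venv /= => Hk Hav.
by exists k; split=> //; apply/reflects_gen.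
Qed.

Lemma reflecting_infinity (M : Lstructure) {HM : isMOST M} (K : M) :
  reflects [::] [::] K -> exists X o, [/\ X ∈ K, o ∈ X, is_empty o &
    forall y, y ∈ X -> exists w, w ∈ X /\ is_succ w y].
Proof.
move=> HA.
have [[_ [_ [_ [_ [[X [HX1 HX2]] _]]]]] _ _] := (most_ax : MOST M).
pose P (e : nat -> M) := (exists y, y ∈ e 0 /\ forall z, z ∈ y -> False) /\
  forall y, y ∈ e 0 -> exists w, w ∈ e 0 /\ is_succ w y.
have HP : Def Delta0P false P by rewrite /P; ddef; apply: Def_succ; dterm.
have [|X' [HX' [[o [Ho1 Ho2]] HS]]] := reflects_def (x := X) HA HP; first by split.
by exists X', o; split.
Qed.

Theorem fixed_segment_realised (I : Lstructure) : countable_structure I ->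
  recursively_saturated I -> MOST I -> Collection I Delta0P ->
  exists (M : Lstructure) (j : M -> M),
    [/\ MOST M, automorphism j, nontrivial j & isomorphic (Ifix j) I].
Proof.
move=> [g g_inj] Hsat HMI collP; have HM : isMOST I := HMI.
have [K0 [HK0 HA0]] := reflecting_set Hsat.
have [X [o [XK0 oX o_e X_s]]] := reflecting_infinity HA0.
have [G [chG longG]] := long_chain Hsat K0.
pose D : I -> Prop := @std I HM K0 G chG longG.
have gD : good D := std_good chG longG XK0 oX o_e X_s.
pose M := substructure D.
have HMM : isMOST M by exact: proj1 (good_MOST gD).
have Dsv (x : M) : D (sval x) := proj2_sig x.
have [tcm Htcm] := choice_fun (fun x : M => TC_singleton_exists x).
have tc_trans (x : M) : transitive_in (sval (tcm x)).
  have [Ht _ _] := Htcm x => y Hy z Hz.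
  have Dy : D y := g_trans gD (Dsv (tcm x)) Hy.
  have Dz : D z := g_trans gD Dy Hz.
  exact: (Ht (exist _ y Dy) Hy (exist _ z Dz) Hz).
(* Transitive closures are taken in [M] and transported to [I]; outside [D] the value is
   arbitrary. *)
have [tcf Htcf] : exists tcf : I -> I, forall x (x' : M), sval x' = x -> tcf x = sval (tcm x').
  apply: (choice_fun (R := fun x t => forall x' : M, sval x' = x -> t = sval (tcm x'))) => x.
  case: (classic (D x)) => Dx; last by exists x => x' E; case: Dx; rewrite -E.
  by exists (sval (tcm (exist _ x Dx))) => x' E; congr (sval (tcm _)); apply: sval_inj.
have tcf_ok x : D x -> [/\ D (tcf x), transitive_in (tcf x) & x ∈ tcf x].
  move=> Dx; rewrite (Htcf x (exist _ x Dx) erefl); split=> //.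
  by case: (Htcm (exist _ x Dx)).
have [K0N _ _] := far_levels (HM := HM) (N0_far chG longG).
have [emb [aut [[e1 e2 e3 e4 e5] a1 a2 a3 a4]]] :=
  @back_and_forth I HM collP Hsat o K0 G (N chG longG) tcf g o_e
    (fun n => lev_G (levN chG longG n)) (@N0_uniq I HM K0 G chG longG)
    (@N_next_uniq I HM K0 G chG longG) (fun n => (N_strans chG longG n).1)
    K0N HK0 HA0 g_inj tcf_ok.
have [j Hj] : exists j : M -> M, forall x, aut (sval x) (sval (j x)).
  apply: (choice_fun (R := fun x y : M => aut (sval x) (sval y))) => x.
  have [[y [Hy Dy]] _] := a2 _ (Dsv x).
  by exists (exist _ y Dy).
have j_val (x : M) y : aut (sval x) y -> sval (j x) = y.
  by move=> H; have [_ [H1 _]] := a1 _ _ _ _ (Hj x) H; apply: H1.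
have j_J (x : M) z : emb z (sval x) -> j x = x.
  by move=> H; apply: sval_inj; apply: esym (a3 _ _ _ H (Hj x)).
have moved (x : M) : (exists z, emb z (sval x)) \/ exists y : M, in_TC_singleton y x /\ j y <> y.
  case: (a4 _ (Dsv x)) => [H|[y [v [Hyv Hy Hne]]]]; [by left|right].
  rewrite (Htcf _ x erefl) in Hy.
  have Dy : D y := g_trans gD (Dsv (tcm x)) Hy.
  exists (exist _ y Dy); split; first by exists (tcm x).
  move=> E; apply: Hne; rewrite -(@j_val (exist _ y Dy) v Hyv).
  by rewrite E.
exists M, j; split.
- exact: HMM.
- split; last by move=> x y; have [H _] := a1 _ _ _ _ (Hj x) (Hj y); rewrite [X in X <-> _]/= -H.
  apply: inj_surj_bij.
    move=> x y E; apply: sval_inj; have [_ [_ H]] := a1 _ _ _ _ (Hj x) (Hj y).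
    by apply: H; rewrite E.
  move=> y; have [_ [x [Hx Dx]]] := a2 _ (Dsv y); exists (exist _ x Dx).
  by apply: sval_inj; apply: j_val.
(* The image of the embedding lies inside [K0], so [K0] is not in it and its transitive closure
   contains a moved element. *)
- have DK0 : D K0 by exists 0.
  case: (moved (exist _ K0 DK0)) => [[z /= Hz]|[y [_ Hy]]]; last by exists y.
  by case: (e5 _ _ Hz).
have HJ (x : Ifix j) : exists z, emb z (sval (sval x)).
  case: x => x Hx /=; case: (moved x) => // -[y [Hy Hne]].
  by case: Hne; apply: Hx.
have [f Hf] := choice_fun HJ.
exists f; split; last first.
  by move=> x y; have [H _] := e2 _ _ _ _ (Hf x) (Hf y); rewrite H.
apply: inj_surj_bij.
  move=> x y E; have [_ [H _]] := e2 _ _ _ _ (Hf x) (Hf y).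
  by apply: sval_inj; apply: sval_inj; apply: H.
move=> z; have [y Hy] := e1 z; have [Dy _] := e5 _ _ Hy.
(* The image [t1] of a transitive set around [z] is transitive, contains [y] and is fixed pointwise,
   so it covers the transitive closure of [y] computed in [M]. *)
have Hfix (u : M) : in_TC_singleton u (exist _ y Dy : M) -> j u = u.
  move=> [t [[_ _ Hmin] Hu]].
  have [t0 [Ht0 Hzt0]] := tc_exists z; have [t1 Ht1] := e1 t0.
  have [Dt1 _] := e5 _ _ Ht1.
  have Hs : subset_in t (exist _ t1 Dt1 : M).
    apply: Hmin; last by have [H _] := e2 _ _ _ _ Hy Ht1; apply/H.
    by move=> p Hp q Hq; exact: (e3 _ _ Ht1 Ht0 _ Hp _ Hq).
  by have [w Hw] := e4 _ _ _ Ht1 (Hs u Hu); apply: j_J Hw.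
exists (exist _ (exist _ y Dy : M) Hfix).
by have [_ [_ H]] := e2 _ _ _ _ (Hf (exist _ (exist _ y Dy : M) Hfix)) Hy; apply: H.
Qed.

Theorem theorem5p7 (I : Lstructure)
  (hcount : countable_structure I)
  (hsat : recursively_saturated I)
  (hinf : Infinity I) :
  (MOST I /\ Collection I Delta0P) <->
  (exists (M : Lstructure) (j : M -> M),
     [/\ MOST M, automorphism j, nontrivial j & isomorphic (Ifix j) I]).
Proof.
split; first by move=> [HM HC]; apply: fixed_segment_realised.
move=> [M [j [HM j_aut j_nt [f [f_bij f_mem]]]]].
have HMM : isMOST M := HM.
have Hinf : Infinity (Ifix j).
  have [h fK hK] := f_bij.
  apply: (iso_infinity (f := h)) hinf; first by exists f.
  by move=> x y; rewrite -f_mem !hK.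
have [H1 H2] := good_MOST (fixed_good j_aut j_nt Hinf).
by split; [apply: iso_MOST f_bij f_mem H1|apply: iso_coll f_bij f_mem _ H2].
Qed.
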